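(* Let $a, d_1,\dots,d_k,\overline{d}_1,\dots,\overline{d}_t,d'_1,\dots,d'_l$ be positive integers for which the region $\mathcal{O}:=\mathcal{O}_{a}(d_1,\dots,d_k;\ \overline{d}_1,\dots,\overline{d}_t;\ d'_1,\dots,d'_l)$ is a quasi-octagon having upper, middle and lower heights $h_1,h_2,h_3$, respectively, and upper and lower widths $w_1,w_2$, respectively. Assume in addition that $w_1>w_2$, $h_1<w_1$, $h_2<w_2$ and $h_3<w_2$. Let $\mathcal{C}_1$ be the number of black regular cells in the upper part, $\mathcal{C}_2$ the number of white regular cells in the middle part, and $\mathcal{C}_3$ the number of black regular cells in the lower part of the region. Let $\operatorname{M}(\mathcal{O})$ denote the number of tilings of $\mathcal{O}$. Then: (a) If $h_1+h_3\neq w_1+h_2$, then $\operatorname{M}(\mathcal{O})=0$. (b) If $h_1+h_3=w_1+h_2$, then $$\operatorname{M}(\mathcal{O})=2^{\mathcal{C}_1+\mathcal{C}_2+\mathcal{C}_3-h_1(2w_1-h_1+1)/2-h_2(2w_2-h_2+1)/2-h_3(2w_2-h_3+1)/2}$$ $$\times\sum_{(A,B)}\frac{\Delta\big([h_2+2w_1-w_2]\setminus(h_2+w_1-w_2+B)\big)}{\Delta\big([h_1+h_2+w_1-w_2]\big)}\cdot\frac{\Delta\big([w_2+h_2]\setminus(h_2+A)\big)}{\Delta\big([h_2+h_3]\big)},$$ where the sum is taken over all pairs of disjoint sets $A$ and $B$ such that $A\cup B=[w_2-h_2]$, $|A|=w_2-h_3$ and $|B|=w_1-h_1$.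
   Context: **Notation.** For a finite set of integers $S=\{s_1<s_2<\dots<s_k\}$, $\Delta(S):=\prod_{1\le i<j\le k}(s_j-s_i)$ (empty product equal to $1$). For a positive integer $n$, $[n]:=\{1,2,\dots,n\}$. For a number $x$ and a set of numbers $A$, $x+A:=\{y+x : y\in A\}$. **Diagonals.** Work on the square lattice $\mathbb{Z}^2$ (unit squares). A lattice diagonal is a line $y=x+c$ with $c\in\mathbb{Z}$ (southwest-to-northeast); distances between diagonals are measured in units of $\sqrt2/2$, so $y=x+c$ and $y=x+c'$ are at distance $|c-c'|$; a diagonal is ''above'' another if its $c$ is larger. Given positive integers $d_1,\dots,d_k$, $\overline d_1,\dots,\overline d_t$, $d'_1,\dots,d'_l$ ($k,t,l\ge 1$), draw in: two distinguished diagonals $\ell$ and $\ell'$, with $\ell'$ below $\ell$; $k$ diagonals above $\ell$ such that the successive distances, starting from the top one and ending at $\ell$, are $d_1,\dots,d_k$; $l$ diagonals below $\ell'$ such that the successive distances, starting from the bottom one and ending at $\ell'$, are $d'_1,\dots,d'_l$; and $t-1$ diagonals between $\ell$ and $\ell'$ such that the successive distances from $\ell$ down to $\ell'$ are $\overline d_1,\dots,\overline d_t$. The drawn-in diagonals cut the unit squares they pass through into two triangles; the resulting pieces (unit squares and triangles) are the fundamental regions. Color them black and white so that any two sharing an edge have opposite colors, and so that the triangles pointing toward $\ell$ with bases on the top drawn-in diagonal are white. **Quasi-octagon.** Let $A$ be a lattice point on the top diagonal. Draw a lattice path from $A$ with unit steps south or east such that at each step the black fundamental region is on the right, until it meets $\ell$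 at a lattice point $B$; continue from $B$ in the same fashion, but with the black fundamental region on the left at each step, until a lattice point $C\in\ell'$; continue from $C$, with the black fundamental region on the right at each step, until a lattice point $D$ on the bottom diagonal. This path is the northeastern boundary. Let $H$ be the lattice point on the top diagonal to the left of $A$ with $|AH|=a\sqrt2$. The southwestern boundary, from $H$ through $G\in\ell$ and $F\in\ell'$ to $E$ on the bottom diagonal, is the reflection of the northeastern boundary in the perpendicular bisector of $AH$. The segments $AH$ and $DE$ complete the boundary (the two boundary paths are assumed not to meet). The enclosed region is the quasi-octagon $\mathcal{O}_a(d_1,\dots,d_k;\overline d_1,\dots,\overline d_t;d'_1,\dots,d'_l)$. (The points $A,B$ here are unrelated to the sets $A,B$ in the claim.) Standing assumption: the triangular fundamental regions inside the region running along the bottom diagonal are white (equivalently, the last step of the southwestern boundary is an east step). **Cells, heights, widths.** The fundamental regions inside the quasi-octagon are its cells. A cell is regular if it is a square cell or a triangular cell pointing away from $\ell'$. A row of cells consists of all triangular cells of a given color with bases resting on a fixed lattice diagonal, or of all square cells of a given color passed through by a fixed lattice diagonal. The upper, middle and lower parts are the portions of the region above $\ell$, between $\ell$ and $\ell'$, and below $\ell'$. The upper height $h_1$ and lower height $h_3$ are the numbers of rows of black regular cells in the upper and lower parts; the middle height $h_2$ is the number of rows of white regular cells in the middle part. The upper width is $w_1=|BG|/\sqrt2$ and the lower width is $w_2=|CF|/\sqrt2$ (Euclidean lengths). **Tilings.** A tile is the union of two fundamental regions sharing an edge. A tiling of a region is a covering of the region by tiles with no gaps or overlaps. *)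

(* Defs.v *)
From HB Require Import structures.
From mathcomp Require Import all_boot all_order all_algebra finmap.

Set Implicit Arguments.
Unset Strict Implicit.
Unset Printing Implicit Defensive.

Import Order.TTheory GRing.Theory Num.Theory.
Local Open Scope fset_scope.
Local Open Scope ring_scope.

Notation point := (int * int)%type.
Notation edge := (point * point)%type.

(* [diag p] is the c such that p lies on the lattice diagonal y = x + c. *)
Definition diag (p : point) : int := p.2 - p.1.

(* A unit square is represented by its lower-left corner p; [diag p] is then
   also the index of the lattice diagonal that passes through the square.
   That diagonal cuts it into the triangle [Upper] (above the diagonal, pointing
   up-left) and the triangle [Lower] (below the diagonal, pointing
   down-right). *)
Inductive shape := Square | Upper | Lower.

Definition shape_code (s : shape) : option bool :=
  match s with Square => None | Upper => Some true | Lower => Some false end.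
Definition shape_decode (o : option bool) : shape :=
  match o with None => Square | Some true => Upper | Some false => Lower end.
Lemma shape_codeK : cancel shape_code shape_decode.
Proof. by case. Qed.
HB.instance Definition _ := Countable.copy shape (can_type shape_codeK).

Notation cell := (point * shape)%type.

(* Edges are listed with their left (resp. lower) endpoint first. *)
Definition edges (x : cell) : seq edge :=
  let: ((i, j), s) := x in
  let left := ((i, j), (i, j + 1)) in
  let right := ((i + 1, j), (i + 1, j + 1)) in
  let bottom := ((i, j), (i + 1, j)) in
  let top := ((i, j + 1), (i + 1, j + 1)) in
  let base := ((i, j), (i + 1, j + 1)) in
  match s with
  | Square => [:: left; right; bottom; top]
  | Upper => [:: left; top; base]
  | Lower => [:: bottom; right; base]
  end.

Definition vertices (x : cell) : seq point :=
  flatten [seq [:: e.1; e.2] | e <- edges x].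

Definition share_edge (x y : cell) : bool :=
  (x != y) && has (mem (edges y)) (edges x).

Record octagon := Octagon {
  ptA : point;
  side : nat;            (* a *)
  upper_dist : seq nat;  (* d_1, ..., d_k, from the top diagonal to l *)
  middle_dist : seq nat; (* from l to l' *)
  lower_dist : seq nat   (* d'_1, ..., d'_l, from the bottom diagonal to l' *)
}.

Definition top_diag (o : octagon) : int := diag (ptA o).
Definition ell (o : octagon) : int := top_diag o - (sumn (upper_dist o))%:Z.
Definition ell' (o : octagon) : int := ell o - (sumn (middle_dist o))%:Z.
Definition bottom_diag (o : octagon) : int :=
  ell' o - (sumn (lower_dist o))%:Z.

Definition drawn (o : octagon) : seq int :=
  (top_diag o :: scanl (fun c (d : nat) => c - d%:Z) (top_diag o) (upper_dist o))
  ++ scanl (fun c (d : nat) => c - d%:Z) (ell o) (middle_dist o)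
  ++ bottom_diag o
  :: scanl (fun c (d : nat) => c + d%:Z) (bottom_diag o) (lower_dist o).

(* The fundamental regions, over the whole plane. *)
Definition fundamental (o : octagon) (x : cell) : bool :=
  if x.2 == Square then diag x.1 \notin drawn o else diag x.1 \in drawn o.

(* [black x] is only meaningful on fundamental regions; white is [~~ black x]. *)
Definition coloring (o : octagon) (black : pred cell) : Prop :=
  (forall x y, fundamental o x -> fundamental o y -> share_edge x y ->
     black x = ~~ black y)
  /\ (forall p, diag p = top_diag o -> ~~ black (p, Lower)).

(* The fundamental region contained in the unit square p and having e among its
   edges, for e a side of p. *)
Definition region_at (o : octagon) (p : point) (e : edge) : cell :=
  if diag p \notin drawn o then (p, Square)
  else if e \in edges (p, Upper) then (p, Upper) else (p, Lower).

(* A unit step from p to q, east or south, whose adjacent fundamental region on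
   the right (if [right]) or on the left (otherwise), with respect to the
   direction of travel, is black. *)
Definition step (o : octagon) (black : pred cell) (right : bool) : rel point :=
  fun p q =>
    let: (x, y) := p in
    ((q == (x + 1, y)) &&
       black (region_at o (if right then (x, y - 1) else (x, y)) (p, q)))
    || ((q == (x, y - 1)) &&
       black (region_at o (if right then (x - 1, y - 1) else (x, y - 1)) (q, p))).

(* The points visited from A (excluded) to B, from B (excluded) to C, and from
   C (excluded) to D. *)
Record boundary := Boundary {
  path_AB : seq point;
  path_BC : seq point;
  path_CD : seq point
}.

Definition ptB (o : octagon) (s : boundary) : point := last (ptA o) (path_AB s).
Definition ptC (o : octagon) (s : boundary) : point := last (ptB o s) (path_BC s).
Definition ptD (o : octagon) (s : boundary) : point := last (ptC o s) (path_CD s).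

(* Every step goes from one lattice diagonal to the one just below, so a path
   ending on l (resp. l') does so at its first point there. *)
Definition northeastern (o : octagon) (black : pred cell) (s : boundary) : Prop :=
  [/\ path (step o black true) (ptA o) (path_AB s) /\ diag (ptB o s) = ell o,
      path (step o black false) (ptB o s) (path_BC s) /\ diag (ptC o s) = ell' o
    & path (step o black true) (ptC o s) (path_CD s)
      /\ diag (ptD o s) = bottom_diag o].

Definition ne_points (o : octagon) (s : boundary) : seq point :=
  ptA o :: path_AB s ++ path_BC s ++ path_CD s.

(* With A = (p, q) and H = (p - a, q - a), the perpendicular bisector of AH is
   the line x + y = p + q - a; this is the reflection in it. *)
Definition mirror (o : octagon) (p : point) : point :=
  let k := (ptA o).1 + (ptA o).2 - (side o)%:Z in (k - p.2, k - p.1).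

Definition sw_points (o : octagon) (s : boundary) : seq point :=
  [seq mirror o p | p <- ne_points o s].

(* Two lattice paths that meet have a lattice point in common. *)
Definition boundaries_apart (o : octagon) (s : boundary) : bool :=
  ~~ has (mem (sw_points o s)) (ne_points o s).

(* p and [mirror o p] lie on the same lattice diagonal; this is the distance
   between them divided by sqrt 2. *)
Definition width_at (o : octagon) (p : point) : nat :=
  `|p.1 - (mirror o p).1|%N.

(* The lattice points in the closed region: those of the segments that join
   each point of the northeastern boundary to its mirror image. *)
Definition region_points (o : octagon) (s : boundary) : seq point :=
  flatten [seq [seq ((mirror o p).1 + m%:Z, (mirror o p).2 + m%:Z)
                 | m <- iota 0 (width_at o p).+1] | p <- ne_points o s].

(* The boundary runs along lattice edges and along the top and bottom drawn-in
   diagonals, so a fundamental region is enclosed by it exactly when all its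
   vertices are in the closed region. *)
Definition cells (o : octagon) (s : boundary) : {fset cell} :=
  [fset x in [seq (p, t) | p <- region_points o s,
                           t <- [:: Square; Upper; Lower]]
    | fundamental o x && all (mem (region_points o s)) (vertices x)].

Record quasi_octagon (o : octagon) (black : pred cell) (s : boundary) : Prop := {
  side_gt0 : (0 < side o)%N;
  upper_nonempty : upper_dist o != [::];
  middle_nonempty : middle_dist o != [::];
  lower_nonempty : lower_dist o != [::];
  upper_gt0 : all (leq 1) (upper_dist o);
  middle_gt0 : all (leq 1) (middle_dist o);
  lower_gt0 : all (leq 1) (lower_dist o);
  black_coloring : coloring o black;
  ne_boundary : northeastern o black s;
  ne_sw_apart : boundaries_apart o s;
  bottom_white : forall x, x \in cells o s -> x.2 = Upper ->
    diag x.1 = bottom_diag o -> ~~ black x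
}.

(* A triangle points away from l' when it is [Upper] with base on or above l',
   or [Lower] with base on or below l'. *)
Definition regular_cell (o : octagon) (x : cell) : bool :=
  match x.2 with
  | Square => true
  | Upper => ell' o <= diag x.1
  | Lower => diag x.1 <= ell' o
  end.

Definition in_upper (o : octagon) (x : cell) : bool :=
  all (fun v => ell o <= diag v) (vertices x).
Definition in_middle (o : octagon) (x : cell) : bool :=
  all (fun v => ell' o <= diag v <= ell o) (vertices x).
Definition in_lower (o : octagon) (x : cell) : bool :=
  all (fun v => diag v <= ell' o) (vertices x).

Definition upper_cells (o : octagon) (black : pred cell) (s : boundary) :=
  [fset x in cells o s | [&& in_upper o x, regular_cell o x & black x]].
Definition middle_cells (o : octagon) (black : pred cell) (s : boundary) :=
  [fset x in cells o s | [&& in_middle o x, regular_cell o x & ~~ black x]].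
Definition lower_cells (o : octagon) (black : pred cell) (s : boundary) :=
  [fset x in cells o s | [&& in_lower o x, regular_cell o x & black x]].

Definition row_of (o : octagon) (black : pred cell) (s : boundary) (x : cell)
    : {fset cell} :=
  [fset y in cells o s | [&& (y.2 == Square) == (x.2 == Square),
                             diag y.1 == diag x.1 & black y == black x]].

Definition nb_rows (o : octagon) (black : pred cell) (s : boundary)
    (X : {fset cell}) : nat :=
  #|` [fset row_of o black s x | x in X]|.

Definition upper_height o black s := nb_rows o black s (upper_cells o black s).
Definition middle_height o black s := nb_rows o black s (middle_cells o black s).
Definition lower_height o black s := nb_rows o black s (lower_cells o black s).
Definition upper_width (o : octagon) (s : boundary) := width_at o (ptB o s).
Definition lower_width (o : octagon) (s : boundary) := width_at o (ptC o s).

(* A tile is identified with the pair of fundamental regions it consists of. *)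
Definition is_tile (R : {fset cell}) (t : {set R}) : bool :=
  [exists x : R, exists y : R,
     share_edge (val x) (val y) && (t == [set x; y]%SET)].

Definition tilings (R : {fset cell}) : {set {set {set R}}} :=
  [set T : {set {set R}} |
     partition T [set: R] && [forall t in T, is_tile t]]%SET.

Definition Delta (S : {fset int}) : int :=
  \prod_(x <- S) \prod_(y <- S | x < y) (y - x).

Definition interval1 (n : nat) : {fset int} := [fset i%:Z | i in iota 1 n].

Definition translate (x : int) (S : {fset int}) : {fset int} := [fset y + x | y in S].

(* Main.v *)
Require Import Defs.
From mathcomp Require Import all_boot all_order all_algebra finmap.
From mathcomp Require Import zify ring.

(* Read from top to bottom, the rows of cells form a layered graph: two rows
   that meet along a zigzag of lattice edges differ in length by one, and two
   rows that meet along a drawn-in diagonal are matched identically.  On each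
   diagonal let S be the set of positions of the white cells that are matched
   downwards, equivalently of the black cells that are matched upwards.  A
   tiling is a sequence of such states; between consecutive diagonals either
   every particle of S jumps by 0 or 1, or the particles interlace and their
   number grows by one (for S itself or for its complement, depending on the
   part of the region and on the colours).

   With [vdm S] the product of Delta over S divided by that of an initial
   interval, a jump multiplies [vdm] by 2 per particle and an interlacing step
   leaves it unchanged, because these sums are determinants in the binomial
   basis.  This evaluates the upper part down to l and the lower part up to l'.
   In the middle part an interlacing step followed by a jump equals twice the
   jump followed by the interlacing step, so all jumps can be moved to the top,
   where the row of states narrows to [w2 - h2] positions.  The sum over (A, B)
   is the sum over the state B of that narrowest row and its complement A.  The
   remaining steps on both sides of it are interlacing steps for the
   complementary particles, flanked by frozen particles. *)

Set Implicit Arguments.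
Unset Strict Implicit.
Unset Printing Implicit Defensive.

Import Order.TTheory GRing.Theory Num.Theory.

(** * Sets of positions, jumps and interlacing *)

(** All powers of 2 have one source. Read each part in the direction in which it is evaluated, the
    lower part upwards. A jump in an outer part gives a factor 2 per particle, and there are as many
    particles as earlier widening steps; in the middle part each exchange gives a factor 2. So there
    is one factor for every pair of a widening step and a later narrowing step. If the h widening
    steps came last, the rows that they reach would have widths W - h + 1, ..., W, where W is the
    final width; each later narrowing step makes such a row one cell longer. The number of pairs is
    therefore the number of cells in these rows minus h(2W - h + 1)/2.

    The obstacle is the narrowest row. An interlacing sum runs over the configuration with fewer
    particles, but here it runs over a wider row whose complement has one particle more. Freezing
    one extra particle at each end of the narrower row reverses the comparison; hence the enlarged
    intervals in the formula.

    Counted from the top, the narrowest row has w1 - h1 particles; counted from the bottom, h3 - h2.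
    Part (a) is the case where these disagree. *)

Lemma nth_lt_count (s : seq nat) (i k : nat) : sorted ltn s -> i < size s ->
  (nth 0 s i < k) = (i < count (fun x => x < k) s).
Proof.
elim: s i => [|x s IH] [|i] //= xs; rewrite ?ltnS => ilt.
  case: (ltnP x k) => xk //=.
  have -> : count (fun y => y < k) s = 0.
    apply/eqP; rewrite -leqn0 leqNgt -has_count; apply/hasPn => y ys.
    by have /allP/(_ _ ys) := order_path_min ltn_trans xs; lia.
  by [].
rewrite IH ?(path_sorted xs) //; case: (ltnP x k) => xk //=.
have -> : count (fun y => y < k) s = 0.
  apply/eqP; rewrite -leqn0 leqNgt -has_count; apply/hasPn => y ys.
  by have /allP/(_ _ ys) := order_path_min ltn_trans xs; lia.
by [].
Qed.

Section Kernels.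
Variable N : nat.
Local Notation st := {set 'I_N.+1}.
Implicit Types (D F G : st) (i j k n : nat).

(** All states live in one ambient type, so that rows of different widths can be compared; [ivl n]
    is the full row of width [n]. *)
Definition ivl (n : nat) : st := [set x : 'I_N.+1 | (x < n)%N].
(** Two encodings of a configuration: under [cnt], complementation is a subtraction ([cnt_compl]),
    while the determinants need the ordered positions [pt]. [pt_lt] translates between them. *)
Definition cnt (D : st) (k : nat) : nat := #|[set x in D | (x < k)%N]|.
Definition pt (D : st) (i : nat) : nat := nth 0 [seq val x | x <- enum D] i.

Lemma sorted_enum_val (D : st) : sorted ltn [seq val x | x <- enum D].
Proof.
have: sorted ltn [seq val x | x <- enum 'I_N.+1].
  by rewrite val_enum_ord iota_ltn_sorted.
apply: (subseq_sorted ltn_trans); apply: map_subseq.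
by rewrite {1}/enum_mem -enumT; apply: filter_subseq.
Qed.

Lemma pt_lt D i k : (i < #|D|)%N -> (pt D i < k)%N = (i < cnt D k)%N.
Proof.
move=> iD; rewrite /pt nth_lt_count ?sorted_enum_val ?size_map -?cardE //.
rewrite count_map /cnt; congr (_ < _)%N.
rewrite -size_filter /enum_mem -filter_predI; rewrite cardE /enum_mem.
congr size; apply: eq_filter => x /=.
by rewrite !inE andbC.
Qed.

Lemma cnt_card D k : (cnt D k <= #|D|)%N.
Proof. by apply/subset_leq_card/subsetP => x; rewrite inE => /andP[]. Qed.

Lemma cnt_max D n k : D \subset ivl n -> (n <= k)%N -> cnt D k = #|D|.
Proof.
move=> /subsetP Dn nk; congr #|pred_of_set _|; apply/setP => x; rewrite !inE.
case xD: (x \in D) => //=; have := Dn _ xD; rewrite inE; lia.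
Qed.

Lemma pt_ltn D i j : (j < #|D|)%N -> (i < j)%N -> (pt D i < pt D j)%N.
Proof.
move=> jD ij; rewrite pt_lt; last by apply: ltn_trans jD.
rewrite ltnNge; apply/negP => h.
have: (pt D j < pt D j)%N -> False by rewrite ltnn.
apply.
have := pt_lt (pt D j).+1 jD; rewrite ltnS leqnn => /esym h1.
have /subset_leq_card : [set x in D | (x < (pt D j).+1)%N] \subset
    [set x in D | (x < pt D j)%N] :|: [set inord (pt D j)].
  apply/subsetP => x; rewrite !inE => /andP[xD]; rewrite ltnS leq_eqVlt => /orP[/eqP e|->].
    by rewrite -e inord_val eqxx orbT.
  by rewrite xD.
move=> /leq_trans /(_ (leq_card_setU _ _)).
by rewrite cards1; move: h h1; rewrite /cnt; lia.
Qed.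

Lemma mem_pt D i : (i < #|D|)%N -> exists2 x : 'I_N.+1, x \in D & pt D i = x.
Proof.
move=> iD; exists (nth ord0 (enum D) i).
  by rewrite -mem_enum mem_nth // -cardE.
by rewrite /pt (nth_map ord0) // -cardE.
Qed.

Lemma pt_sub D n i : D \subset ivl n -> (i < #|D|)%N -> (pt D i < n)%N.
Proof. by move=> /subsetP Dn /mem_pt[x /Dn + ->]; rewrite inE. Qed.

(* By [jump_ptP], the i-th element of [G] is that of [F] or one more. *)
Definition jump (n : nat) (G F : st) : bool :=
  [&& G \subset ivl n.+1, F \subset ivl n &
      all (fun k => cnt G k <= cnt F k <= cnt G k.+1)%N (iota 0 n.+2)].

(* By [interlace_ptP], G_0 <= F_0 < G_1 <= F_1 < ... < G_m: complementation
   exchanges interlacings and jumps. *)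
Definition interlace (n : nat) (F G : st) : bool :=
  [&& F \subset ivl n, G \subset ivl n.+1 &
      jump n (ivl n.+1 :\: G) (ivl n :\: F)].

Lemma jumpP n G F : reflect
  [/\ G \subset ivl n.+1, F \subset ivl n &
      forall k, (cnt G k <= cnt F k <= cnt G k.+1)%N]
  (jump n G F).
Proof.
apply: (iffP and3P) => -[Gn Fn h]; split=> //; last by apply/allP => k _.
(* From [n.+1] on all counts are constant, so the test at [n.+1] settles every larger [k]. *)
move=> k; case: (ltnP k n.+2) => kn; first by apply: (allP h); rewrite mem_iota.
have := allP h n.+1; rewrite mem_iota => /(_ (leqnn _)).
by rewrite !(cnt_max Gn) ?(cnt_max Fn) //; lia.
Qed.

Lemma jump_card n G F : jump n G F -> #|G| = #|F|.
Proof.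
case/jumpP => Gn Fn /(_ n.+1).
by rewrite !(cnt_max Gn) ?(cnt_max Fn) //; lia.
Qed.

Lemma jump_ptP n G F : reflect
  [/\ G \subset ivl n.+1, F \subset ivl n, #|G| = #|F| &
      forall i, (i < #|F|)%N -> (pt F i <= pt G i <= (pt F i).+1)%N]
  (jump n G F).
Proof.
apply: (iffP idP) => [h|[Gn Fn GF h]].
  have c := jump_card h; case/jumpP: h => Gn Fn h; split=> // i iF.
  apply/andP; split; rewrite -ltnS.
    rewrite pt_lt //; apply: (@leq_trans (cnt G (pt G i).+1)); last by case/andP: (h (pt G i).+1).
    by rewrite -pt_lt ?c // ltnSn.
  rewrite pt_lt ?c //; apply: (@leq_trans (cnt F (pt F i).+1)); last by case/andP: (h (pt F i).+1).
  by rewrite -pt_lt ?c // ltnSn.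
apply/jumpP; split=> // k; apply/andP; split; rewrite leqNgt; apply/negP => hk.
  have iF: (cnt F k < #|F|)%N by rewrite -GF; apply: leq_trans hk (cnt_card _ _).
  have := h _ iF; have := pt_lt k iF; rewrite ltnn.
  by rewrite -GF in iF; have := pt_lt k iF; rewrite hk; lia.
have iF: (cnt G k.+1 < #|F|)%N by apply: leq_trans hk (cnt_card _ _).
have := h _ iF; have := pt_lt k iF; rewrite hk.
by rewrite -GF in iF; have := pt_lt k.+1 iF; rewrite ltnn; lia.
Qed.

Lemma cnt_compl n D k : (n <= N.+1)%N -> D \subset ivl n -> (k <= n)%N ->
  (cnt (ivl n :\: D) k + cnt D k = k)%N.
Proof.
move=> nN /subsetP Dn kn; rewrite /cnt addnC -cardsUI.
have -> : [set x in D | (x < k)%N] :&: [set x in ivl n :\: D | (x < k)%N] = set0.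
  by apply/setP => x; rewrite !inE; case: (x \in D); rewrite ?andbF.
rewrite cards0 addn0.
have kN : (k <= N.+1)%N by lia.
have -> : [set x in D | (x < k)%N] :|: [set x in ivl n :\: D | (x < k)%N]
        = [set widen_ord kN i | i : 'I_k].
  apply/setP => x; rewrite !inE; apply/idP/imsetP => [|[i _ ->]].
    move=> h; have xk : (x < k)%N by case/orP: h => /andP[].
    by exists (Ordinal xk) => //; apply: val_inj.
  by rewrite /= ltn_ord !andbT; case: (_ \in D) => //=; have := ltn_ord i; lia.
by rewrite card_imset ?card_ord // => i j /(congr1 val) /= /val_inj.
Qed.

Lemma card_ivl n : (n <= N.+1)%N -> #|ivl n| = n.
Proof.
move=> nN; have := cnt_compl nN (sub0set _) (leqnn n).
have -> : cnt set0 n = 0%N by apply/eqP; rewrite cards_eq0; apply/eqP/setP => x; rewrite !inE.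
by rewrite setD0 addn0 (cnt_max (subxx _)).
Qed.

Lemma card_compl n D : (n <= N.+1)%N -> D \subset ivl n ->
  (#|ivl n :\: D| + #|D| = n)%N.
Proof.
move=> nN Dn; have := cnt_compl nN Dn (leqnn n).
by rewrite !(@cnt_max _ n) // subsetDl.
Qed.

Lemma complK n (D : st) : D \subset ivl n -> ivl n :\: (ivl n :\: D) = D.
Proof.
move=> /subsetP Dn; apply/setP => x; rewrite !inE.
by case xD: (x \in D) => /=; [have := Dn _ xD; rewrite inE => -> | rewrite andNb].
Qed.

Lemma interlaceP n F G : (n <= N)%N -> reflect
  [/\ F \subset ivl n, G \subset ivl n.+1, #|G| = #|F|.+1 &
      forall k, (k <= n)%N -> (cnt F k <= cnt G k)%N /\ (cnt G k.+1 <= (cnt F k).+1)%N]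
  (interlace n F G).
Proof.
move=> nN; apply: (iffP and3P) => -[Fn Gn].
  move=> h; have := jump_card h; case/jumpP: h => _ _ h c.
  have cF := @card_compl n _ (leqW nN) Fn.
  have cG := @card_compl n.+1 _ nN Gn.
  split=> // [|k kn]; first by lia.
  have := h k.
  have := @cnt_compl n F k (leqW nN) Fn kn.
  have := @cnt_compl n.+1 G k nN Gn (leqW kn).
  have := @cnt_compl n.+1 G k.+1 nN Gn kn.
  by lia.
move=> c h; split=> //; apply/jumpP; split; rewrite ?subsetDl // => k.
case: (leqP k n) => kn.
  have := h k kn.
  have := @cnt_compl n F k (leqW nN) Fn kn.
  have := @cnt_compl n.+1 G k nN Gn (leqW kn).
  have := @cnt_compl n.+1 G k.+1 nN Gn kn.
  by lia.
rewrite !(@cnt_max (ivl n.+1 :\: G) n.+1) ?subsetDl ?(ltnW kn) //; last by lia.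
rewrite !(@cnt_max (ivl n :\: F) n) ?subsetDl ?(ltnW kn) //.
have cF := @card_compl n _ (leqW nN) Fn.
have cG := @card_compl n.+1 _ nN Gn.
by lia.
Qed.

Lemma interlace_card n F G : (n <= N)%N -> interlace n F G -> #|G| = #|F|.+1.
Proof. by move=> nN /(interlaceP _ _ nN)[]. Qed.

Lemma interlace_ptP n F G : (n <= N)%N -> reflect
  [/\ F \subset ivl n, G \subset ivl n.+1, #|G| = #|F|.+1 &
      forall i, (i < #|F|)%N -> (pt G i <= pt F i < pt G i.+1)%N]
  (interlace n F G).
Proof.
move=> nN; apply: (iffP (interlaceP _ _ nN)) => -[Fn Gn c h]; split=> //.
  move=> i iF; have iG: (i < #|G|)%N by lia.
  have iG': (i.+1 < #|G|)%N by lia.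
  have Fi := pt_sub Fn iF.
  have := h (pt F i).+1 Fi; have := h (pt F i) (ltnW Fi).
  have := pt_lt (pt F i).+1 iF; have := pt_lt (pt F i) iF.
  have := pt_lt (pt F i).+1 iG; have := pt_lt (pt F i).+1 iG'.
  by lia.
move=> k kn; split; rewrite leqNgt; apply/negP => hk.
  have iF: (cnt G k < #|F|)%N by apply: leq_trans hk (cnt_card _ _).
  have iG: (cnt G k < #|G|)%N by rewrite c; lia.
  have := h _ iF; have := pt_lt k iF; have := pt_lt k iG.
  by lia.
have iG: ((cnt F k).+1 < #|G|)%N by apply: leq_trans hk (cnt_card _ _).
have iF: (cnt F k < #|F|)%N by lia.
have := h _ iF; have := pt_lt k iF; have := pt_lt k.+1 iG.
by lia.
Qed.

Lemma interlace_compl n F G : F \subset ivl n -> G \subset ivl n.+1 ->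
  interlace n (ivl n :\: F) (ivl n.+1 :\: G) = jump n G F.
Proof. by move=> Fn Gn; rewrite /interlace !subsetDl /= !complK. Qed.

Lemma jump_compl n F G : F \subset ivl n -> G \subset ivl n.+1 ->
  jump n (ivl n.+1 :\: G) (ivl n :\: F) = interlace n F G.
Proof. by move=> Fn Gn; rewrite /interlace Fn Gn. Qed.

End Kernels.

(** * Sequences of widths as words of up and down steps *)

Section Words.
Variable w : nat -> nat.
Implicit Types (i j k : nat).

Definition nearby (i j : nat) : Prop :=
  forall k, i <= k < j -> w k.+1 = (w k).+1 \/ w k = (w k.+1).+1.

Definition ups i j : nat := \sum_(i <= k < j) (w k < w k.+1).
Definition downs i j : nat := \sum_(i <= k < j) (w k.+1 < w k).
Definition up_total i j : nat := \sum_(i <= k < j | w k < w k.+1) w k.+1.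
(** [ud_pairs] and [du_pairs] both count the pairs of an up step and a later down step, grouped by
    the up step and by the down step respectively. The first suits recursions that peel steps from
    the left, the second those that peel from the right. *)
Definition ud_pairs i j : nat := \sum_(i <= k < j | w k < w k.+1) downs k.+1 j.
Definition du_pairs i j : nat := \sum_(i <= k < j | w k.+1 < w k) ups i k.

Lemma width_ups i j : i <= j -> nearby i j -> w j + downs i j = w i + ups i j.
Proof.
move=> ij; rewrite -(subnKC ij) /ups /downs; elim: (j - i) => [|d IH] nb.
  by rewrite addn0 !big_geq.
rewrite addnS !big_nat_recr ?leq_addr //=.
have /IH : nearby i (i + d) by move=> k kj; apply: nb; lia.
by have := nb (i + d); rewrite -addnS; case; lia.
Qed.

Lemma nearbyS i j : nearby i j -> nearby i.+1 j.
Proof. by move=> nb k kj; apply: nb; lia. Qed.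

Lemma ups_recl i j : i < j -> ups i j = (w i < w i.+1) + ups i.+1 j.
Proof. exact: big_ltn. Qed.

Lemma downs_recl i j : i < j -> downs i j = (w i.+1 < w i) + downs i.+1 j.
Proof. exact: big_ltn. Qed.

(** The row reached by an up step has width [w j], minus the up steps after it, plus the down steps
    after it. Summing the first two terms gives a triangular sum, the third gives [ud_pairs].
    Doubling and moving the square to the left avoid division and subtraction. *)
Lemma up_total_ud i j : i <= j -> nearby i j ->
  2 * up_total i j + ups i j * ups i j
  = 2 * ud_pairs i j + ups i j * (2 * w j + 1).
Proof.
move=> ij; have [d e] : exists d, d = j - i by eexists.
elim: d i ij e => [|d IH] i ij e nb.
  by rewrite /ups /up_total /ud_pairs !big_geq //; lia.
have ij' : i < j by lia.
have nb' := nearbyS nb.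
have := IH i.+1 ij' ltac:(lia) nb'; have := width_ups ij' nb'.
have -> : up_total i j = if w i < w i.+1 then w i.+1 + up_total i.+1 j else up_total i.+1 j.
  by rewrite /up_total big_ltn_cond //.
have -> : ud_pairs i j =
    if w i < w i.+1 then downs i.+1 j + ud_pairs i.+1 j else ud_pairs i.+1 j.
  by rewrite /ud_pairs big_ltn_cond //.
rewrite (ups_recl ij').
case: (nb i); first by lia.
  by move=> e1; rewrite e1 ltnSn; nia.
by move=> e1; rewrite e1 ltnNge leqnSn /=; nia.
Qed.

Lemma ups_recr i j : i <= j -> ups i j.+1 = ups i j + (w j < w j.+1).
Proof. by move=> ij; rewrite /ups big_nat_recr. Qed.

Lemma du_pairs_recr i j : i <= j ->
  du_pairs i j.+1 = du_pairs i j + (if w j.+1 < w j then ups i j else 0).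
Proof. by move=> ij; rewrite /du_pairs big_mkcond big_nat_recr //= -big_mkcond. Qed.

Lemma up_total_recr i j : i <= j ->
  up_total i j.+1 = up_total i j + (if w j < w j.+1 then w j.+1 else 0).
Proof. by move=> ij; rewrite /up_total big_mkcond big_nat_recr //= -big_mkcond. Qed.

Lemma up_total_du i j : i <= j -> nearby i j ->
  2 * up_total i j + ups i j * ups i j
  = 2 * du_pairs i j + ups i j * (2 * w j + 1).
Proof.
move=> ij; rewrite -(subnKC ij); elim: (j - i) => [|d IH] nb.
  by rewrite addn0 /ups /up_total /du_pairs !big_geq //; lia.
have : nearby i (i + d) by move=> k kj; apply: nb; lia.
move/IH; rewrite (addnS i d) ups_recr ?up_total_recr ?du_pairs_recr ?leq_addr //.
case: (nb (i + d)); first by lia.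
  by move=> e1; rewrite e1 ltnSn ltnNge leqnSn /=; nia.
by move=> e1; rewrite e1 ltnSn ltnNge leqnSn /=; nia.
Qed.

(** Returns to the floor quotient of the theorem; the doubled identity itself shows that the
    dividend is even. *)
Lemma half_triangle T c h W : h <= W ->
  2 * T + h * h = 2 * c + h * (2 * W + 1) ->
  T = c + h * (2 * W - h + 1) %/ 2.
Proof.
move=> hW e; have -> : h * (2 * W - h + 1) = (T - c) * 2 by nia.
by rewrite mulnK //; nia.
Qed.
End Words.

(** * Perfect matchings of layered graphs *)

Section Matchings.
Variables (T : finType) (e : rel T).
Implicit Types (V B : {set T}) (P : {set {set T}}).

(** The same form as [tilings], but over subsets of a fixed type, so that vertices can be removed
    one by one. *)
Definition matchings V : {set {set {set T}}} :=
  [set P : {set {set T}} | partition P V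
    && [forall t in P, [exists x, exists y, e x y && (t == [set x; y])]]].

Lemma matchings0 : #|matchings set0| = 1.
Proof.
rewrite -(cards1 (set0 : {set {set T}})); congr #|pred_of_set _|.
apply/setP => P; rewrite !inE partition_set0.
by case: eqP => //= ->; apply/forall_inP => t; rewrite inE.
Qed.

Hypothesis e_sym : symmetric e.
Hypothesis e_irr : irreflexive e.

Lemma matchings_block V x P : x \in V -> P \in matchings V ->
  exists2 y, [&& y \in V, e x y & [set x; y] \in P] &
    forall z, [set x; z] \in P -> z = y.
Proof.
move=> xV; rewrite inE => /andP[pP /forall_inP eP].
have xc : x \in cover P by rewrite (cover_partition pP).
have BP := pblock_mem xc; have xB : x \in pblock P x by rewrite mem_pblock.
have uB B : B \in P -> x \in B -> B = pblock P x.
  by move=> h1 h2; rewrite (def_pblock (partition_trivIset pP) h1 h2).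
have [y eB exy] : exists2 y, pblock P x = [set x; y] & e x y.
  have /existsP[a /existsP[b /andP[eab /eqP E]]] := eP _ BP.
  move: xB; rewrite E => /set2P[->|->]; first by exists b.
  by exists a; rewrite 1?setUC 1?e_sym.
have yP : [set x; y] \in P by rewrite -eB.
exists y => [|z zP].
  by rewrite exy yP (subsetP (partitionS pP yP)) // set22.
have := uB _ zP (set21 _ _); rewrite eB => /setP /(_ z); rewrite set22 => /esym /set2P[zx|//].
(* If [z = x], the block is a singleton and its edge a loop, against [e_irr]. *)
have /existsP[a /existsP[b /andP[eab /eqP E]]] := eP _ zP.
have : a \in [set x; z] by rewrite E set21.
have : b \in [set x; z] by rewrite E set22.
by rewrite zx setUid !inE => /eqP bx /eqP ax; move: eab; rewrite ax bx e_irr.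
Qed.

(** Expansion along the partner of [x]. By [matchings_block] a sum of ones over the partners equals
    1; it is inserted and the two sums are exchanged. *)
Lemma matchings_peel V x : x \in V ->
  #|matchings V| = \sum_(y | (y \in V) && e x y) #|matchings (V :\: [set x; y])|.
Proof.
move=> xV; rewrite -sum1_card.
transitivity (\sum_(P in matchings V)
   \sum_(y | [&& (y \in V) && e x y & [set x; y] \in P]) 1).
  apply: eq_bigr => P /(matchings_block xV)[y /and3P[yV exy yP] uy].
  rewrite (big_pred1 y) // => z; apply/idP/eqP => [/andP[_ /uy]|->] //.
  by rewrite yV exy.
rewrite (exchange_big_dep (fun y => (y \in V) && e x y)) /=; last first.
  by move=> P y _ /andP[].
apply: eq_bigr => y /andP[yV exy]; set B := [set x; y].
rewrite -[RHS]sum1_card.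
have BV : B \subset V by apply/subsetP => z /set2P[->|->].
rewrite (reindex_onto (fun P => B |: P) (fun P => P :\ B)) /=; last first.
  by move=> P /and3P[_ _ BP]; rewrite setD1K.
apply: eq_bigl => P; rewrite setU11 yV exy /= andbT !inE.
apply/idP/idP => [/andP[/andP[pP /forall_inP eP] /eqP E]|/andP[pP /forall_inP eP]].
  rewrite -E partitionD1 ?setU11 //=; apply/forall_inP => t.
  by rewrite inE => /andP[_]; apply: eP.
have BP : B \notin P.
  apply/negP => /(partitionS pP)/subsetP/(_ x); rewrite !inE eqxx /=.
  by move=> /(_ isT).
rewrite setU1K // eqxx andbT -{1}(setID V B) (setIidPr BV) partitionU1 //=; last 2 first.
- by apply/set0Pn; exists x; rewrite !inE eqxx.
- by rewrite disjoints_subset; apply/subsetP => z; rewrite !inE => ->.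
apply/forall_inP => t /setU1P[->|/eP //].
by apply/existsP; exists x; apply/existsP; exists y; rewrite exy /=.
Qed.

End Matchings.

Lemma imset_setD (T U : finType) (f : T -> U) (A B : {set T}) : injective f ->
  f @: (A :\: B) = (f @: A) :\: (f @: B).
Proof.
move=> fi; apply/setP => z; rewrite inE; apply/imsetP/andP => [[t + ->]|[zB /imsetP[t tA E]]].
  by rewrite inE => /andP[tB tA]; rewrite !mem_imset.
by exists t; rewrite // inE tA andbT; move: zB; rewrite E mem_imset.
Qed.

(** Induction on the number of vertices, peeling one on both sides, so that no partition has to be
    carried along [f]. *)
Lemma card_matchings_imset (T U : finType) (e : rel T) (e' : rel U) (f : T -> U)
    (V : {set T}) : symmetric e -> irreflexive e -> symmetric e' -> irreflexive e' ->
  injective f -> {in V &, forall x y, e' (f x) (f y) = e x y} ->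
  #|matchings e' (f @: V)| = #|matchings e V|.
Proof.
move=> es ei es' ei' fi; have [n] := ubnP #|V|.
elim: n V => // n IH V Vn ee.
have [->|[x xV]] := set_0Vmem V; first by rewrite imset0 !matchings0.
rewrite (matchings_peel es ei xV) (matchings_peel es' ei' (imset_f f xV)).
have fV z : (f z \in f @: V) = (z \in V) by rewrite mem_imset.
rewrite (eq_bigl (fun z => (z \in f @: V) && e' (f x) z)) // big_mkcondr.
rewrite big_imset /=; last by move=> ? ? _ _; apply: fi.
rewrite -big_mkcondr; apply: eq_big => y; first by case yV: (y \in V); rewrite //= ee.
move=> /andP[yV _]; rewrite -IH.
- by rewrite imset_setD // imsetU1 imset_set1; congr #|pred_of_set _|.
- move: Vn; rewrite ltnS; apply: leq_trans; apply: proper_card.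
  apply/properP; split; first exact: subsetDl.
  by exists x; rewrite // !inE eqxx.
by move=> a b; rewrite !inE => /andP[_ aV] /andP[_ bV]; apply: ee.
Qed.

(** * Matching a whole row at once *)

Section RowPeel.
Variables (T I : finType) (e : rel T) (c1 c2 : I -> T) (nb : rel I).
Hypothesis e_sym : symmetric e.
Hypothesis e_irr : irreflexive e.
Hypothesis c1_inj : injective c1.
Hypothesis c2_inj : injective c2.
Hypothesis c1_indep : forall x y, e (c1 x) (c1 y) = false.

(** The permanent of [nb]: the number of bijections from the list [s] onto [U] along [nb]. *)
Fixpoint mcount (s : seq I) (U : {set I}) : nat :=
  if s is x :: s' then \sum_(u in U | nb x u) mcount s' (U :\ u) else (U == set0).

(** The row [c1] is independent and its neighbours in [V] lie in the row [c2], so matchings are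
    classified by the set [U] of partners that the row uses. *)
Lemma row_peel (s : seq I) (V : {set T}) : uniq s ->
  (forall x, c1 x \notin V) ->
  (forall x y, x \in s -> y \in V -> e (c1 x) y = [exists u, (y == c2 u) && nb x u]) ->
  #|matchings e ([set c1 x | x in s] :|: V)| =
  \sum_(U : {set I} | c2 @: U \subset V) mcount s U * #|matchings e (V :\: c2 @: U)|.
Proof.
elim: s V => [|x s IH] V /=.
  move=> _ _ _; rewrite (bigD1 set0) ?imset0 ?sub0set //= eqxx mul1n setD0.
  rewrite big1 ?addn0; last by move=> U /andP[_ /negPf ->].
  by congr #|pred_of_set (matchings e _)|; apply/setP => z; rewrite !inE; case: imsetP => // -[].
move=> /andP[xs us] c1V eV.
have xV : c1 x \in [set c1 y | y in x :: s] :|: V.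
  by rewrite !inE imset_f ?mem_head.
rewrite (matchings_peel e_sym e_irr xV).
have c2V u : (c2 u \in V) -> c2 u \notin [set c1 y | y in x :: s].
  move=> uV; apply/imsetP => -[y _ E]; have := c1V y; by rewrite -E uV.
transitivity (\sum_(u | (c2 u \in V) && nb x u)
    #|matchings e ([set c1 y | y in s] :|: (V :\ c2 u))|).
  transitivity (\sum_(y in V | e (c1 x) y)
     #|matchings e ([set c1 y | y in s] :|: (V :\ y))|).
    apply: eq_big => y.
      rewrite inE; case yV: (y \in V); rewrite ?orbT ?orbF //=.
      by apply/negP => /andP[/imsetP[z _ ->]]; rewrite c1_indep.
    rewrite inE => /andP[/orP[/imsetP[z _ ->]|yV] exy]; first by rewrite c1_indep in exy.
    congr #|pred_of_set (matchings e _)|; apply/setP => z; rewrite !inE negb_or.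
    case zx: (z == c1 x) => /=.
      rewrite (eqP zx) (negPf (c1V x)) andbF orbF; apply/esym/imsetP => -[z' z's /c1_inj].
      by move=> E; rewrite E z's in xs.
    case zy: (z == y) => /=.
      rewrite (eqP zy) orbF; apply/esym/imsetP => -[z' _ E].
      by have := c1V z'; rewrite -E yV.
    congr (_ || _); apply/imsetP/imsetP => -[z']; last by move=> h ->; exists z'; rewrite ?inE ?h ?orbT.
    by rewrite inE => /predU1P[->|h] E; [rewrite E eqxx in zx|exists z'].
  rewrite [RHS](eq_bigl (fun u => (c2 u \in V) && e (c1 x) (c2 u))); last first.
    move=> u; case uV: (c2 u \in V) => //=; rewrite eV ?mem_head //.
    apply/idP/existsP => [h|[u' /andP[/eqP /c2_inj ->]] //].
    by exists u; rewrite eqxx.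
  transitivity (\sum_(y in c2 @: [set u | (c2 u \in V) && e (c1 x) (c2 u)])
     #|matchings e ([set c1 y | y in s] :|: (V :\ y))|); last first.
    rewrite big_imset /=; last by move=> ? ? _ _; apply: c2_inj.
    by apply: eq_bigl => u; rewrite inE.
  apply: eq_bigl => y; apply/andP/imsetP => [[yV exy]|[u + ->]]; last by rewrite inE => /andP.
  move: (exy); rewrite eV ?mem_head // => /existsP[u /andP[/eqP E _]].
  by exists u => //; rewrite inE -E yV exy.
under eq_bigr => u uV.
  rewrite IH //; first over.
  - by move=> z; rewrite inE negb_and c1V orbT.
  by move=> z y zs; rewrite inE => /andP[_ yV]; apply: eV; rewrite // inE zs orbT.
under [RHS]eq_bigr do rewrite big_distrl /=.
rewrite [RHS](exchange_big_dep (fun u => (c2 u \in V) && nb x u)) /=; last first.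
  by move=> U u /subsetP UV /andP[uU ->]; rewrite UV ?imset_f.
apply: eq_bigr => u /andP[uV nu].
(* On the left [U] holds the partners of [s] only; on the right it also contains [u], the partner of
   [x]. *)
rewrite (reindex_onto (fun U => U :\ u) (fun U => u |: U)) /=; last first.
  move=> U /subsetP UV; rewrite setU1K //; apply/negP => uU.
  by have := UV _ (imset_f _ uU); rewrite !inE eqxx.
apply: eq_big => U.
  rewrite nu andbT; apply/andP/andP => [[/subsetP UV /eqP E]|[/subsetP UV uU]].
    have uU : u \in U by rewrite -E setU11.
    split=> //; apply/subsetP => z /imsetP[t tU ->].
    have [->//|tu] := eqVneq t u.
    by have := UV (c2 t); rewrite imset_f ?inE ?tu // => /(_ isT) /andP[].
  rewrite setD1K // eqxx; split=> //; apply/subsetP => z /imsetP[t + ->].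
  by rewrite !inE (inj_eq c2_inj) => /andP[-> tU]; rewrite UV ?imset_f.
move=> /andP[_ /eqP E]; congr (_ * #|pred_of_set (matchings e _)|).
have uU : u \in U by rewrite -E setU11.
rewrite -{2}E imsetU1; apply/setP => z; rewrite !inE.
by case: (z == c2 u); rewrite /= ?andbF.
Qed.
End RowPeel.

Section Monotone.
Variable N : nat.
Local Notation st := {set 'I_N.+1}.

Lemma sorted_enum_ord (U : st) : sorted (fun x y : 'I_N.+1 => x < y) (enum U).
Proof. by have := sorted_enum_val U; rewrite sorted_map. Qed.

Lemma enum_setD1 (U : st) u : enum (U :\ u) = [seq x <- enum U | x != u].
Proof.
rewrite /enum_mem -filter_predI; apply: eq_filter => x /=.
by rewrite !inE.
Qed.

(** Under the monotonicity hypothesis partners cannot cross, so the permanent has at most one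
    nonzero term, the pairing of both sets in increasing order. *)
Lemma mcount_all2 (nb : rel 'I_N.+1) (s : seq 'I_N.+1) (U : st) :
  (forall x x' u u' : 'I_N.+1, x < x' -> nb x u -> nb x' u' -> u <= u') ->
  sorted (fun x y : 'I_N.+1 => x < y) s -> mcount nb s U = all2 nb s (enum U).
Proof.
move=> mon; elim: s U => [|x s IH] U /=.
  rewrite -cards_eq0 cardE; by case: (enum U).
move=> xs; under eq_bigr do rewrite (IH _ (path_sorted xs)) enum_setD1.
have mU u : (u \in U) = (u \in enum U) by rewrite mem_enum.
have := sorted_enum_ord U; have := enum_uniq U.
case E: (enum U) => [|u0 l] /=.
  by move=> _ _; rewrite big1 // => u; rewrite mU E.
move=> /andP[u0l ul] pl.
have lt0 u : u \in l -> u0 < u.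
  move=> h; apply: (allP (order_path_min _ pl) u h) => a b c; apply: ltn_trans.
have fl : [seq y <- l | y != u0] = l.
  by apply/all_filterP/allP => y yl; apply: contraNneq u0l => <-.
(* If [x] skips the least element [u0], a later element must take it, which is a crossing. *)
have big0 u : u \in l -> nb x u -> all2 nb s (u0 :: [seq y <- l | y != u]) = false.
  move=> ul' nu; case: s xs {IH} => //= x' s /andP[xx' _].
  apply/negbTE; apply/negP => /andP[nu0 _].
  by have := mon _ _ _ _ xx' nu nu0; have := lt0 _ ul'; lia.
case nu0 : (nb x u0) => /=.
  rewrite (bigD1 u0) ?mU ?E ?mem_head ?nu0 //= eqxx /= fl big1 ?addn0 // => u.
  rewrite mU E inE => /andP[/andP[/orP[/eqP ->|ul'] nu]]; first by rewrite eqxx.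
  by move=> uu0; rewrite eq_sym uu0 /= big0.
rewrite big1 // => u; rewrite mU E inE => /andP[/predU1P[->|ul'] nu]; first by rewrite nu in nu0.
have -> : u0 != u by apply/eqP => h; rewrite h nu in nu0.
by rewrite /= big0.
Qed.

Lemma all2_nth (T : Type) (r : rel T) (x0 : T) s t :
  reflect (size s = size t /\ forall i, i < size s -> r (nth x0 s i) (nth x0 t i))
          (all2 r s t).
Proof.
elim: s t => [|x s IH] [|y t] /=; try by constructor=> // -[].
apply: (iffP andP) => [[rxy /IH[e h]]|[[e] h]].
  by split=> [|[|i] /=]; [rewrite e | | rewrite ltnS; apply: h].
by split; [apply: (h 0)|apply/IH; split=> // i; apply: (h i.+1)].
Qed.

(** Positions are counted so that a cell touches positions [x] and [x.+1] of a wider neighbouring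
    row, and [x.-1] and [x] of a narrower one. *)
Definition zigzag (a b x y : nat) : bool :=
  if a < b then (x <= y <= x.+1) else (y <= x <= y.+1).

Lemma zigzag_jump a b (D U : st) : b = a.+1 \/ a = b.+1 ->
  D \subset ivl _ a -> U \subset ivl _ b ->
  all2 (fun x y : 'I_N.+1 => zigzag a b x y) (enum D) (enum U)
  = if a < b then jump a U D else jump b D U.
Proof.
have pE (F : st) i : i < #|F| -> pt F i = nth ord0 (enum F) i.
  by move=> iF; rewrite /pt (nth_map ord0) // -cardE.
move=> ab Da Ub; rewrite /zigzag; case: ab => e.
  rewrite e in Ub *; rewrite ltnSn.
  apply/(all2_nth _ ord0)/jump_ptP; rewrite -!cardE.
    by case=> c h; split=> // i iD; have := h i iD; rewrite !pE -?c.
  case=> _ _ c h; split=> // i iD; have := h i iD; by rewrite !pE ?c.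
rewrite e in Da *; rewrite ltnNge leqnSn /=.
apply/(all2_nth _ ord0)/jump_ptP; rewrite -!cardE.
  by case=> c h; split=> // i iD; have := h i; rewrite c iD !pE ?c //; apply.
by case=> _ _ c h; split=> // i iD; have := h i; rewrite -c iD !pE -?c //; apply.
Qed.

End Monotone.

(** * The layered graph and its peeling from the top *)

Section Model.
Variables (N L : nat) (w : nat -> nat) (d : pred nat).
Local Notation st := {set 'I_N.+1}.
Local Notation ivl := (@ivl N).
Implicit Types (D U S : st) (i : nat).

(* [w i] is the width of the [i]-th diagonal from the top, [d i] tells whether it
   is drawn in.  [(i, b, m)] is the [m]-th cell of the row of [Lower] or [Square]
   cells (if [b]) or of [Upper] cells (otherwise) on the [i]-th diagonal. *)
Definition mcell : finType := ('I_L.+1 * bool * 'I_N.+1)%type.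
Implicit Types x y : mcell.

(** The first clause is the common base of two triangles, the second the zigzag to the next
    diagonal, where the upper row consists of [Upper] cells exactly if that diagonal is drawn in. *)
Definition below x y : bool :=
  let: (i, b, m) := x in let: (i', b', m') := y in
  [&& i == i', d i, ~~ b, b' & m == m'] ||
  [&& i' == i.+1 :> nat, b, b' == ~~ d i' & zigzag (w i) (w i.+1) m m'].

Definition madj x y : bool := below x y || below y x.

Lemma madj_sym : symmetric madj.
Proof. by move=> x y; rewrite /madj orbC. Qed.

Lemma madj_irr : irreflexive madj.
Proof.
move=> [[i b] m]; rewrite /madj orbb /= eqxx /=.
by case: b; rewrite ?andbF //= [_ == _]ltn_eqF.
Qed.

(** The last two conditions drop the triangles outside the region, above the top and below the
    bottom diagonal. *)
Definition mvalid : {set mcell} :=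
  [set x : mcell | [&& x.2 < w x.1.1, d x.1.1 || x.1.2,
     ~~ ((x.1.1 == 0 :> nat) && ~~ x.1.2) & ~~ ((x.1.1 == L :> nat) && x.1.2)]].

Definition rest i : {set mcell} := [set x in mvalid | i < x.1.1].
(** What is left when everything above the lower row of diagonal [i] is matched: [D] is the part of
    that row still free. *)
Definition tail i D : {set mcell} :=
  [set x : mcell | [&& x.1.1 == i :> nat, x.1.2 & x.2 \in D]] :|: rest i.

Definition cell_at i b (m : 'I_N.+1) : mcell := (inord i, b, m).

Definition ways i D : nat := #|matchings madj (tail i D)|.

Definition link i D U : bool :=
  if w i < w i.+1 then jump (w i) U D else jump (w i.+1) D U.

Hypothesis dL : d L.
Hypothesis nb : nearby w 0 L.

Lemma cell_at_inj i b : injective (cell_at i b).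
Proof. by move=> m m' []. Qed.

Lemma zigzag_mono a b (x x' u u' : nat) : x < x' -> zigzag a b x u -> zigzag a b x' u' -> u <= u'.
Proof. by rewrite /zigzag; case: (a < b); lia. Qed.

Lemma first_peel i D : i < L -> D \subset ivl (w i) ->
  ways i D = \sum_(U | link i D U)
     #|matchings madj (rest i :\: cell_at i.+1 (~~ d i.+1) @: U)|.
Proof.
move=> iL Dw; have iL1 : i < L.+1 by apply: leqW.
have c2V (u : 'I_N.+1) : (cell_at i.+1 (~~ d i.+1) u \in rest i) = (u < w i.+1).
  rewrite !inE /= inordK // ltnSn orbN /= !andbT.
  by case: eqP => [e|]; rewrite ?andbT // e dL /= andbT.
have c2s (U : st) : (cell_at i.+1 (~~ d i.+1) @: U \subset rest i) = (U \subset ivl (w i.+1)).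
  apply/subsetP/subsetP => h x.
    by move=> xU; rewrite inE -c2V; apply/h/imset_f.
  by case/imsetP=> u /h + ->; rewrite inE -c2V.
have -> : ways i D = #|matchings madj ([set cell_at i true x | x in enum D] :|: rest i)|.
  rewrite /ways /tail; congr #|pred_of_set (matchings _ (_ :|: _))|; apply/setP => x.
  rewrite inE; apply/and3P/imsetP => [[/eqP e b xD]|[m + ->]].
    exists x.2; first by rewrite mem_enum.
    by case: x e b {xD} => -[j b'] m /= <- ->; rewrite /cell_at inord_val.
  by rewrite mem_enum /= inordK.
rewrite (row_peel madj_sym madj_irr (@cell_at_inj _ _) (@cell_at_inj i.+1 (~~ d i.+1))
   (nb := fun x y : 'I_N.+1 => zigzag (w i) (w i.+1) x y)) ?enum_uniq //.
- rewrite (eq_bigl _ _ c2s) [RHS]big_mkcond [LHS]big_mkcond; apply: eq_bigr => U _.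
  have nbi := nb iL; case: ifP => Uw.
    rewrite mcount_all2 ?sorted_enum_ord //; last by move=> *; apply: zigzag_mono; eassumption.
    by rewrite zigzag_jump // /link; case: ifP => _; case: ifP; rewrite ?mul1n ?mul0n.
  suff -> : link i D U = false by [].
  rewrite /link; case: ifP => h; apply/negP => /and3P[U1 U2 _].
    by case: nbi => e; [rewrite e U1 in Uw | lia].
  by rewrite U2 in Uw.
- by move=> x y; rewrite /madj /below /cell_at /= eqxx /= [_ == _ :> nat]ltn_eqF ?andbF.
- by move=> x; rewrite !inE /= inordK // ltnn andbF.
move=> x [[j b] m] _; rewrite inE => /andP[jv /= ij].
have ji : (j == inord i :> 'I_L.+1) = false.
  by rewrite -val_eqE /= inordK // gtn_eqF.
rewrite /madj /below /cell_at /= inordK // [inord i == j]eq_sym ji /=.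
rewrite [i == j.+1]ltn_eqF ?orbF; last exact: ltnW.
apply/andP/existsP => [[/eqP e /andP[/eqP be z]]|[u /andP[/eqP[-> -> ->] z]]].
  exists m; rewrite z andbT; apply/eqP; rewrite be e; congr (_, _, _).
  by apply: val_inj; rewrite /= inordK // -e.
by rewrite inordK // !eqxx z.
Qed.

Lemma rest_undrawn i U : i.+1 < L -> ~~ d i.+1 ->
  rest i :\: cell_at i.+1 (~~ d i.+1) @: U = tail i.+1 (ivl (w i.+1) :\: U).
Proof.
move=> iL di; rewrite di; apply/setP => -[[j b] m]; rewrite !inE /=.
have E : ((j, b, m) \in cell_at i.+1 true @: U) = [&& j == i.+1 :> nat, b & m \in U].
  apply/imsetP/and3P => [[u uU [-> -> ->]]|[/eqP e bt mU]].
    by rewrite inordK ?eqxx // ltnS ltnW.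
  by exists m; rewrite // /cell_at -e inord_val bt.
rewrite E; case: (ltngtP j i.+1) => [ji|ji|->] /=.
- by rewrite ?andbF.
- by rewrite ?andbT ?orFb.
rewrite (negPf di) (ltn_eqF iL) !andbF orbF !andbT /=.
by case: (b); rewrite /= ?andbF ?andbT.
Qed.

Lemma rest_drawn i U : i < L -> d i.+1 ->
  rest i :\: cell_at i.+1 (~~ d i.+1) @: U =
  [set cell_at i.+1 false m | m in enum (ivl (w i.+1) :\: U)] :|:
  (if i.+1 == L then set0 else tail i.+1 (ivl (w i.+1))).
Proof.
move=> iL di; rewrite di; apply/setP => -[[j b] m].
have E b' (A : {pred 'I_N.+1}) :
    ((j, b, m) \in cell_at i.+1 b' @: A) = [&& j == i.+1 :> nat, b == b' & m \in A].
  apply/imsetP/and3P => [[u uU [-> -> ->]]|[/eqP e /eqP bt mU]].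
    by rewrite inordK // !eqxx.
  by exists m; rewrite // /cell_at -e inord_val bt.
rewrite in_setU in_setD !E mem_enum !inE /=.
case: (ltngtP j i.+1) => [ji|ji|e] /=.
- rewrite andbF.
  by case: ifP => _; rewrite !inE //= (ltn_eqF ji) [_ < j]ltnNge (ltnW ji) !andbF.
- rewrite andbT; have -> : (i.+1 == L) = false.
    by rewrite ltn_eqF // (leq_trans ji) // -ltnS.
  by rewrite !inE /= ji (gtn_eqF ji) andbT.
rewrite e di andbT /=; case: ifP => iL'.
  by rewrite !inE; case: (b); rewrite /= ?andbF ?orbF ?andbT.
by rewrite !inE /= e eqxx ltnn andbF orbF; case: (b); rewrite /= ?andbF ?andbT ?orbF.
Qed.

Lemma upper_peel i U : i < L -> d i.+1 -> U \subset ivl (w i.+1) ->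
  #|matchings madj ([set cell_at i.+1 false m | m in enum (ivl (w i.+1) :\: U)] :|:
     (if i.+1 == L then set0 else tail i.+1 (ivl (w i.+1))))|
  = if i.+1 == L then (U == ivl (w L)) : nat else ways i.+1 U.
Proof.
move=> iL di Uw.
have Dw := complK Uw.
case: ifP => [/eqP iL'|/negbT iL'].
  rewrite (row_peel madj_sym madj_irr (@cell_at_inj i.+1 false) (@cell_at_inj i.+1 true)
     (nb := fun x y : 'I_N.+1 => x == y)) ?enum_uniq //.
  - rewrite (big_pred1 set0) => [|V]; last by rewrite /= subset0 imset_eq0.
    rewrite imset0 setD0 matchings0 muln1 mcount_all2 ?sorted_enum_ord //; last first.
      by move=> x x' u u' xx /eqP <- /eqP <-; apply: ltnW.
    rewrite enum_set0 -iL'.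
    transitivity ((ivl (w i.+1) :\: U == set0) : nat).
      by rewrite -cards_eq0 cardE; case: (enum _).
    congr nat_of_bool; apply/eqP/eqP => [e|->]; last by rewrite setDv.
    by rewrite -Dw e setD0.
  - by move=> x y; rewrite /madj /below /cell_at /= !andbF.
  - by move=> x; rewrite inE.
  by move=> x y _; rewrite inE.
have iL2 : i.+1 < L by rewrite ltn_neqAle iL'.
rewrite (row_peel madj_sym madj_irr (@cell_at_inj i.+1 false) (@cell_at_inj i.+1 true)
     (nb := fun x y : 'I_N.+1 => x == y)) ?enum_uniq //.
- rewrite (bigD1 (ivl (w i.+1) :\: U)) /=; last first.
    apply/subsetP => x /imsetP[u]; rewrite !inE => /andP[uU uw] ->.
    by rewrite /= inordK // eqxx uw.
  have mc V : mcount (fun x y : 'I_N.+1 => x == y) (enum (ivl (w i.+1) :\: U)) V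
      = (V == ivl (w i.+1) :\: U).
    rewrite mcount_all2 ?sorted_enum_ord //; last first.
      by move=> x x' u u' xx /eqP <- /eqP <-; apply: ltnW.
    congr nat_of_bool; apply/idP/eqP => [h|->].
      apply/setP => x; rewrite -[x \in V]mem_enum -[RHS]mem_enum.
      suff -> : enum V = enum (ivl (w i.+1) :\: U) by [].
      by elim: (enum _) (enum V) h => [|a s IH] [|b t] //= /andP[/eqP -> /IH ->].
    by elim: (enum _) => //= a s ->; rewrite eqxx.
  rewrite mc eqxx mul1n big1 ?addn0; last by move=> V /andP[_ /negPf h]; rewrite mc h.
  rewrite /ways; congr #|pred_of_set (matchings _ _)|.
  apply/setP => -[[j b] m]; rewrite in_setD.
  have -> : ((j, b, m) \in cell_at i.+1 true @: (ivl (w i.+1) :\: U)) =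
     [&& j == i.+1 :> nat, b & m \in ivl (w i.+1) :\: U].
    apply/imsetP/and3P => [[u uU [-> -> ->]]|[/eqP e bt mU]].
      by rewrite inordK // !eqxx.
    by exists m; rewrite // /cell_at -e inord_val bt.
  rewrite !inE /=; case: eqP => [->|] //=; rewrite ltnn andbF !orbF.
  case: b => //=; case mU : (m \in U) => //=; first by have := subsetP Uw _ mU; rewrite inE.
  by case: (m < w i.+1).
- by move=> x y; rewrite /madj /below /cell_at /= !andbF.
- by move=> x; rewrite !inE /= inordK // ltnn !andbF.
move=> x [[j b] m] _; rewrite !inE /= => h.
have ji : (i.+1 == j.+1) = false by apply/eqP => -[e]; move: h; rewrite -e; lia.
rewrite /madj /below /cell_at /= !andbF inordK // ji /= !orbF di /=.
apply/and3P/existsP => [[/eqP e bt /eqP xm]|[u /andP[/eqP[-> -> ->] xu]]].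
  by exists m; rewrite xm eqxx andbT -e bt.
by rewrite eqxx xu.
Qed.

(** An undrawn diagonal carries a single row, so what is not matched from above goes on downwards:
    the complement of [U]. A drawn-in diagonal reproduces [U] by [upper_peel]. *)
Lemma ways_step i D : i < L -> D \subset ivl (w i) ->
  ways i D = \sum_(U | link i D U)
    if i.+1 == L then (U == ivl (w L)) : nat
    else ways i.+1 (if d i.+1 then U else ivl (w i.+1) :\: U).
Proof.
move=> iL Dw; rewrite first_peel //; apply: eq_bigr => U lU.
have Uw : U \subset ivl (w i.+1).
  move: lU; rewrite /link; have := nb iL; case: ifP => h e /and3P[U1 U2 _] //.
  by case: e => e; [rewrite e | lia].
have [di|di] := boolP (d i.+1).
  by have := rest_drawn U iL di; rewrite di => ->; rewrite upper_peel.
have iL' : i.+1 < L.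
  by rewrite ltn_neqAle iL andbT; apply/eqP => e; rewrite e dL in di.
have := rest_undrawn U iL' di; rewrite (negPf di) => ->.
by rewrite (ltn_eqF iL').
Qed.

(* [white i]: the colour of the row of [Lower] or [Square] cells on the [i]-th
   diagonal. *)
Variable white : pred nat.
Hypothesis whiteS : forall i, i.+1 < L -> white i.+1 = if d i.+1 then white i else ~~ white i.
Hypothesis white_end : forall i, i.+1 = L -> ~~ white i.

(* The state of a diagonal: the positions of its white cells that are matched
   downwards, equivalently of its black cells that are matched upwards. *)
Definition state i S : st := if white i then S else ivl (w i) :\: S.
(** The triangles on the bottom diagonal are white and nothing lies below them, so only the empty
    state survives there. *)
Definition chain i S : nat := if i == L then nat_of_bool (S == set0) else ways i (state i S).

Lemma state_sub i S : S \subset ivl (w i) -> state i S \subset ivl (w i).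
Proof. by rewrite /state; case: ifP => // _ _; apply: subsetDl. Qed.

(** Where [ways_step] takes a complement the colour of the row alternates as well; in terms of
    [state] the two changes cancel. *)
Lemma chain_step i S : i < L -> S \subset ivl (w i) ->
  chain i S = \sum_(S' : st | (S' \subset ivl (w i.+1)) &&
      (if white i then link i S S' else link i (ivl (w i) :\: S) (ivl (w i.+1) :\: S')))
    chain i.+1 S'.
Proof.
move=> iL Sw; rewrite {1}/chain (ltn_eqF iL) ways_step ?state_sub // /state.
have linkU D U : link i D U -> U \subset ivl (w i.+1).
  rewrite /link; have := nb iL; case: ifP => h e /and3P[U1 U2 _] //.
  by case: e => e; [rewrite e | lia].
case wi : (white i).
  apply: eq_big => [U|U lU]; first by case lU : link; rewrite ?andbF // (linkU _ _ lU).
  rewrite /chain; case: eqP => [e|ne].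
    by have := white_end e; rewrite wi.
  rewrite /state whiteS ?wi; last by rewrite ltn_neqAle iL andbT; apply/eqP.
  by case: (d i.+1).
rewrite (reindex_onto (fun S' : st => ivl (w i.+1) :\: S') (fun U : st => ivl (w i.+1) :\: U)) /=; last first.
  by move=> U /linkU; apply: complK.
apply: eq_big => [S'|S' /andP[lS' /eqP e]].
  apply/andP/andP => [[lS' /eqP <-]|[S'w lS']]; first by rewrite subsetDl complK ?subsetDl.
  by rewrite complK // eqxx.
rewrite /chain; case: eqP => [iL'|ne].
  congr nat_of_bool; rewrite -iL'; apply/eqP/eqP => [e'|->]; last by rewrite setD0.
  by rewrite -e e' setDv.
rewrite /state whiteS ?wi; last by rewrite ltn_neqAle iL andbT; apply/eqP.
by case: (d i.+1) => //=; rewrite e.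
Qed.
End Model.

Local Open Scope ring_scope.

(** * Vandermonde products *)

(** Multilinearity in the columns: column [j] is summed over its own index set [Q j]. *)
Lemma det_sum_family (m : nat) (I : finType) (Q : 'I_m -> pred I)
    (F : 'I_m -> I -> rat) :
  \sum_(h : {ffun 'I_m -> I} | [forall j, Q j (h j)])
     \det (\matrix_(i, j) F i (h j))
  = \det (\matrix_(i, j) \sum_(x | Q j x) F i x).
Proof.
under eq_bigr do rewrite -det_tr.
rewrite -[RHS]det_tr exchange_big /=; apply: eq_bigr => s _.
rewrite -big_distrr /=; congr (_ * _).
under [RHS]eq_bigr do rewrite !mxE.
rewrite bigA_distr_big_dep /=; apply: eq_big => [h|h _].
  by apply/forallP/familyP.
by apply: eq_bigr => i _; rewrite !mxE.
Qed.

Definition binom_det (m : nat) (a : nat -> nat) : rat :=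
  \det (\matrix_(i < m, j < m) 'C(a j, i)%:R).

(** By Pascal's rule the entries are 2 C(a, i) + C(a, i - 1): a row operation by a triangular matrix
    with diagonal 2. *)
Lemma binom_det_jump m (a : nat -> nat) :
  \det (\matrix_(i < m, j < m) ('C(a j, i)%:R + 'C((a j).+1, i)%:R : rat))
  = 2 ^+ m * binom_det m a.
Proof.
pose T : 'M[rat]_m := \matrix_(i, k) ((k == i)%:R *+ 2 + (k.+1 == i :> nat)%:R).
have -> : \matrix_(i < m, j < m) ('C(a j, i)%:R + 'C((a j).+1, i)%:R : rat)
       = T *m \matrix_(i < m, j < m) 'C(a j, i)%:R.
  apply/matrixP => i j; rewrite !mxE.
  under eq_bigr do rewrite !mxE mulrDl.
  rewrite big_split /= (bigD1 i) //= eqxx mulr1n big1 ?addr0; last first.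
    by move=> k /negPf ->; rewrite mul0rn mul0r.
  case: i => [[|i] im] /=.
    rewrite !bin0 big1 ?addr0; first by rewrite mulr_natl mulr2n.
    by move=> k _; rewrite mul0r.
  have im' := ltnW im.
  rewrite (bigD1 (Ordinal im')) //= eqxx mul1r big1 ?addr0; last first.
    move=> k; rewrite -val_eqE /= => /negPf ki.
    by rewrite eqSS ki mul0r.
  by rewrite binS natrD mulr_natl; ring.
rewrite det_mulmx; congr (_ * _).
rewrite det_trig.
  rewrite -[m in RHS]card_ord -prodr_const; apply: eq_bigr => i _.
  rewrite !mxE eqxx.
  by have -> : (i.+1 == i :> nat) = false by lia.
apply/is_trig_mxP => i j ij; rewrite !mxE.
have -> : (j == i) = false by rewrite -val_eqE /=; lia.
by have -> : (j.+1 == i :> nat) = false by lia.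
Qed.

(** Subtracting neighbouring columns turns the first row, all ones, into (1, 0, ..., 0); expansion
    along it leaves the differences. *)
Lemma binom_det_diff m (a : nat -> nat) :
  binom_det m.+1 a =
  \det (\matrix_(i < m, j < m) ('C(a j.+1, i.+1)%:R - 'C(a j, i.+1)%:R : rat)).
Proof.
pose T : 'M[rat]_m.+1 := \matrix_(k, j) ((k == j)%:R - (k.+1 == j :> nat)%:R).
have detT : \det T = 1.
  rewrite -det_tr det_trig.
    rewrite big1 // => i _; rewrite !mxE eqxx.
    by have -> : (i.+1 == i :> nat) = false by lia.
  apply/is_trig_mxP => i j ij; rewrite !mxE.
  have -> : (j == i) = false by rewrite -val_eqE /=; lia.
  by have -> : (j.+1 == i :> nat) = false by lia.
transitivity (binom_det m.+1 a * \det T); first by rewrite detT mulr1.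
rewrite /binom_det -det_mulmx.
set M := _ *m _.
have M0 (i : 'I_m.+1) : M i 0 = 'C(a 0, i)%:R.
  rewrite !mxE (bigD1 0) //= big1 ?addr0 => [|k /negPf k0]; rewrite !mxE /=.
    by rewrite subr0 mulr1.
  by rewrite k0 subrr mulr0.
have MS (i : 'I_m.+1) (j : 'I_m) :
    M i (lift 0 j) = 'C(a j.+1, i)%:R - 'C(a j, i)%:R.
  rewrite !mxE; under eq_bigr do rewrite !mxE mulrBr.
  rewrite sumrB; congr (_ - _).
    rewrite (bigD1 (lift 0 j)) //= big1 ?addr0 => [|k /negPf k0].
      by rewrite eqxx mulr1.
    by rewrite k0 mulr0.
  rewrite (bigD1 (widen_ord (leqnSn m) j)) //= big1 ?addr0 => [|k].
    by rewrite /bump leq0n eqxx mulr1.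
  by rewrite -val_eqE /= /bump leq0n add1n eqSS => /negPf ->; rewrite mulr0.
rewrite (expand_det_row _ 0) (bigD1 0) //= big1 ?addr0 => [|j].
  rewrite M0 bin0 mul1r /cofactor /= expr0 mul1r.
  congr (\det _); apply/matrixP => i j.
  have -> : row' 0 (col' 0 M) i j = M (lift 0 i) (lift 0 j) by rewrite !mxE.
  by rewrite MS [RHS]mxE.
case: (unliftP 0 j) => [k ->|-> //] _.
by rewrite MS !bin0 subrr mul0r.
Qed.

Lemma sum_bin (a b k : nat) : (a <= b)%N ->
  (\sum_(a <= x < b) 'C(x, k) + 'C(a, k.+1) = 'C(b, k.+1))%N.
Proof.
move=> ab; rewrite -(subnKC ab); elim: (b - a)%N => [|d IH].
  by rewrite addn0 big_geq.
by rewrite addnS big_nat_recr ?leq_addr //= addnAC IH binS.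
Qed.

Definition superfact (m : nat) : nat := \prod_(i < m) i`!.

(** i! C(x, i) is the falling factorial [q i], monic of degree [i] in x. Scaling the rows by
    factorials and a unitriangular row operation lead to the Vandermonde matrix. *)
Lemma binom_det_vandermonde m (a : nat -> nat) :
  binom_det m a * (superfact m)%:R =
  \prod_(i < m) \prod_(j < m | (i < j)%N) ((a j)%:R - (a i)%:R).
Proof.
pose q (i : nat) : {poly rat} := \prod_(k < i) ('X - (k%:R)%:P).
have qx (i x : nat) : (q i).[x%:R] = ('C(x, i) * i`!)%:R.
  rewrite bin_ffact /q horner_prod.
  elim: i => [|i IH]; first by rewrite big_ord0 ffactn0.
  rewrite big_ord_recr /= IH !hornerE ffactnSr natrM; case: (leqP i x) => ix.
    by rewrite natrB.
  by rewrite ffact_small // !mul0r.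
have qm i : q i \is monic by apply: monic_prod_XsubC.
have qs i : size (q i) = i.+1 by rewrite /q size_prod_XsubC /index_enum -enumT size_enum_ord.
transitivity (\det (\matrix_(i < m, j < m) (q i).[(a j)%:R])).
  pose T : 'M[rat]_m := diag_mx (\row_i (i`!)%:R).
  have -> : \matrix_(i < m, j < m) (q i).[(a j)%:R] = T *m \matrix_(i < m, j < m) 'C(a j, i)%:R.
    by apply/matrixP => i j; rewrite mul_diag_mx !mxE qx mulnC natrM.
  rewrite det_mulmx det_diag mulrC /binom_det /superfact natr_prod; congr (_ * _).
  by apply: eq_bigr => i _; rewrite mxE.
pose T : 'M[rat]_m := \matrix_(i, k) (q i)`_k.
pose b : 'rV[rat]_m := \row_j (a j)%:R.
have -> : \matrix_(i < m, j < m) (q i).[(a j)%:R] = T *m Vandermonde m b.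
  apply/matrixP => i j; rewrite !mxE (@horner_coef_wide _ m) ?qs //.
  by apply: eq_bigr => k _; rewrite !mxE.
rewrite det_mulmx det_Vandermonde det_trig.
  rewrite big1 ?mul1r => [|i _].
    by apply: eq_bigr => i _; apply: eq_bigr => j _; rewrite !mxE.
  by rewrite !mxE; have := qm i; rewrite monicE /lead_coef qs => /eqP.
apply/is_trig_mxP => i j ij; rewrite !mxE.
by apply: nth_default; rewrite qs.
Qed.

(** * Summing [vdm] over interlacings and jumps *)

Section Sums.
Variable N : nat.
Local Notation st := {set 'I_N.+1}.
Local Notation ivl := (@ivl N).
Implicit Types (D F G Y Z : st) (i j k n m : nat).

Definition mono m (g : {ffun 'I_m -> 'I_N.+1}) : bool :=
  [forall i : 'I_m, forall j : 'I_m, (i < j)%N ==> (g i < g j)%N].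

Lemma monoP m (g : {ffun 'I_m -> 'I_N.+1}) :
  reflect (forall i j : 'I_m, (i < j)%N -> (g i < g j)%N) (mono g).
Proof.
apply: (iffP forallP) => h i; last by apply/forallP => j; apply/implyP; apply: h.
by move=> j; apply/implyP; apply: (forallP (h i)).
Qed.

Lemma mono_inj m (g : {ffun 'I_m -> 'I_N.+1}) : mono g -> injective g.
Proof.
move/monoP => h i j /(congr1 (@nat_of_ord _)) e; apply/val_inj/eqP.
by rewrite eqn_leq; apply/andP; split; rewrite leqNgt; apply/negP => /h; lia.
Qed.

Lemma enum_mono m (g : {ffun 'I_m -> 'I_N.+1}) : mono g ->
  [seq val x | x <- enum (g @: setT)] = [seq val (g i) | i : 'I_m <- enum 'I_m].
Proof.
move=> mg; apply: (irr_sorted_eq ltn_trans ltnn); first exact: sorted_enum_val.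
  rewrite (map_comp val g) sorted_map.
  have: sorted (relpre val ltn) (enum 'I_m).
    by rewrite -sorted_map val_enum_ord iota_ltn_sorted.
  rewrite sorted_map; apply: sub_sorted => i j /=.
  by move/monoP: mg; apply.
move=> x; apply/mapP/mapP => -[y].
  by rewrite mem_enum => /imsetP[i _ ->] ->; exists i; rewrite ?mem_enum.
by move=> _ ->; exists (g y) => //; rewrite mem_enum imset_f.
Qed.

Lemma card_mono m (g : {ffun 'I_m -> 'I_N.+1}) : mono g -> #|g @: setT| = m.
Proof. by move=> /mono_inj gi; rewrite card_imset // cardsT card_ord. Qed.

Lemma pt_mono m (g : {ffun 'I_m -> 'I_N.+1}) (i : 'I_m) : mono g ->
  pt (g @: setT) i = g i.
Proof.
move=> mg; rewrite /pt enum_mono // (nth_map i) ?size_enum_ord //.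
by rewrite nth_ord_enum.
Qed.

(** Passing to increasing maps gives a sum over tuples, the form that [det_sum_family] needs. *)
Lemma sum_mono m (P : pred st) (phi : st -> rat) :
  \sum_(G : st | (#|G| == m) && P G) phi G =
  \sum_(g : {ffun 'I_m -> 'I_N.+1} | mono g && P (g @: setT)) phi (g @: setT).
Proof.
pose h (g : {ffun 'I_m -> 'I_N.+1}) : st := g @: setT.
pose h' G : {ffun 'I_m -> 'I_N.+1} := [ffun i : 'I_m => nth ord0 (enum G) i].
have h'P G : #|G| = m -> mono (h' G).
  move=> Gm; apply/monoP => i j ij; rewrite !ffunE.
  have := @pt_ltn _ G i j; rewrite /pt !(nth_map ord0) -?cardE ?Gm //.
  by apply.
rewrite (reindex_onto h h') => [|G /andP[/eqP Gm _]].
  apply: eq_bigl => g; rewrite -andbA andbC -andbA; case: (boolP (mono g)) => mg /=.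
    rewrite card_mono // eqxx /= andbT; case: (P (h g)) => //=.
    apply/eqP/ffunP => i; rewrite ffunE; apply: val_inj.
    by have := pt_mono i mg; rewrite /pt (nth_map ord0) // -cardE card_mono.
  apply/negbTE; apply/negP => /and3P[_ /eqP e /eqP c].
  by move/negP: mg; apply; rewrite -e; apply: h'P.
apply/setP => x; apply/imsetP/idP => [[i _ ->]|xG].
  by rewrite ffunE -mem_enum mem_nth // -cardE Gm.
have xi : (index x (enum G) < m)%N by rewrite -Gm cardE index_mem mem_enum.
by exists (Ordinal xi) => //; rewrite ffunE /= nth_index // mem_enum.
Qed.

(* [Delta] of [D] over [Delta] of an initial interval: see [Delta_ratio]. *)
Definition vdm D : rat := binom_det #|D| (pt D).

Lemma V_mono m (g : {ffun 'I_m -> 'I_N.+1}) : mono g ->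
  vdm (g @: setT) = \det (\matrix_(i < m, j < m) 'C(g j, i)%:R).
Proof.
move=> mg; rewrite /vdm card_mono //; congr (\det _).
by apply/matrixP => i j; rewrite !mxE pt_mono.
Qed.

Lemma sub_ivl_mono m (g : {ffun 'I_m -> 'I_N.+1}) n :
  (g @: setT \subset ivl n) = [forall i : 'I_m, (g i < n)%N].
Proof.
apply/subsetP/forallP => [h i|h x /imsetP[i _ ->]]; last by rewrite inE.
by have := h (g i); rewrite inE; apply; apply: imset_f.
Qed.

(** The particles of [F] range independently over the disjoint intervals between consecutive points
    of [G], so monotonicity is automatic. The column sums are differences of binomials by [sum_bin],
    and [binom_det_diff] collects them. *)
Lemma interlace_V n G : (n <= N)%N -> G \subset ivl n.+1 -> (0 < #|G|)%N ->
  \sum_(F | interlace n F G) vdm F = vdm G.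
Proof.
move=> nN Gn G0; set m := #|G|.-1.
have Gm : #|G| = m.+1 by rewrite prednK.
rewrite (eq_bigl (fun F => (#|F| == m) && interlace n F G)); last first.
  move=> F; case aF: (interlace n F G); rewrite ?andbF // andbT.
  by rewrite /m (interlace_card nN aF) eqxx.
rewrite (sum_mono m (fun F => interlace n F G)).
pose Q (j : 'I_m) (x : 'I_N.+1) := (pt G j <= x < pt G j.+1)%N.
have PQ (g : {ffun 'I_m -> 'I_N.+1}) :
    mono g && interlace n (g @: setT) G = [forall j : 'I_m, Q j (g j)].
  apply/andP/forallP => [[mg /(interlace_ptP _ _ nN)[_ _ _ h]] j|h].
    by have := h j; rewrite card_mono // pt_mono //; apply.
  have mg : mono g.
    apply/monoP => i j ij; case/andP: (h i) => _ /leq_trans; apply.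
    case/andP: (h j) => + _; apply: leq_trans.
    move: ij; rewrite leq_eqVlt => /predU1P[->//|ij].
    by apply/ltnW/pt_ltn => //; rewrite Gm; have := ltn_ord j; lia.
  split=> //; apply/(interlace_ptP _ _ nN); split=> //.
  - rewrite sub_ivl_mono; apply/forallP => i; case/andP: (h i) => _ /leq_trans; apply.
    by have := @pt_sub _ G n.+1 i.+1 Gn; rewrite Gm ltnS ltn_ord => /(_ isT).
  - by rewrite card_mono.
  by move=> i; rewrite card_mono // => im; have /= -> := pt_mono (Ordinal im) mg; apply: h (Ordinal im).
rewrite (eq_bigl _ _ PQ) (eq_bigr (fun g : {ffun 'I_m -> 'I_N.+1} =>
    \det (\matrix_(i < m, j < m) 'C(g j, i)%:R))); last first.
  by move=> g; rewrite -PQ => /andP[mg _]; apply: V_mono.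
rewrite (det_sum_family Q (fun (i : 'I_m) (x : 'I_N.+1) => 'C(x, i)%:R)) /vdm Gm binom_det_diff.
congr (\det _); apply/matrixP => i j; rewrite !mxE.
have jm : (j.+1 < #|G|)%N by rewrite Gm ltnS ltn_ord.
rewrite -(@sum_bin (pt G j)) ?(ltnW (pt_ltn jm (ltnSn _))) // natrD addrK natr_sum.
rewrite big_geq_mkord (@big_ord_widen_cond _ _ _ _ N.+1 _ (fun x => 'C(x, i)%:R)).
  by apply: eq_bigl => x; rewrite /Q andbC.
by have := pt_sub Gn jm; lia.
Qed.

(** Letting every particle jump independently adds only tuples in which two particles collide; their
    determinants have two equal columns and vanish. The full sum is then [binom_det_jump]. *)
Lemma jump_V n F : (n <= N)%N -> F \subset ivl n ->
  \sum_(G | jump n G F) vdm G = 2 ^+ #|F| * vdm F.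
Proof.
move=> nN Fn; set m := #|F|.
rewrite (eq_bigl (fun G => (#|G| == m) && jump n G F)); last first.
  move=> G; case aF: (jump n G F); rewrite ?andbF // andbT.
  by rewrite (jump_card aF) eqxx.
rewrite (sum_mono m (fun G => jump n G F)).
pose Q (j : 'I_m) (x : 'I_N.+1) := (pt F j <= x <= (pt F j).+1)%N.
rewrite (eq_bigr (fun g : {ffun 'I_m -> 'I_N.+1} =>
    \det (\matrix_(i < m, j < m) 'C(g j, i)%:R))); last first.
  by move=> g /andP[mg _]; apply: V_mono.
have PQ (g : {ffun 'I_m -> 'I_N.+1}) :
    mono g && jump n (g @: setT) F = mono g && [forall j : 'I_m, Q j (g j)].
  case: (boolP (mono g)) => //= mg.
  apply/jump_ptP/forallP => [[_ _ _ h] j|h].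
    by have := h j; rewrite pt_mono // /Q ; apply; apply: ltn_ord.
  split=> //; last 2 first.
  - by rewrite card_mono.
  - move=> i im; have := h (Ordinal im); have /= -> := pt_mono (Ordinal im) mg; apply.
  rewrite sub_ivl_mono; apply/forallP => i.
  have := h i; have := pt_sub Fn (ltn_ord i); rewrite /Q; lia.
rewrite (eq_bigl _ _ PQ).
transitivity (\sum_(g : {ffun 'I_m -> 'I_N.+1} | [forall j : 'I_m, Q j (g j)])
    \det (\matrix_(i < m, j < m) 'C(g j, i)%:R) : rat).
  rewrite [RHS](bigID (@mono m)) /= [X in _ = _ + X]big1 ?addr0.
    by apply: eq_bigl => g; rewrite andbC.
  move=> g /andP[/forallP h].
  rewrite /mono negb_forall => /existsP[i]; rewrite negb_forall => /existsP[j].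
  rewrite negb_imply => /andP[ij ge].
  have e : g i = g j :> nat.
    have := h i; have := h j; rewrite /Q.
    by have := pt_ltn (ltn_ord j) ij; lia.
  rewrite -det_tr; apply: (@determinant_alternate _ _ _ i j).
    by rewrite -val_eqE neq_ltn ij.
  by move=> k; rewrite !mxE e.
rewrite (det_sum_family Q (fun (i : 'I_m) (x : 'I_N.+1) => 'C(x, i)%:R)) /vdm -binom_det_jump.
congr (\det _); apply/matrixP => i j; rewrite !mxE.
have jn := pt_sub Fn (ltn_ord j).
have j1 : (pt F j < N.+1)%N by lia.
have j2 : ((pt F j).+1 < N.+1)%N by lia.
rewrite (bigD1 (Ordinal j1)) /=; last by rewrite /Q leqnn leqnSn.
congr (_ + _); rewrite (big_pred1 (Ordinal j2)) //= => x.
have -> : pred1 (Ordinal j2) x = (x == (pt F j).+1 :> nat) by [].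
rewrite /Q -val_eqE /= neq_ltn eqn_leq.
by apply/idP/idP; lia.
Qed.
End Sums.

(** * Transfer operators *)

Lemma minn2_mul u v c : (u < 2 -> v < 2 -> c = u * v)%N ->
  (2 <= u -> c = 2 * minn 2 v)%N -> (2 <= v -> c = 2 * minn 2 u)%N ->
  c = (minn 2 u * minn 2 v)%N.
Proof.
move=> h1 h2 h3; case: (leqP 2 u) => hu; first exact: h2.
case: (leqP 2 v) => hv; first by rewrite mulnC; rewrite h3 // (minn_idPr (ltnW hu)).
exact: h1.
Qed.

Section Operators.
Variable N : nat.
Local Notation st := {set 'I_N.+1}.
Local Notation ivl := (@ivl N).
Implicit Types (B D F G S Y Z : st) (i j k n m : nat) (t : st -> rat).

Lemma sum_itv p q : (q <= N)%N ->
  \sum_(x : 'I_N.+1 | (p <= x <= q)%N) 1 = (q.+1 - p)%:R :> rat.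
Proof.
move=> qN; rewrite -[RHS]mulr1 mulr_natl -(sumr_const_nat q.+1 p (1 : rat)).
by rewrite big_geq_mkord (@big_ord_widen_cond _ _ _ _ N.+1 _ (fun=> 1)).
Qed.

Lemma sum_family1 m (I : finType) (Q : 'I_m -> pred I) :
  \sum_(g : {ffun 'I_m -> I} | [forall j : 'I_m, Q j (g j)]) 1
  = \prod_(j < m) \sum_(x | Q j x) 1 :> rat.
Proof.
rewrite bigA_distr_big_dep /=; apply: eq_big => [h|h _]; last by rewrite big1.
by apply/forallP/familyP.
Qed.

(* Both counts below are products over the particles, and twice each factor is the
   product of the weights of a particle with its two neighbours. *)
Let wt (x y : nat) : nat := minn 2 (y.+1 - x).

Lemma interlace_jump_comm n Z Y : (n.+1 <= N)%N ->
  \sum_(D | interlace n.+1 Z D && jump n.+1 D Y) 1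
  = 2 * \sum_(D | jump n Z D && interlace n D Y) 1 :> rat.
Proof.
move=> nN; have nN' := ltnW nN.
have [/and3P[Zn Yn /eqP YZ]|bad] :=
  boolP [&& Z \subset ivl n.+1, Y \subset ivl n.+1 & #|Y| == #|Z|.+1]; last first.
  rewrite !big1 ?mulr0 // => D /andP[h1 h2].
    case/jump_ptP: (h1) => Zn _ c _; case/(interlace_ptP _ _ nN'): h2 => _ Yn c' _.
    by move: bad; rewrite Zn Yn c c' eqxx.
  case/(interlace_ptP _ _ nN): h1 => Zn _ c _; case/jump_ptP: h2 => _ Yn c' _.
  by move: bad; rewrite Zn Yn -c' c eqxx.
set m := #|Z| in YZ.
have ymono i j : (j < m.+1)%N -> (i < j)%N -> (pt Y i < pt Y j)%N.
  by move=> jm; apply: pt_ltn; rewrite YZ.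
have zmono i j : (j < m)%N -> (i < j)%N -> (pt Z i < pt Z j)%N by apply: pt_ltn.
have zn i : (i < m)%N -> (pt Z i <= n)%N by move=> im; rewrite -ltnS; apply: pt_sub.
have yn i : (i < m.+1)%N -> (pt Y i <= n)%N.
  by move=> im; rewrite -ltnS; apply: pt_sub; rewrite ?YZ.
(* The outermost particles are bounded only by the walls 0 and [n.+1] of the row of width [n.+2]. *)
pose lo j := if j is j'.+1 then (pt Z j').+1 else 0%N.
pose hi j := if (j < m)%N then pt Z j else n.+1.
pose Q (j : 'I_m.+1) (x : 'I_N.+1) :=
  (maxn (lo j) (pt Y j) <= x <= minn (hi j) (pt Y j).+1)%N.
(* If [pt Z j] is 0, the truncated predecessor is the wall 0, as it should be; [pt Y j.+1] is always
   positive. *)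
pose Q' (j : 'I_m) (x : 'I_N.+1) :=
  (maxn (pt Z j).-1 (pt Y j) <= x <= minn (pt Z j) (pt Y j.+1).-1)%N.
have -> : \sum_(D | interlace n.+1 Z D && jump n.+1 D Y) 1
    = \sum_(g : {ffun 'I_m.+1 -> 'I_N.+1} | [forall j : 'I_m.+1, Q j (g j)]) 1 :> rat.
  rewrite (eq_bigl (fun D => (#|D| == m.+1) && (interlace n.+1 Z D && jump n.+1 D Y))); last first.
    move=> D; case: (boolP (interlace _ _ _)) => a; rewrite ?andbF //=.
    by rewrite (interlace_card nN a) eqxx.
  rewrite (sum_mono m.+1 (fun D => interlace n.+1 Z D && jump n.+1 D Y)).
  apply: eq_bigl => g; apply/idP/forallP => [/and3P[mg] | h].
    case/(interlace_ptP _ _ nN) => _ gn _ h1; case/jump_ptP=> _ _ _ h2 j.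
    have := h2 j; rewrite YZ pt_mono // ltn_ord => /(_ isT) h2j.
    have hj : (lo j <= g j)%N.
      case: j {h2j} => [[|j] jm] //=.
      have := h1 j; rewrite -ltnS jm => /(_ isT).
      by have /= -> := pt_mono (Ordinal jm) mg; lia.
    have hj' : (g j <= hi j)%N.
      rewrite /hi; case: ifP => jm; last first.
        move: gn; rewrite sub_ivl_mono => /forallP/(_ j); rewrite ltnS; apply.
      by have := h1 j jm; rewrite pt_mono // => /andP[].
    by rewrite /Q geq_max leq_min hj hj' h2j.
  have mg : mono g.
    apply/monoP => i [[|j] jm] // ij.
    apply: (@leq_ltn_trans (pt Z i)).
      have := h i; rewrite /Q /hi; have -> : (i < m)%N by apply: leq_trans ij jm.
      by rewrite geq_max leq_min -andbA => /and4P[].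
    apply: (@leq_ltn_trans (pt Z j)).
      by move: ij; rewrite /= ltnS leq_eqVlt => /predU1P[->//|ij]; apply/ltnW/zmono.
    by have := h (Ordinal jm); rewrite /Q /=; lia.
  have gn : g @: setT \subset ivl n.+2.
    rewrite sub_ivl_mono; apply/forallP => i; have /andP[_] := h i.
    rewrite leq_min => /andP[_ /leq_ltn_trans]; apply.
    by rewrite !ltnS; apply: yn (ltn_ord i).
  apply/and3P; split=> //.
    apply/(interlace_ptP _ _ nN); split=> //; first by rewrite card_mono.
    move=> i im; have im1 : (i < m.+1)%N by lia.
    have im2 : (i.+1 < m.+1)%N by lia.
    have /= -> := pt_mono (Ordinal im1) mg; have /= -> := pt_mono (Ordinal im2) mg.
    by have := h (Ordinal im1); have := h (Ordinal im2); rewrite /Q /= /hi im; lia.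
  apply/jump_ptP; split=> //; first by rewrite card_mono.
  rewrite YZ => i im; have /= -> := pt_mono (Ordinal im) mg.
  by have := h (Ordinal im); rewrite /Q /=; lia.
have -> : \sum_(D | jump n Z D && interlace n D Y) 1
    = \sum_(g : {ffun 'I_m -> 'I_N.+1} | [forall j : 'I_m, Q' j (g j)]) 1 :> rat.
  rewrite (eq_bigl (fun D => (#|D| == m) && (jump n Z D && interlace n D Y))); last first.
    move=> D; case: (boolP (jump _ _ _)) => a; rewrite ?andbF //=.
    by rewrite -(jump_card a) eqxx.
  rewrite (sum_mono m (fun D => jump n Z D && interlace n D Y)).
  apply: eq_bigl => g; apply/idP/forallP => [/and3P[mg] | h].
    case/jump_ptP=> _ _ _ h2; case/(interlace_ptP _ _ nN') => _ gn _ h1 j.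
    have := h2 j; have := h1 j; rewrite card_mono // pt_mono // ltn_ord.
    by move=> /(_ isT) + /(_ isT); rewrite /Q'; lia.
  have mg : mono g.
    apply/monoP => i j ij; have := h i; have := h j; rewrite /Q'.
    have := ymono i.+1 j (ltnW (ltn_ord j)); have := ymono i i.+1.
    have := ltn_ord j; move: ij.
    case: (ltngtP i.+1 j) => [ij|ij|ij] //; try lia.
    by rewrite ij; lia.
  have gn : g @: setT \subset ivl n.
    rewrite sub_ivl_mono; apply/forallP => i; have := h i; rewrite /Q'.
    have := yn i.+1; have := ymono i i.+1; have := ltn_ord i; lia.
  apply/and3P; split=> //.
    apply/jump_ptP; split=> //.
    - by rewrite card_mono.
    rewrite card_mono // => i im; have /= -> := pt_mono (Ordinal im) mg.
    by have := h (Ordinal im); rewrite /Q' /=; lia.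
  apply/(interlace_ptP _ _ nN'); split=> //.
  - by rewrite card_mono.
  rewrite card_mono // => i im; have /= -> := pt_mono (Ordinal im) mg.
  by have := h (Ordinal im); rewrite /Q' /=; have := ymono i i.+1; lia.
rewrite !sum_family1.
pose a j := if j is j'.+1 then wt (pt Z j') (pt Y j) else 2%N.
pose b j := if (j < m)%N then wt (pt Y j) (pt Z j) else 2%N.
have c1 (j : 'I_m.+1) : 2 * \sum_(x | Q j x) 1 = (a j * b j)%:R :> rat.
  rewrite sum_itv; last by have := yn j (ltn_ord j); lia.
  rewrite -natrM; congr (_%:R); rewrite /a /b /hi /lo /wt.
  have := yn j (ltn_ord j); have := ltn_ord j.
  case: ifP => jm; case E: (nat_of_ord j) => [|j'] jm1 yj.
  - by lia.
  - have := zmono j' j'.+1; rewrite -E jm => /(_ isT); rewrite E ltnSn => /(_ isT).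
    by move=> zz; apply: minn2_mul; nia.
  - by lia.
  - have := zn j'; rewrite -ltnS -E ltn_ord => /(_ isT); rewrite E.
    by lia.
have c2 (j : 'I_m) : 2 * \sum_(x | Q' j x) 1 = (b j * a j.+1)%:R :> rat.
  rewrite sum_itv; last by have := zn j (ltn_ord j); lia.
  rewrite -natrM; congr (_%:R); rewrite /a /b ltn_ord /wt.
  have := ymono j j.+1; rewrite ltnS ltn_ord ltnSn => /(_ isT isT).
  by move=> yy; apply: minn2_mul; nia.
(* The weights beyond the two ends are 2 each, hence the 4. One of these factors is used up by the
   additional particle on this side, the other is the 2 of the statement. *)
have e1 : 2 ^+ m.+1 * \prod_(j < m.+1) \sum_(x | Q j x) 1
    = (4 * \prod_(j < m) (b j * a j.+1))%:R :> rat.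
  rewrite -[X in _ ^+ X * _]card_ord -prodr_const -big_split /=.
  rewrite (eq_bigr _ (fun (j : 'I_m.+1) _ => c1 j)) -natr_prod; congr (_%:R).
  rewrite !big_split /= [X in (X * _ = _)%N]big_ord_recl [X in (_ * X = _)%N]big_ord_recr /=.
  have -> : b m = 2%N by rewrite /b ltnn.
  under eq_bigr do rewrite /bump leq0n add1n.
  by lia.
have e2 : 2 ^+ m * \prod_(j < m) \sum_(x | Q' j x) 1
    = (\prod_(j < m) (b j * a j.+1))%:R :> rat.
  rewrite -[X in _ ^+ X * _]card_ord -prodr_const -big_split /=.
  by rewrite (eq_bigr _ (fun (j : 'I_m) _ => c2 j)) -natr_prod.
apply: (@mulfI _ (2 ^+ m.+1)); first by rewrite expf_neq0.
by rewrite e1 natrM -e2 exprS; ring.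
Qed.

Definition opA n t Z : rat := \sum_(Y | interlace n Z Y) t Y.
Definition opJ n t Z : rat := \sum_(Y | jump n Z Y) t Y.

Lemma opA_opJ n t Z : (n.+1 <= N)%N ->
  opA n.+1 (opJ n.+1 t) Z = 2 * opJ n (opA n t) Z.
Proof.
move=> nN; rewrite /opA /opJ.
rewrite (exchange_big_dep predT) //= [in RHS](exchange_big_dep predT) //= mulr_sumr.
apply: eq_bigr => Y _.
rewrite -[LHS]mulr1; under [in LHS]eq_bigr do rewrite -[t Y]mulr1.
rewrite -[LHS]/(_ * 1) mulr1 -mulr_sumr interlace_jump_comm // mulrCA; congr (_ * _).
by rewrite mulr_sumr; apply: eq_bigr => D _; rewrite mulr1.
Qed.

End Operators.

(** * Sorted products of operators and frozen particles *)

Section Frozen.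
Variable N : nat.
Local Notation st := {set 'I_N.+1}.
Local Notation ivl := (@ivl N).
Implicit Types (B D F G S Y Z : st) (h i j k n m : nat) (t : st -> rat).

(** In both iterations [n] is the narrow end: [iterJ j n] goes from width [n + j] down to [n],
    [iterA h n] from [n] up to [n + h]. *)
Fixpoint iterJ j n t : st -> rat :=
  if j is j'.+1 then opJ (n + j') (iterJ j' n t) else t.
Fixpoint iterA h n t : st -> rat :=
  if h is h'.+1 then opA n (iterA h' n.+1 t) else t.

Lemma opA_ext n t t' Z : (forall Y, interlace n Z Y -> t Y = t' Y) ->
  opA n t Z = opA n t' Z.
Proof. by move=> e; apply: eq_bigr. Qed.

Lemma opJ_ext n t t' Z : (forall Y, jump n Z Y -> t Y = t' Y) ->
  opJ n t Z = opJ n t' Z.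
Proof. by move=> e; apply: eq_bigr. Qed.

Lemma opJ_scale n c t Z : opJ n (fun Y => c * t Y) Z = c * opJ n t Z.
Proof. by rewrite /opJ mulr_sumr. Qed.

Lemma opA_scale n c t Z : opA n (fun Y => c * t Y) Z = c * opA n t Z.
Proof. by rewrite /opA mulr_sumr. Qed.

Lemma opA_iterJ j n t Z : (n + j <= N)%N ->
  opA (n + j) (iterJ j n.+1 t) Z = 2 ^+ j * iterJ j n (opA n t) Z.
Proof.
elim: j Z => [|j IH] Z jN /=; first by rewrite addn0 mul1r.
rewrite addnS addSn opA_opJ; last by rewrite -addnS.
rewrite (opJ_ext (t' := fun Y => 2 ^+ j * iterJ j n (opA n t) Y)).
  by rewrite opJ_scale exprS mulrA.
by move=> Y _; apply: IH; lia.
Qed.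

Definition shift j Z : st := [set inord (x + j) | x : 'I_N.+1 in Z].

Lemma shift_sub j n Z : (n + j <= N.+1)%N -> Z \subset ivl n ->
  shift j Z \subset ivl (n + j).
Proof.
move=> nj /subsetP Zn; apply/subsetP => x /imsetP[z /Zn + ->].
by rewrite !inE => zn; rewrite inordK; lia.
Qed.

Lemma cnt_shift j n Z k : (n + j <= N.+1)%N -> Z \subset ivl n ->
  cnt (shift j Z) k = cnt Z (k - j).
Proof.
move=> nj /subsetP Zn; rewrite /cnt.
have zb (z : 'I_N.+1) : z \in Z -> (z + j < N.+1)%N.
  by move=> /Zn; rewrite inE; lia.
rewrite -[RHS](@card_in_imset _ _ (fun z : 'I_N.+1 => inord (z + j) : 'I_N.+1)).
  congr #|pred_of_set _|; apply/setP => x; rewrite inE.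
  apply/andP/imsetP => [[/imsetP[z zZ ->]]|[z]].
    rewrite inordK ?zb // => zk; exists z => //.
    by rewrite inE zZ /=; lia.
  rewrite inE => /andP[zZ zk] ->; split; first by apply: imset_f.
  by rewrite inordK ?zb //; lia.
move=> x y; rewrite !inE => /andP[xZ _] /andP[yZ _] /(congr1 (@nat_of_ord _)).
by rewrite !inordK ?zb // => /addIn /val_inj.
Qed.

Lemma mem_shift j n Z (x : 'I_N.+1) : (n + j <= N.+1)%N -> Z \subset ivl n ->
  (x \in shift j Z) = (j <= x)%N && (inord (x - j) \in Z).
Proof.
move=> nj /subsetP Zn; apply/imsetP/andP => [[z zZ ->]|[jx xZ]].
  have := Zn _ zZ; rewrite inE => zn; rewrite inordK; last by lia.
  by rewrite addnK inord_val; split=> //; lia.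
exists (inord (x - j)) => //; apply: val_inj.
have := ltn_ord x => xN; rewrite /= !inordK; lia.
Qed.

Definition unshift j n (D : st) : st :=
  [set x : 'I_N.+1 | (x < n)%N && (inord (x + j) \in D)].

Lemma shiftK j n Z : (n + j <= N.+1)%N -> Z \subset ivl n ->
  unshift j n (shift j Z) = Z.
Proof.
move=> nj Zn; apply/setP => x; rewrite inE.
apply/andP/idP => [[xn]|xZ].
  by rewrite (mem_shift _ nj) // inordK ?addnK ?inord_val; [case/andP|lia].
have := subsetP Zn _ xZ; rewrite inE => xn; split=> //.
by rewrite (mem_shift _ nj) // inordK ?addnK ?inord_val ?leq_addl //; lia.
Qed.

Lemma unshiftK j n D : (n + j <= N.+1)%N -> D \subset ivl (n + j) ->
  cnt D j = 0%N -> shift j (unshift j n D) = D.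
Proof.
move=> nj /subsetP Dn D0.
have un : unshift j n D \subset ivl n by apply/subsetP => x; rewrite !inE => /andP[].
apply/setP => x; rewrite (mem_shift _ nj) // inE.
have xN := ltn_ord x.
apply/idP/idP => [/and3P[jx _]|xD].
  by rewrite inordK ?subnK ?inord_val //; lia.
have jx : (j <= x)%N.
  rewrite leqNgt; apply/negP => xj.
  have : (0 < cnt D j)%N by rewrite card_gt0; apply/set0Pn; exists x; rewrite inE xD.
  by rewrite D0.
have := Dn _ xD; rewrite inE => xn.
by rewrite jx /= inordK ?subnK ?inord_val ?xD ?andbT; lia.
Qed.

Lemma cnt0 D : cnt D 0 = 0%N.
Proof. by apply/eqP; rewrite cards_eq0; apply/eqP/setP => x; rewrite !inE andbF. Qed.

Lemma cnt_full D k : cnt D k = #|D| -> D \subset ivl k.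
Proof.
move=> e; have /subset_leqif_cards[_] : [set x in D | (x < k)%N] \subset D.
  by apply/subsetP => x; rewrite inE => /andP[].
rewrite -/(cnt D k) e eqxx => /esym/eqP <-.
by apply/subsetP => x; rewrite !inE => /andP[].
Qed.

(* The complement of [j + Z] in [n + 2 j]: the particles of the complement of
   [Z], flanked by [j] frozen particles on each side. *)
Definition frozen_vdm j n Z : rat := vdm (ivl (n + 2 * j) :\: shift j Z).

Lemma shift0 Z : shift 0 Z = Z.
Proof.
apply/setP => x; apply/imsetP/idP => [[z zZ ->]|xZ].
  by rewrite addn0 inord_val.
by exists x => //; rewrite addn0 inord_val.
Qed.

Lemma E0 n Z : frozen_vdm 0 n Z = vdm (ivl n :\: Z).
Proof. by rewrite /frozen_vdm shift0 muln0 addn0. Qed.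

(** [interlace_V] for complements. Shifting [Z'] by one position more than [Z] reverses the
    direction of the jump, so the complements in the enlarged rows interlace with that of [Z'] as
    the larger one, exactly when [jump n Z Z'] holds. *)
Lemma jump_E j n Z' : (n + 2 * j < N)%N -> Z' \subset ivl n ->
  \sum_(Z | jump n Z Z') frozen_vdm j n.+1 Z = frozen_vdm j.+1 n Z'.
Proof.
move=> nj Zn'; set n1 := (n + 2 * j).+1.
have n1N : (n1 <= N)%N by rewrite /n1.
have e1 : (n.+1 + 2 * j = n1)%N by rewrite /n1; lia.
have e2 : (n + 2 * j.+1 = n1.+1)%N by rewrite /n1; lia.
have b1 : (n + j.+1 <= N.+1)%N by lia.
have b2 : (n.+1 + j <= N.+1)%N by lia.
pose G := ivl n1.+1 :\: shift j.+1 Z'.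
have s1 : shift j.+1 Z' \subset ivl n1.+1.
  by apply: subset_trans (shift_sub b1 Zn') _; apply/subsetP => x; rewrite !inE; lia.
rewrite {2}/frozen_vdm e2 -/G -(@interlace_V _ n1) ?subsetDl //; last first.
  rewrite card_gt0; apply/set0Pn; exists ord0.
  by rewrite in_setD (mem_shift _ b1) //= inE.
pose h Z := ivl n1 :\: shift j Z.
pose h' F := unshift j n.+1 (ivl n1 :\: F).
have s2 Z : Z \subset ivl n.+1 -> shift j Z \subset ivl n1.
  by move=> Zn; apply: subset_trans (shift_sub b2 Zn) _; apply/subsetP => x; rewrite !inE; lia.
have key Z : Z \subset ivl n.+1 -> interlace n1 (h Z) G = jump n Z Z'.
  move=> Zn; rewrite interlace_compl //; last exact: s2.
  apply/jumpP/jumpP => [[_ _ c]|[_ _ c]]; split=> //; try exact: s2.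
    move=> k; have := c (k + j)%N; have := c (k + j).+1.
    rewrite !(cnt_shift _ b1) // !(cnt_shift _ b2) // !subSS addnK.
    by rewrite subSn ?leq_addl // addnK => /andP[-> _] /andP[_ ->].
  move=> k; rewrite !(cnt_shift _ b1) // !(cnt_shift _ b2) // subSS.
  have /andP[-> _] := c (k - j)%N; rewrite andbT.
  case: (ltnP j k) => jk; last by rewrite (eqP (_ : k - j.+1 == 0)%N) ?cnt0 // subn_eq0 ltnW.
  by rewrite -(subnSK jk); case/andP: (c (k - j.+1)%N).
rewrite [RHS](reindex_onto h h') => [|F /and3P[Fn _ /jumpP[_ Hn c]]].
  apply: eq_big => [Z|Z _]; last by rewrite /frozen_vdm e1.
  apply/idP/andP => [jZ|[aZ /eqP Zh]].
    have Zn : Z \subset ivl n.+1 by case/and3P: jZ.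
    by rewrite key // /h' complK ?s2 ?shiftK.
  have Zn : Z \subset ivl n.+1 by rewrite -Zh; apply/subsetP => x; rewrite !inE => /andP[].
  by rewrite -key.
(* Every [F] that interlaces [G] arises in this way: its holes avoid the first [j] positions and lie
   in the next [n.+1]. *)
move: c; rewrite /G complK // => c.
have WZ : #|ivl n1 :\: F| = #|Z'|.
  rewrite -(cnt_max (subsetDl _ F) (leqnSn n1)).
  rewrite -(@cnt_max _ Z' n (n.+2 + 2 * j - j.+1)%N) //; last by lia.
  have := c n1.+1; have := c n1; rewrite !(cnt_shift _ b1) //.
  rewrite !(cnt_max (subsetDl _ F)) // !(@cnt_max _ Z' n) //; lia.
rewrite /h /h' unshiftK ?complK //.
  apply: cnt_full; apply/eqP; rewrite eqn_leq cnt_card /= WZ.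
  have /andP[+ _] := c (n.+1 + j)%N; rewrite (cnt_shift _ b1) // addSn subSS addnK.
  by rewrite (cnt_max Zn').
have /andP[_] := c j; rewrite (cnt_shift _ b1) // subnn cnt0; lia.
Qed.

Lemma opA_E j n B : (n + 2 * j < N)%N -> B \subset ivl n ->
  opA n (fun Y => frozen_vdm j n.+1 (ivl n.+1 :\: Y)) B = frozen_vdm j.+1 n (ivl n :\: B).
Proof.
move=> nj Bn; rewrite -jump_E ?subsetDl // /opA.
rewrite (reindex_onto (fun Y => ivl n.+1 :\: Y) (fun Z => ivl n.+1 :\: Z)); last first.
  by move=> Y /and3P[_ Yn _]; rewrite complK.
apply: eq_big => [Z|Z /andP[_ /eqP ->] //].
apply/andP/idP => [[aZ /eqP Zh]|jZ].
  have Zn : Z \subset ivl n.+1 by rewrite -Zh subsetDl.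
  by rewrite -interlace_compl ?subsetDl // complK.
have Zn : Z \subset ivl n.+1 by case/and3P: jZ.
by rewrite complK // -(interlace_compl (subsetDl _ _) Zn) complK // in jZ *.
Qed.

Lemma iterA_E h j n B : (n + 2 * (h + j) <= N.+1)%N ->
  B \subset ivl n ->
  iterA h n (fun Y => frozen_vdm j (n + h) (ivl (n + h) :\: Y)) B = frozen_vdm (h + j) n (ivl n :\: B).
Proof.
elim: h j n B => [|h IH] j n B b1 Bn; first by rewrite /= addn0.
rewrite addSn -opA_E //; last by lia.
apply: opA_ext => Y /and3P[_ Yn _].
by rewrite -IH //; [rewrite addSnnS | lia].
Qed.

(** Transposition: the jump acting on [t] is made to act on [frozen_vdm], where [jump_E] evaluates
    it. *)
Lemma sum_E_opJ m k n t : (n + 2 * k < N)%N ->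
  \sum_(S : st | (S \subset ivl n.+1) && (#|S| == m)) frozen_vdm k n.+1 S * opJ n t S
  = \sum_(B : st | (B \subset ivl n) && (#|B| == m)) frozen_vdm k.+1 n B * t B.
Proof.
move=> nk; under eq_bigr do rewrite /opJ mulr_sumr.
rewrite (exchange_big_dep (fun B : st => (B \subset ivl n) && (#|B| == m))) /=; last first.
  by move=> S B /andP[Sn /eqP <-] j; rewrite (jump_card j) eqxx; case/and3P: j => _ ->.
apply: eq_bigr => B /andP[Bn /eqP Bm].
rewrite -jump_E // mulr_suml; apply: eq_bigl => S.
case j: (jump n S B); rewrite ?andbF // andbT (jump_card j) Bm eqxx andbT.
by case/and3P: j.
Qed.

Lemma sum_E_iterJ m j k n t : (n + 2 * (j + k) <= N.+1)%N ->
  \sum_(S : st | (S \subset ivl (n + j)) && (#|S| == m)) frozen_vdm k (n + j) S * iterJ j n t S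
  = \sum_(B : st | (B \subset ivl n) && (#|B| == m)) frozen_vdm (j + k) n B * t B.
Proof.
elim: j k => [|j IH] k b1; first by rewrite addn0.
rewrite addnS addSnnS (sum_E_opJ m (iterJ j n t)); last by lia.
by rewrite IH //; lia.
Qed.

End Frozen.

(** * Composing the steps of the three parts *)

Section Chains.
Variable N : nat.
Local Notation st := {set 'I_N.+1}.
Local Notation ivl := (@ivl N).
Implicit Types (B S X Y : st) (h i j k n m : nat) (t : st -> rat) (v w : nat -> nat).

Definition transfer (a b : nat) X Y : bool :=
  if (a < b)%N then interlace a X Y else jump b X Y.

Lemma transfer_sub a b X Y : b = a.+1 \/ a = b.+1 -> transfer a b X Y ->
  (X \subset ivl a) /\ (Y \subset ivl b).
Proof.
rewrite /transfer; case=> ->; rewrite ?ltnSn ?[(_.+1 < _)%N]ltnNge ?leqnSn /=.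
  by case/and3P.
by case/and3P.
Qed.

(** Counts paths from the empty configuration at an outer end of the region. The particles are the
    complement of the state in the upper part, and the state itself in the lower part read
    upwards. *)
Fixpoint fwd v k X : rat :=
  if k is k'.+1 then \sum_(X' | transfer (v k') (v k'.+1) X' X) fwd v k' X'
  else (X == set0)%:R.

(** Each up step adds a particle, so a jump meets as many particles as there were up steps before
    it; its powers of 2 add up to [du_pairs]. *)
Lemma fwd_closed v k X : nearby v 0 k -> (forall i, (i <= k)%N -> (v i <= N)%N) ->
  X \subset ivl (v k) ->
  fwd v k X = if #|X| == ups v 0 k then 2 ^+ du_pairs v 0 k * vdm X else 0.
Proof.
elim: k X => [|k IH] X nb vN Xv /=.
  rewrite /ups /du_pairs !big_geq // cards_eq0 expr0 mul1r.
  by case: eqP => // ->; rewrite /vdm cards0 /binom_det det_mx00.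
rewrite ups_recr // du_pairs_recr //.
have nb' : nearby v 0 k by move=> i ik; apply: nb; lia.
have vN' i : (i <= k)%N -> (v i <= N)%N by move=> ik; apply: vN; lia.
rewrite /transfer; case: (nb k); first by rewrite ltnSn.
  move=> e; rewrite e in Xv *; rewrite ltnSn ltnNge leqnSn /= addn0 addn1.
  have [X0|X0] := posnP #|X|.
    rewrite X0 /= big1 // => Y /(interlace_card (vN' k (leqnn k))); rewrite X0 //.
  rewrite (eq_bigr (fun Y => if #|X| == (ups v 0 k).+1 then 2 ^+ du_pairs v 0 k * vdm Y else 0)).
    case: eqP => _; last by rewrite big1.
    by rewrite -mulr_sumr interlace_V // vN'.
  move=> Y a; rewrite (interlace_card (vN' k (leqnn k)) a) eqSS IH //.
  by case/and3P: a.
move=> e; rewrite e ltnNge leqnSn ltnSn /= addn0.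
rewrite (eq_bigr (fun Y => if #|X| == ups v 0 k then 2 ^+ du_pairs v 0 k * vdm Y else 0)).
  case: eqP => [c|_]; last by rewrite big1.
  by rewrite -mulr_sumr jump_V ?vN // c exprD mulrA.
by move=> Y a; rewrite IH ?(jump_card a) // e; case/and3P: a.
Qed.

Fixpoint mid w len i t : st -> rat :=
  if len is len'.+1 then
    fun X => \sum_(Y | transfer (w i) (w i.+1) X Y) mid w len' i.+1 t Y
  else t.

(** Sorting the word: after the tail is sorted, a leading interlacing passes all its jumps by
    [opA_iterJ], at the price of one factor 2 per later down step. *)
Lemma mid_sorted w len i n t X : nearby w i (i + len) ->
  (forall k, (i <= k <= i + len)%N -> (w k <= N)%N) ->
  w i = (n + downs w i (i + len))%N ->
  mid w len i t X = 2 ^+ ud_pairs w i (i + len) *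
    iterJ (downs w i (i + len)) n (iterA (ups w i (i + len)) n t) X.
Proof.
elim: len i n X => [|len IH] i n X nb wN wi.
  by rewrite addn0 /ud_pairs /downs /ups !big_geq ?addn0 //= mul1r.
have ilt : (i < i + len.+1)%N by lia.
have nb' : nearby w i.+1 (i.+1 + len) by move=> k ki; apply: nb; lia.
have wN' k : (i.+1 <= k <= i.+1 + len)%N -> (w k <= N)%N by move=> ki; apply: wN; lia.
have e1 : (i + len.+1 = i.+1 + len)%N by rewrite addnS.
have eud : ud_pairs w i (i + len.+1) = if (w i < w i.+1)%N then
   (downs w i.+1 (i.+1 + len) + ud_pairs w i.+1 (i.+1 + len))%N else ud_pairs w i.+1 (i.+1 + len).
  by rewrite /ud_pairs big_ltn_cond // e1.
move: wi; rewrite eud ups_recl // downs_recl // e1 [mid _ _ _ _ _]/=.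
case: (nb i); first by lia.
  move=> e; rewrite /transfer e ltnSn ltnNge leqnSn !add0n !add1n /= => wi.
  rewrite wi -[LHS]/(opA _ _ _) (opA_ext (t' := fun Y => 2 ^+ ud_pairs w i.+1 (i.+1 + len) *
     iterJ (downs w i.+1 (i.+1 + len)) n.+1 (iterA (ups w i.+1 (i.+1 + len)) n.+1 t) Y)).
    rewrite opA_scale opA_iterJ; first by rewrite exprD mulrCA mulrA.
    by rewrite -wi; apply: wN; lia.
  by move=> Y _; apply: IH => //; rewrite e wi.
move=> e; rewrite /transfer e ltnSn ltnNge leqnSn !add1n !add0n /= => wi.
rewrite -[LHS]/(opJ _ _ _) (opJ_ext (t' := fun Y => 2 ^+ ud_pairs w i.+1 (i.+1 + len) *
     iterJ (downs w i.+1 (i.+1 + len)) n (iterA (ups w i.+1 (i.+1 + len)) n t) Y)).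
  by rewrite opJ_scale; have -> : w i.+1 = (n + downs w i.+1 (i.+1 + len))%N by lia.
by move=> Y _; apply: IH => //; lia.
Qed.

Lemma iterA_ext h n t t' B : (n + h <= N.+1)%N -> B \subset ivl n ->
  (forall Y, Y \subset ivl (n + h) -> #|Y| = (#|B| + h)%N -> t Y = t' Y) ->
  iterA h n t B = iterA h n t' B.
Proof.
elim: h n B => [|h IH] n B nN Bn e /=; first by apply: e; rewrite ?addn0.
apply: opA_ext => Y a; have nN' : (n <= N)%N by lia.
have [_ Yn _] := and3P a; apply: IH => //; first by rewrite addSnnS.
by move=> S Sn c; apply: e; rewrite -?addSnnS // c (interlace_card nN' a) addSnnS.
Qed.

Lemma iterA_scale h n c t B : iterA h n (fun Y => c * t Y) B = c * iterA h n t B.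
Proof.
elim: h n B => [|h IH] n B //=.
by rewrite -opA_scale; apply: opA_ext => Y _.
Qed.

Lemma count_formula w n1 n2 n3 n (f : nat -> st -> rat) :
  let i2 := (n1 + n2)%N in let L := (i2 + n3)%N in let v k := w (L - k)%N in
  nearby w 0 L -> (forall i, (i <= L)%N -> (w i <= N)%N) ->
  w n1 = (n + downs w n1 i2)%N -> (ups w 0 n1 <= w n1)%N ->
  (n + 2 * downs w n1 i2 <= N.+1)%N -> (n + 2 * ups w n1 i2 <= N.+1)%N ->
  (forall i X, (i < n1)%N -> X \subset ivl (w i) ->
     f i (ivl (w i) :\: X) =
     \sum_(Y | transfer (w i) (w i.+1) X Y) f i.+1 (ivl (w i.+1) :\: Y)) ->
  (forall i X, (n1 <= i < i2)%N -> X \subset ivl (w i) ->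
     f i X = \sum_(Y | transfer (w i) (w i.+1) X Y) f i.+1 Y) ->
  (forall i X, (i2 <= i < L)%N -> X \subset ivl (w i) ->
     f i X = \sum_(Y | transfer (w i.+1) (w i) Y X) f i.+1 Y) ->
  (forall X, X \subset ivl (w L) -> f L X = (X == set0)%:R) ->
  f 0%N (ivl (w 0%N)) =
  2 ^+ (du_pairs w 0 n1 + ud_pairs w n1 i2 + du_pairs v 0 n3) *
  \sum_(B : st | [&& B \subset ivl n, #|B| == (w n1 - ups w 0 n1)%N &
             (#|B| + ups w n1 i2 == ups v 0 n3)%N])
    frozen_vdm (downs w n1 i2) n B * frozen_vdm (ups w n1 i2) n (ivl n :\: B).
Proof.
move=> i2 L v nb wN wn h1w bJ bA f_up f_mid f_low f_end.
have nbk k : (k < L)%N -> w k.+1 = (w k).+1 \/ w k = (w k.+1).+1 by move=> kL; apply: nb.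
have low k X : (k <= n3)%N -> X \subset ivl (v k) -> f (L - k)%N X = fwd v k X.
  elim: k X => [|k IH] X kn Xv; first by rewrite subn0 f_end //; move: Xv; rewrite /v subn0.
  have kL : (k < L)%N by rewrite /L; lia.
  rewrite f_low //; last by rewrite /L; lia.
  rewrite /= /v -(subSn kL) subSS; apply: eq_bigr => Y s.
  apply: IH; first exact: ltnW.
  by case: (transfer_sub _ s) => //; rewrite -(subnSK kL); case: (nbk (L - k.+1)%N); [lia|right|left].
have midf j X : (j <= n2)%N -> X \subset ivl (w (i2 - j)%N) ->
    f (i2 - j)%N X = mid w j (i2 - j) (f i2) X.
  elim: j X => [|j IH] X jn Xv; first by rewrite subn0.
  have ji : (j < i2)%N by rewrite /i2; lia.
  rewrite f_mid //; last by rewrite /i2; lia.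
  rewrite /= (subnSK ji); apply: eq_bigr => Y s; apply: IH; first exact: ltnW.
  case: (transfer_sub _ s) => //; rewrite -(subnSK ji).
  by apply: nbk; rewrite /L; lia.
have upf k : (k <= n1)%N ->
    f 0%N (ivl (w 0%N)) = \sum_(X : st | X \subset ivl (w k)) fwd w k X * f k (ivl (w k) :\: X).
  elim: k => [|k IH] kn /=.
    rewrite (bigD1 set0) ?sub0set //= eqxx mul1r setD0 big1 ?addr0 // => X /andP[_ /negPf ->].
    by rewrite mul0r.
  rewrite IH; last exact: ltnW.
  under [RHS]eq_bigr do rewrite mulr_suml.
  have kL : (k < L)%N by rewrite /L /i2; lia.
  rewrite [RHS](exchange_big_dep (fun X : st => X \subset ivl (w k))) /=; last first.
    by move=> Y X _ /(transfer_sub (nbk k kL))[].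
  apply: eq_bigr => X Xw; rewrite f_up // mulr_sumr; apply: eq_bigl => Y.
  by case s: (transfer _ _ _ _); rewrite ?andbF // andbT; case: (transfer_sub (nbk k kL) s).
have e2 : (i2 - n2 = n1)%N by rewrite /i2 addnK.
have e3 : (L - n3 = i2)%N by rewrite /L addnK.
rewrite (upf n1) //.
have nb1 : nearby w 0 n1 by move=> k kn; apply: nbk; rewrite /L /i2; lia.
have wN1 i : (i <= n1)%N -> (w i <= N)%N by move=> h; apply: wN; rewrite /L /i2; lia.
have nb2 : nearby w n1 i2 by move=> k kn; apply: nbk; rewrite /L; lia.
have ww := width_ups (leq0n n1) nb1.
have ww2 := width_ups (leq_addr n2 n1) nb2.
have nb3 : nearby v 0 n3.
  move=> k kn; have kL : (k < L)%N by rewrite /L; lia.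
  rewrite /v -(subnSK kL); case: (nbk (L - k.+1)%N); [rewrite /L; lia|right|left] => //.
have vN i : (i <= n3)%N -> (v i <= N)%N by move=> h; apply: wN; rewrite leq_subr.
transitivity (\sum_(X : st | (X \subset ivl (w n1)) && (#|X| == ups w 0 n1))
   2 ^+ (du_pairs w 0 n1 + ud_pairs w n1 i2) *
    (vdm X * iterJ (downs w n1 i2) n (iterA (ups w n1 i2) n (f i2)) (ivl (w n1) :\: X))).
  rewrite (bigID (fun X : st => #|X| == ups w 0 n1)) /= [X in _ + X]big1 ?addr0; last first.
    by move=> X /andP[Xw /negPf Xu]; rewrite fwd_closed // Xu mul0r.
  apply: eq_bigr => X /andP[Xw Xu]; rewrite fwd_closed // Xu -!mulrA exprD -mulrA.
  congr (_ * _); rewrite mulrCA; congr (_ * _).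
  have := @midf n2 (ivl (w n1) :\: X) (leqnn _); rewrite e2 => -> //; last by rewrite subsetDl.
  by apply: mid_sorted => // k kn; apply: wN; rewrite /L; lia.
(* Pass from the complement [X] used in the upper part to the state [S] on l; [vdm X] is then
   [frozen_vdm 0] of [S]. *)
transitivity (2 ^+ (du_pairs w 0 n1 + ud_pairs w n1 i2) *
  \sum_(S : st | (S \subset ivl (n + downs w n1 i2)) && (#|S| == (w n1 - ups w 0 n1)%N))
     frozen_vdm 0 (n + downs w n1 i2) S *
     iterJ (downs w n1 i2) n (iterA (ups w n1 i2) n (f i2)) S).
  rewrite mulr_sumr -wn.
  rewrite (reindex_onto (fun S => ivl (w n1) :\: S) (fun S => ivl (w n1) :\: S)); last first.
    by move=> S /andP[Sw _]; apply: complK.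
  apply: eq_big => [S|S /andP[/andP[_ _] /eqP e]]; last by rewrite E0 e.
  apply/idP/idP => [/andP[/andP[_ c] /eqP e]|/andP[Sw c]].
    have Sw : S \subset ivl (w n1) by rewrite -e subsetDl.
    rewrite Sw /=.
    by have := card_compl (leqW (wN1 n1 (leqnn _))) Sw; move/eqP: c => c <-; rewrite -c addKn.
  rewrite subsetDl complK // eqxx andbT /=.
  have := card_compl (leqW (wN1 n1 (leqnn _))) Sw; move/eqP: c => c.
  by rewrite c => c'; rewrite -(eqn_add2r (w n1 - ups w 0 n1)) c' subnKC.
rewrite sum_E_iterJ ?addn0; last by lia.
rewrite [in RHS]exprD -[RHS]mulrA; congr (_ * _); rewrite mulr_sumr.
rewrite big_mkcondr.
rewrite [RHS](eq_bigl (fun B : st => ((B \subset ivl n) && (#|B| == (w n1 - ups w 0 n1)%N))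
   && (#|B| + ups w n1 i2 == ups v 0 n3)%N)); last by move=> B; rewrite -andbA.
rewrite -big_mkcondr [RHS]big_mkcondr; apply: eq_bigr => B /andP[Bn Bc].
have low2 Y : Y \subset ivl (w i2) -> f i2 Y =
    if #|Y| == ups v 0 n3 then 2 ^+ du_pairs v 0 n3 * frozen_vdm 0 (w i2) (ivl (w i2) :\: Y) else 0.
  move=> Yw; have := @low n3 Y (leqnn _); rewrite e3 /v e3 -/v => -> //.
  by rewrite fwd_closed // ?/v ?e3 // E0 complK.
have e4 : w i2 = (n + ups w n1 i2)%N.
  by apply: (@addIn (downs w n1 i2)); rewrite {1 2}/i2 ww2 -/i2 wn addnAC.
pose c : rat := if (#|B| + ups w n1 i2 == ups v 0 n3)%N then 2 ^+ du_pairs v 0 n3 else 0.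
rewrite (@iterA_ext _ _ _ (fun Y => c * frozen_vdm 0 (n + ups w n1 i2) (ivl (n + ups w n1 i2) :\: Y))) //.
- rewrite iterA_scale iterA_E ?addn0 // /c.
  by case: eqP => _; rewrite ?mul0r ?mulr0 // mulrCA.
- by rewrite -e4; apply/leqW/wN; rewrite leq_addr.
by move=> Y Yn Yc; rewrite -e4 low2 /c -?Yc ?e4 //; case: eqP; rewrite ?mul0r.
Qed.
End Chains.

(** * Evaluation of the layered graph *)

Section ModelCount.
Variables (N : nat) (w : nat -> nat) (d white : pred nat) (n1 n2 n3 : nat).
Local Notation st := {set 'I_N.+1}.
Local Notation ivl := (@ivl N).
Let i2 := (n1 + n2)%N.
Let L := (i2 + n3)%N.
Implicit Types (S X Y : st) (i : nat).

Hypothesis L0 : (0 < L)%N.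
Hypothesis dL : d L.
Hypothesis wN : forall i, (i <= L)%N -> (w i <= N)%N.
Hypothesis nb : nearby w 0 L.
Hypothesis white0 : white 0%N.
Hypothesis whiteS :
  forall i, (i.+1 < L)%N -> white i.+1 = if d i.+1 then white i else ~~ white i.
Hypothesis white_end : forall i, i.+1 = L -> ~~ white i.
Hypothesis white_up : forall i, (i < n1)%N -> white i = (w i < w i.+1)%N.
Hypothesis white_mid : forall i, (n1 <= i < i2)%N -> white i = ~~ (w i < w i.+1)%N.
Hypothesis white_low : forall i, (i2 <= i < L)%N -> white i = (w i < w i.+1)%N.

Let f i S : rat := (chain L w d white i S)%:R.

(** Here white rows are those followed by a wider row, which makes the complement [X] interlace when
    the width grows and jump when it shrinks. In the middle part the colours are opposite and the
    state itself behaves so. *)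
Lemma chain_up i X : (i < n1)%N -> X \subset ivl (w i) ->
  f i (ivl (w i) :\: X) =
  \sum_(Y | transfer (w i) (w i.+1) X Y) f i.+1 (ivl (w i.+1) :\: Y).
Proof.
move=> iN Xw; have iL : (i < L)%N by rewrite /L /i2; lia.
rewrite /f (@chain_step N L w d dL nb white whiteS white_end) ?subsetDl // natr_sum.
have nbi : w i.+1 = (w i).+1 \/ w i = (w i.+1).+1 by apply: nb.
rewrite (reindex_onto (fun Y : st => ivl (w i.+1) :\: Y) (fun Y : st => ivl (w i.+1) :\: Y)) /=; last first.
  by move=> S /andP[Sw _]; apply: complK.
apply: eq_bigl => Y; rewrite subsetDl complK // white_up // /link /transfer /=.
case: nbi => e.
  rewrite e ltnSn; case Yw : (Y \subset ivl (w i).+1).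
    by rewrite complK // eqxx andbT jump_compl.
  have -> : interlace (w i) X Y = false by apply/negP => /and3P[_ h _]; rewrite h in Yw.
  by apply/negP => /andP[_ /eqP h]; rewrite -h subsetDl in Yw.
rewrite e ltnNge leqnSn /=; case Yw : (Y \subset ivl (w i.+1)).
  by rewrite complK // eqxx andbT.
have -> : jump (w i.+1) X Y = false by apply/negP => /and3P[_ h _]; rewrite h in Yw.
by apply/negP => /andP[_ /eqP h]; rewrite -h subsetDl in Yw.
Qed.

Lemma chain_mid i X : (n1 <= i < i2)%N -> X \subset ivl (w i) ->
  f i X = \sum_(Y | transfer (w i) (w i.+1) X Y) f i.+1 Y.
Proof.
move=> iN Xw; have iL : (i < L)%N by rewrite /L; lia.
rewrite /f (@chain_step N L w d dL nb white whiteS white_end) // natr_sum.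
have nbi : w i.+1 = (w i).+1 \/ w i = (w i.+1).+1 by apply: nb.
apply: eq_bigl => Y; rewrite white_mid // /link /transfer; case: nbi => e.
  rewrite e ltnSn /=; case Yw : (Y \subset _) => /=; first by rewrite jump_compl.
  by apply/esym/negP => /and3P[_ h _]; rewrite h in Yw.
rewrite e ltnNge leqnSn /=; case Yw : (Y \subset _) => //=.
by apply/esym/negP => /and3P[_ h _]; rewrite h in Yw.
Qed.

(** The colours are as in the upper part, but reading upwards exchanges widening and narrowing, so
    the transferred particles are those of the state. *)
Lemma chain_low i X : (i2 <= i < L)%N -> X \subset ivl (w i) ->
  f i X = \sum_(Y | transfer (w i.+1) (w i) Y X) f i.+1 Y.
Proof.
move=> iN Xw; have iL : (i < L)%N by case/andP: iN.
rewrite /f (@chain_step N L w d dL nb white whiteS white_end) // natr_sum.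
have nbi : w i.+1 = (w i).+1 \/ w i = (w i.+1).+1 by apply: nb.
apply: eq_bigl => Y; rewrite white_low // /link /transfer; case: nbi => e.
  rewrite e ltnSn ltnNge leqnSn /=; case Yw : (Y \subset _) => //=.
  by apply/esym/negP => /and3P[h _ _]; rewrite h in Yw.
rewrite e ltnSn ltnNge leqnSn /=; case Yw : (Y \subset _) => /=.
  by rewrite jump_compl // -e.
by apply/esym/negP => /and3P[h _ _]; rewrite h in Yw.
Qed.

Lemma model_formula n : let v k := w (L - k)%N in
  w n1 = (n + downs w n1 i2)%N -> (ups w 0 n1 <= w n1)%N ->
  (n + 2 * downs w n1 i2 <= N.+1)%N -> (n + 2 * ups w n1 i2 <= N.+1)%N ->
  (#|matchings (@madj N L w d) (mvalid N L w d)|)%:R =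
  2 ^+ (du_pairs w 0 n1 + ud_pairs w n1 i2 + du_pairs v 0 n3) *
  \sum_(B : st | [&& B \subset ivl n, #|B| == (w n1 - ups w 0 n1)%N &
             (#|B| + ups w n1 i2 == ups v 0 n3)%N])
    frozen_vdm (downs w n1 i2) n B * frozen_vdm (ups w n1 i2) n (ivl n :\: B).
Proof.
move=> v wn h1w bJ bA; rewrite -(@count_formula N w n1 n2 n3 n f) //; first last.
- by move=> X _; rewrite /f /chain eqxx.
- exact: chain_low.
- exact: chain_mid.
- exact: chain_up.
(* No cell lies above the top diagonal, so all its white triangles are matched downwards: the
   initial state is the full row. *)
rewrite /f /chain ltn_eqF // /ways /state white0; congr (#|pred_of_set (matchings _ _)|)%:R.
apply/setP => -[[j b] m]; rewrite !inE /=.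
case: (posnP j) => [j0|j0]; last by rewrite andbT.
rewrite j0 andbF orbF ltn_eqF //= andbT negbK.
by case: (b); rewrite ?andbF ?andbT ?orbT /= ?andbT ?andbF.
Qed.
End ModelCount.

(** * Geometry of the quasi-octagon *)

Lemma nth_path (T : eqType) (e : rel T) x0 x (s : seq T) i :
  path e x s -> (i < size s)%N -> e (nth x0 (x :: s) i) (nth x0 s i).
Proof. by move=> /(pathP x0); apply. Qed.

Lemma nth_cat_last (T : Type) x0 x (s1 s2 : seq T) j : (j <= size s2)%N ->
  nth x0 (x :: s1 ++ s2) (size s1 + j) = nth x0 (last x s1 :: s2) j.
Proof. by elim: s1 x => [|y s1 IH] x js //=; rewrite -IH. Qed.

Lemma int_const (T : Type) (g : int -> T) : (forall x, g (x + 1) = g x) ->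
  forall x y, g x = g y.
Proof.
move=> gS; have g0 (n : nat) z : g (z + n%:Z) = g z.
  by elim: n => [|n IH]; rewrite ?addr0 // -addn1 PoszD addrA gS IH.
move=> x y; have [h|h] := leP x y.
  by have := g0 `|y - x|%N x; have -> : x + `|y - x|%N%:Z = y by lia.
by have := g0 `|x - y|%N y; have -> : y + `|x - y|%N%:Z = x by lia.
Qed.

Lemma last_scanl (T S : Type) (g : T -> S -> T) x s :
  last x (scanl g x s) = foldl g x s.
Proof. by elim: s x => //= a s IH x; rewrite IH. Qed.

Lemma foldl_sub (x : int) (s : seq nat) :
  foldl (fun c (d : nat) => c - d%:Z) x s = x - (sumn s)%:Z.
Proof. by elim: s x => [|a s IH] x /=; rewrite ?subr0 // IH PoszD opprD addrA. Qed.

Section Geometry.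
Variables (o : octagon) (black : pred cell) (s : boundary).
Hypothesis qo : quasi_octagon o black s.

Let n1 := sumn (upper_dist o).
Let n2 := sumn (middle_dist o).
Let n3 := sumn (lower_dist o).
Let L := (n1 + n2 + n3)%N.
Let top := top_diag o.

Definition ne_pt (i : nat) : point := nth (ptA o) (ne_points o s) i.
Definition wid (i : nat) : nat := width_at o (ne_pt i).
Definition qx (i : nat) : int := (mirror o (ne_pt i)).1.
Definition drawn_at (i : nat) : bool := top - i%:Z \in drawn o.

Lemma step_diag r x y : step o black r x y -> diag y = diag x - 1.
Proof.
case: x y => [x1 x2] [y1 y2]; rewrite /step /diag /=.
by case/orP => /andP[/eqP[-> ->] _]; lia.
Qed.

Lemma path_diag r x l : path (step o black r) x l ->
  diag (last x l) = diag x - (size l)%:Z.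
Proof.
elim: l x => [|y l IH] x /=; first by rewrite subr0.
by move=> /andP[/step_diag e /IH ->]; rewrite e; lia.
Qed.

Lemma size_AB : size (path_AB s) = n1.
Proof.
have [[/path_diag + e] _ _] := ne_boundary qo.
by rewrite -/(ptB o s) e /ell /top_diag -/n1; lia.
Qed.

Lemma size_BC : size (path_BC s) = n2.
Proof.
have [[_ e] [/path_diag + e'] _] := ne_boundary qo.
by rewrite -/(ptC o s) e e' /ell' -/n2; lia.
Qed.

Lemma size_CD : size (path_CD s) = n3.
Proof.
have [_ [_ e] [/path_diag + e']] := ne_boundary qo.
by rewrite -/(ptD o s) e e' /bottom_diag -/n3; lia.
Qed.

Lemma size_ne : size (ne_points o s) = L.+1.
Proof. by rewrite /= !size_cat size_AB size_BC size_CD addnA. Qed.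

Lemma ne_pt0 : ne_pt 0 = ptA o. Proof. by []. Qed.

Lemma ne_step i : (i < L)%N ->
  step o black ((i < n1) || (n1 + n2 <= i))%N (ne_pt i) (ne_pt i.+1).
Proof.
have [[pAB _] [pBC _] [pCD _]] := ne_boundary qo.
move=> iL; rewrite /ne_pt /ne_points.
case: (ltnP i n1) => i1 /=.
  have -> : nth (ptA o) (ptA o :: path_AB s ++ path_BC s ++ path_CD s) i
      = nth (ptA o) (ptA o :: path_AB s) i.
    by rewrite -cat_cons nth_cat /= size_AB ltnS ltnW.
  by rewrite nth_cat size_AB i1; apply: nth_path; rewrite ?size_AB.
have -> : i = (size (path_AB s) + (i - n1))%N by rewrite size_AB subnKC.
rewrite nth_cat_last; last by rewrite size_cat size_BC size_CD; move: iL; rewrite /L; lia.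
rewrite nth_cat ltnNge leq_addr /= addKn size_AB -/(ptB o s).
case: (ltnP (n1 + (i - n1)) (n1 + n2)) => i2 /=.
  have -> : nth (ptA o) (ptB o s :: path_BC s ++ path_CD s) (i - n1)
      = nth (ptA o) (ptB o s :: path_BC s) (i - n1).
    by rewrite -cat_cons nth_cat /= size_BC; have -> : (i - n1 < n2.+1)%N by lia.
  by rewrite nth_cat size_BC (_ : (i - n1 < n2)%N) ?nth_path ?size_BC //; lia.
have -> : (i - n1 = size (path_BC s) + (i - n1 - n2))%N by rewrite size_BC; lia.
rewrite nth_cat_last; last by rewrite size_CD; move: iL; rewrite /L; lia.
rewrite nth_cat ltnNge leq_addr /= addKn -/(ptC o s).
by apply: nth_path; rewrite // size_CD; move: iL; rewrite /L; lia.
Qed.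

Lemma ne_pt_B : ne_pt n1 = ptB o s.
Proof.
have := nth_cat_last (ptA o) (ptA o) (path_AB s) (leq0n (size (path_BC s ++ path_CD s))).
by rewrite addn0 size_AB.
Qed.

Lemma ne_pt_C : ne_pt (n1 + n2) = ptC o s.
Proof.
have := @nth_cat_last _ (ptA o) (ptA o) (path_AB s) (path_BC s ++ path_CD s) n2.
rewrite size_AB size_cat size_BC leq_addr => /(_ isT) e.
rewrite /ne_pt /ne_points e -/(ptB o s).
have := @nth_cat_last _ (ptA o) (ptB o s) (path_BC s) (path_CD s) 0.
by rewrite size_BC addn0 => ->.
Qed.

Lemma diag_ne i : (i <= L)%N -> diag (ne_pt i) = top - i%:Z.
Proof.
elim: i => [|i IH] iL; first by rewrite ne_pt0 subr0.
by rewrite (step_diag (ne_step iL)) (IH (ltnW iL)) -addn1 PoszD opprD addrA.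
Qed.

(** The signed width: [wid] is an absolute value and would not notice that the two boundary paths
    have crossed. *)
Let W i : int := (ne_pt i).1 - qx i.

Lemma W_neq0 i : (i <= L)%N -> W i != 0.
Proof.
move=> iL; apply/eqP => W0; move: (ne_sw_apart qo) => /hasPn /(_ (ne_pt i)).
have pin : ne_pt i \in ne_points o s by rewrite mem_nth // size_ne.
move=> /(_ pin); apply/negP; rewrite negbK.
apply/mapP; exists (ne_pt i) => //; move: W0; rewrite /W /qx /mirror /=.
by case: (ne_pt i) => x y /= h; congr (_, _); lia.
Qed.

Lemma W_step i : (i < L)%N ->
  (W i.+1 = W i + 1 /\ qx i.+1 = qx i) \/ (W i = W i.+1 + 1 /\ qx i.+1 = qx i + 1).
Proof.
move=> /ne_step; rewrite /W /qx /mirror.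
case: (ne_pt i) => x y; case: (ne_pt i.+1) => x' y' /=.
by case/orP => /andP[/eqP[-> ->] _]; [left | right]; lia.
Qed.

(** [W] starts at the positive side length, changes by one at each step and never vanishes, since
    the paths do not meet. *)
Lemma W_gt0 i : (i <= L)%N -> 0 < W i.
Proof.
elim: i => [|i IH] iL.
  rewrite /W /qx /mirror ne_pt0 /=; have := side_gt0 qo; lia.
by have := IH (ltnW iL); have := W_neq0 iL; case: (W_step iL); lia.
Qed.

Lemma widE i : (i <= L)%N -> (wid i)%:Z = W i.
Proof. by move=> /W_gt0; rewrite /wid /width_at -/(qx i) -/(W i); lia. Qed.

Lemma wid_gt0 i : (i <= L)%N -> (0 < wid i)%N.
Proof. by move=> iL; have := W_gt0 iL; rewrite -widE. Qed.

Lemma wid_step i : (i < L)%N ->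
  (wid i.+1 = (wid i).+1 /\ qx i.+1 = qx i) \/
  (wid i = (wid i.+1).+1 /\ qx i.+1 = qx i + 1).
Proof.
by move=> iL; have := W_step iL; rewrite -!widE ?(ltnW iL) //; case=> -[e e']; [left|right]; lia.
Qed.

Lemma wid_nearby : nearby wid 0 L.
Proof. by move=> i /wid_step[[]|[]]; [left|right]. Qed.

Definition pt_at (i : nat) (m : int) : point := (qx i + m, qx i + m + (top - i%:Z)).

Lemma region_pointsP v : reflect
  (exists i, [/\ (i <= L)%N, diag v = top - i%:Z, qx i <= v.1 & v.1 <= qx i + (wid i)%:Z])
  (v \in region_points o s).
Proof.
apply: (iffP flattenP) => [[l /mapP[p pin ->]] /mapP[m]|[i [iL dv v1 v2]]].
  rewrite mem_iota add0n ltnS /= => mw ->.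
  have [i iL Ep] : exists2 i, (i <= L)%N & p = ne_pt i.
    exists (index p (ne_points o s)); last by rewrite /ne_pt nth_index.
    by rewrite -ltnS -size_ne index_mem.
  exists i; move: (diag_ne iL) mw; rewrite /wid -Ep /qx -Ep /diag /mirror /=; split=> //; lia.
exists [seq ((mirror o (ne_pt i)).1 + m%:Z, (mirror o (ne_pt i)).2 + m%:Z)
                 | m <- iota 0 (width_at o (ne_pt i)).+1].
  by apply/mapP; exists (ne_pt i) => //; rewrite mem_nth // size_ne.
apply/mapP; exists `|v.1 - qx i|%N.
  by rewrite mem_iota -/(wid i); lia.
have := diag_ne iL; move: dv v1 v2; rewrite /diag /qx /mirror /=.
by case: v => x y /= dv v1 v2 e; congr (_, _); lia.
Qed.

Definition shape_ok (i : nat) (sh : Defs.shape) : bool :=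
  match sh with
  | Square => ~~ drawn_at i
  | Upper => drawn_at i && (0 < i)%N
  | Lower => drawn_at i && (i < L)%N
  end.

Lemma drawn_top : drawn_at 0.
Proof. by rewrite /drawn_at subr0 /drawn mem_head. Qed.

Lemma ell_top : ell o = top - n1%:Z.
Proof. by []. Qed.

Lemma ell'_top : ell' o = top - (n1 + n2)%N%:Z.
Proof. by rewrite /ell' ell_top -/n2; lia. Qed.

Lemma bottom_top : bottom_diag o = top - L%:Z.
Proof. by rewrite /bottom_diag ell'_top -/n3 /L; lia. Qed.

Lemma drawn_ell : drawn_at n1.
Proof.
rewrite /drawn_at -ell_top /drawn mem_cat.
have -> : ell o = last top (scanl (fun c (d : nat) => c - d%:Z) top (upper_dist o)).
  by rewrite last_scanl foldl_sub.
by rewrite mem_last.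
Qed.

Lemma drawn_ell' : drawn_at (n1 + n2).
Proof.
rewrite /drawn_at -ell'_top /drawn !mem_cat.
have : ell' o \in ell o :: scanl (fun c (d : nat) => c - d%:Z) (ell o) (middle_dist o).
  have -> : ell' o = last (ell o) (scanl (fun c (d : nat) => c - d%:Z) (ell o) (middle_dist o)).
    by rewrite last_scanl foldl_sub.
  exact: mem_last.
rewrite inE => /predU1P[->|->]; last by rewrite orbT.
by have := drawn_ell; rewrite /drawn_at -ell_top /drawn !mem_cat.
Qed.

Lemma drawn_bottom : drawn_at L.
Proof. by rewrite /drawn_at -bottom_top /drawn !mem_cat mem_head !orbT. Qed.

Lemma fundamentalE x i : diag x.1 = top - i%:Z ->
  fundamental o x = if x.2 == Square then ~~ drawn_at i else drawn_at i.
Proof. by rewrite /fundamental /drawn_at => ->. Qed.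

Lemma cellsP x : reflect
  (exists i, [/\ (i <= L)%N, diag x.1 = top - i%:Z,
     qx i <= x.1.1 < qx i + (wid i)%:Z & shape_ok i x.2])
  (x \in cells o s).
Proof.
have inj (i j : nat) : top - i%:Z = top - j%:Z -> i = j by lia.
have -> : (x \in cells o s) =
    [&& x \in [seq (p, t) | p <- region_points o s, t <- [:: Square; Upper; Lower]],
        fundamental o x & all (mem (region_points o s)) (vertices x)].
  by rewrite in_fset inE.
apply: (iffP idP) => [/and3P[_ fx /allP vx]|[i [iL dx qx1 shx]]].
  have R v : v \in vertices x ->
      exists i, [/\ (i <= L)%N, diag v = top - i%:Z, qx i <= v.1 & v.1 <= qx i + (wid i)%:Z].
    by move=> /vx /region_pointsP.
  case: x fx {vx} R => -[a b] sh fx R.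
  have [i [iL di q1 q2]] :
      exists i, [/\ (i <= L)%N, diag (a, b) = top - i%:Z, qx i <= a & a <= qx i + (wid i)%:Z].
    by apply: (R (a, b)); case: sh {fx R}; rewrite !inE eqxx ?orbT.
  have [j [jL dj q3 q4]] :
      exists i, [/\ (i <= L)%N, diag (a + 1, b + 1) = top - i%:Z, qx i <= a + 1 & a + 1 <= qx i + (wid i)%:Z].
    by apply: (R (a + 1, b + 1)); case: sh {fx R}; rewrite !inE eqxx ?orbT.
  have ij : i = j by apply: inj; rewrite -di -dj /diag /=; lia.
  exists i; split=> //; first by rewrite q1 /= ij; lia.
  move: fx; rewrite (fundamentalE (i := i)) //=; case: sh R => //= R ->.
    (* The apex of an [Upper] triangle lies on the preceding diagonal, which must belong to the
       region, so [i] is positive; the apex of a [Lower] one gives [i < L]. *)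
    have [k [_ dk _ _]] := R (a, b + 1) ltac:(by rewrite !inE eqxx ?orbT).
    by move: dk di; rewrite /diag /=; lia.
  have [k [kL dk _ _]] := R (a + 1, b) ltac:(by rewrite !inE eqxx ?orbT).
  by move: dk di; rewrite /diag /=; lia.
case: x dx qx1 shx => -[a b] sh dx qx1 shx; simpl in dx, qx1, shx.
have r0 : (a, b) \in region_points o s.
  by apply/region_pointsP; exists i; split=> //=; lia.
have r1 : (a + 1, b + 1) \in region_points o s.
  apply/region_pointsP; exists i; split=> //=; last 1 first.
  - lia.
  - by rewrite -dx /diag /=; lia.
  - lia.
have ru : (0 < i)%N -> (a, b + 1) \in region_points o s.
  move=> i0; have iL' : (i.-1 < L)%N by lia.
  have := wid_step iL'; rewrite prednK // => ws.
  apply/region_pointsP; exists i.-1; split=> //=; first by lia.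
  - by move: dx; rewrite /diag /=; lia.
  - by case: ws => -[]; lia.
  - by case: ws => -[]; lia.
have rl : (i < L)%N -> (a + 1, b) \in region_points o s.
  move=> iL'; have ws := wid_step iL'.
  apply/region_pointsP; exists i.+1; split=> //=.
  - by move: dx; rewrite /diag /=; lia.
  - by case: ws => -[]; lia.
  - by case: ws => -[]; lia.
rewrite (fundamentalE (i := i)) //.
apply/and3P; split.
- by apply/allpairsP; exists ((a, b), sh); split=> //; case: sh {shx}.
- by case: sh shx => //= /andP[].
have i0 : ~~ drawn_at i -> (0 < i < L)%N.
  move=> di; rewrite lt0n ltn_neqAle iL andbT; apply/andP; split.
    by apply/eqP => e; rewrite e drawn_top in di.
  by apply/eqP => e; rewrite e drawn_bottom in di.
case: sh shx => /=.
- by move=> /i0/andP[i1 i2]; rewrite r0 r1 ru ?rl.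
- by move=> /andP[_ i1]; rewrite r0 r1 ru.
by move=> /andP[_ i1]; rewrite r0 r1 rl.
Qed.

Definition low (i : nat) : Defs.shape := if drawn_at i then Lower else Square.
Definition high (i : nat) : Defs.shape := if drawn_at i then Upper else Square.

Lemma fundamental_low i p : diag p = top - i%:Z -> fundamental o (p, low i).
Proof. by move=> dp; rewrite (fundamentalE (i := i)) //= /low; case: (drawn_at i). Qed.

Lemma fundamental_high i p : diag p = top - i%:Z -> fundamental o (p, high i).
Proof. by move=> dp; rewrite (fundamentalE (i := i)) //= /high; case: (drawn_at i). Qed.

Definition white (i : nat) : bool := ~~ black (pt_at i 0, low i).

(** One cell of diagonal [i.+1] touches two consecutive cells of diagonal [i], which forces a
    constant colour along each row, inside and outside the region. *)
Lemma black_link i a b : b - a = top - i%:Z ->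
  black ((a, b), low i) = ~~ black ((a + 1, b), high i.+1) /\
  black ((a + 1, b + 1), low i) = ~~ black ((a + 1, b), high i.+1).
Proof.
move=> ab; have [cb _] := black_coloring qo.
have f1 : fundamental o ((a, b), low i) by apply: fundamental_low.
have f2 : fundamental o ((a + 1, b + 1), low i).
  by apply: fundamental_low; rewrite /diag /=; lia.
have f3 : fundamental o ((a + 1, b), high i.+1).
  by apply: fundamental_high; rewrite /diag /=; lia.
split; apply: cb => //; rewrite /share_edge.
  apply/andP; split; first by apply/eqP => -[]; lia.
  apply/hasP; exists ((a + 1, b), (a + 1, b + 1)).
    by rewrite /low; case: ifP; rewrite !inE eqxx ?orbT.
  by rewrite /high inE; case: ifP; rewrite !inE eqxx ?orbT.
apply/andP; split; first by apply/eqP => -[]; lia.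
apply/hasP; exists ((a + 1, b + 1), (a + 1 + 1, b + 1)).
  by rewrite /low; case: ifP; rewrite !inE eqxx ?orbT.
by rewrite /high inE; case: ifP; rewrite !inE eqxx ?orbT.
Qed.

Lemma black_low i p : diag p = top - i%:Z -> black (p, low i) = ~~ white i.
Proof.
case: p => a b dp; rewrite /white negbK.
have gS x : black ((x + 1, x + 1 + (top - i%:Z)), low i) = black ((x, x + (top - i%:Z)), low i).
  have [e1 e2] := @black_link i x (x + (top - i%:Z)) ltac:(lia).
  by rewrite e1 -e2; congr (black (_, _, _)); lia.
have := int_const gS a (qx i + 0); rewrite /pt_at.
by have -> : a + (top - i%:Z) = b by move: dp; rewrite /diag /=; lia.
Qed.

Lemma black_high i p : diag p = top - i.+1%:Z -> black (p, high i.+1) = white i.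
Proof.
case: p => a b dp; rewrite /diag /= in dp.
have [e _] := @black_link i (a - 1) b ltac:(lia).
have := @black_low i (a - 1, b); rewrite e /diag /= => /(_ ltac:(lia)) /(congr1 negb).
by rewrite !negbK => <-; congr (black (_, _, _)); lia.
Qed.

Lemma black_drawn i p : diag p = top - i%:Z -> drawn_at i ->
  black (p, Upper) = ~~ black (p, Lower).
Proof.
move=> dp di; have [cb _] := black_coloring qo.
have f1 := fundamental_low dp; have f2 := fundamental_high dp.
rewrite /low /high di in f1 f2; apply: cb => //.
case: p {dp f1 f2} => a b; rewrite /share_edge; apply/andP; split; first by apply/eqP.
by apply/hasP; exists ((a, b), (a + 1, b + 1)); rewrite !inE eqxx ?orbT.
Qed.

Lemma white_top : white 0.
Proof.
have [_ cw] := black_coloring qo; rewrite /white /low drawn_top.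
by apply: cw; rewrite /pt_at /diag /= -/top; lia.
Qed.

Lemma diag_pt_at i m : diag (pt_at i m) = top - i%:Z.
Proof. by rewrite /diag /pt_at /=; lia. Qed.

Lemma white_next i : white i.+1 = if drawn_at i.+1 then white i else ~~ white i.
Proof.
have d0 := diag_pt_at i.+1 0; have h := black_high d0; have l := black_low d0.
case di : (drawn_at i.+1).
  have := black_drawn d0 di; rewrite /high di in h; rewrite /low di in l.
  by rewrite h l negbK.
by move: l h; rewrite /low /high di => -> <-; rewrite negbK.
Qed.

Lemma white_bottom i : i.+1 = L -> ~~ white i.
Proof.
move=> iL; have d0 := diag_pt_at i.+1 0; rewrite -(black_high d0).
have dL := drawn_bottom; rewrite /high iL dL; apply: (bottom_white qo) => //.
  apply/cellsP; exists L; split=> //=.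
  - by rewrite -iL diag_pt_at.
  - by have := wid_gt0 (leqnn L); rewrite -iL addr0 lexx /=; lia.
  by rewrite dL -iL.
by rewrite bottom_top -iL diag_pt_at.
Qed.

(** An east step widens the next row, a south step narrows it. The cell right of an east step
    belongs to the upper row of diagonal [i.+1], the cell right of a south step to the lower row of
    diagonal [i]. These rows have opposite colours, so black on the right ties the direction to
    [white i], and black on the left to its negation. *)
Lemma wid_color i : (i < L)%N ->
  (wid i < wid i.+1)%N = (if ((i < n1) || (n1 + n2 <= i))%N then white i else ~~ white i).
Proof.
move=> iL; have := wid_step iL.
have := ne_step iL; have := diag_ne (ltnW iL); have := diag_ne iL.
set r := (_ || _); rewrite /qx /mirror.
case: (ne_pt i) => x y; case: (ne_pt i.+1) => x' y' /=; rewrite /diag /= => d' d.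
have up p e : diag p = top - i.+1%:Z -> (~~ drawn_at i.+1 \/ e \in edges (p, Upper)) ->
    region_at o p e = (p, high i.+1).
  rewrite /region_at /high => ->; rewrite -/(drawn_at i.+1).
  by case: (drawn_at i.+1) => //= -[] // ->.
have lw p e : diag p = top - i%:Z -> (~~ drawn_at i \/ e \notin edges (p, Upper)) ->
    region_at o p e = (p, low i).
  rewrite /region_at /low => ->; rewrite -/(drawn_at i).
  by case: (drawn_at i) => //= -[] // /negPf ->.
case/orP => /andP[/eqP[ex ey] bl] ws.
  have -> : (wid i < wid i.+1)%N by case: ws => -[]; lia.
  move: bl; case: r.
    rewrite up; first by rewrite black_high // /diag /=; lia.
      by rewrite /diag /=; lia.
    right; rewrite !inE; apply/orP; right; apply/orP; left.
    by rewrite ex ey subrK.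
  rewrite lw; first by rewrite black_low // /diag /=; lia.
    by rewrite /diag /=; lia.
  right; rewrite !inE ex ey !negb_or; apply/and3P; split; apply/eqP => -[]; lia.
have -> : (wid i < wid i.+1)%N = false by case: ws => -[]; lia.
move: bl; case: r.
  rewrite lw; first by rewrite black_low // /diag /= => [/negPf ->//|]; lia.
    by rewrite /diag /=; lia.
  right; rewrite !inE ex ey !negb_or; apply/and3P; split; apply/eqP => -[]; lia.
rewrite up; first by rewrite black_high // /diag /= => [->//|]; lia.
  by rewrite /diag /=; lia.
right; rewrite !inE; apply/orP; left.
by rewrite ex ey subrK.
Qed.

End Geometry.

Lemma share_edge_sym : symmetric share_edge.
Proof.
move=> x y; rewrite /share_edge eq_sym; congr (_ && _).
by apply/hasP/hasP => -[e e1 e2]; exists e.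
Qed.

Lemma share_edge_irr : irreflexive share_edge.
Proof. by move=> x; rewrite /share_edge eqxx. Qed.

(** The directed form of [share_edge], matching [below]: [x] is on the upper-left side of the common
    edge. *)
Definition on_top (x y : cell) : bool :=
  let: ((a, b), sh) := x in let: ((a', b'), sh') := y in
  [&& sh == Upper, sh' == Lower, a' == a & b' == b] ||
  [&& sh != Upper, sh' != Lower & (a' == a + 1) && (b' == b) || (a' == a) && (b' + 1 == b)].

Lemma on_top_share (x y : cell) : on_top x y -> share_edge x y.
Proof.
case: x => -[a b] sh; case: y => -[a' b'] sh' /orP[/and4P[/eqP -> /eqP -> /eqP -> /eqP ->]|].
  apply/andP; split; first by apply/eqP.
  by apply/hasP; exists ((a, b), (a + 1, b + 1)); rewrite !inE eqxx ?orbT.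
case/and3P=> nsh nsh' /orP[/andP[/eqP ea /eqP eb]|/andP[/eqP ea /eqP eb]].
  apply/andP; split; first by apply/eqP => -[]; lia.
  apply/hasP; exists ((a + 1, b), (a + 1, b + 1)).
    by case: sh nsh => //= _; rewrite !inE eqxx ?orbT.
  by rewrite ea eb /=; case: sh' nsh' => //= _; rewrite !inE eqxx ?orbT.
apply/andP; split; first by apply/eqP => -[]; lia.
apply/hasP; exists ((a, b), (a + 1, b)).
  by case: sh nsh => //= _; rewrite !inE eqxx ?orbT.
by rewrite ea -eb /=; case: sh' nsh' => //= _; rewrite !inE eqxx ?orbT.
Qed.

(** The hypothesis excludes a square together with one of its own halves; these have sides in common
    but are never both fundamental. *)
Lemma share_edgeE (x y : cell) :
  (x.1 = y.1 -> (x.2 == Square) = (y.2 == Square)) ->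
  share_edge x y = on_top x y || on_top y x.
Proof.
move=> same; apply/idP/orP; last first.
  by case=> /on_top_share; rewrite // share_edge_sym.
move: same; case: x => -[a b] sh; case: y => -[a' b'] sh' /= same.
  move=> /andP[neq /hasP[e ex ey]].
  have K : (sh = Upper /\ sh' = Lower) \/ (sh = Lower /\ sh' = Upper) \/ ~ (a = a' /\ b = b').
    have [[ea eb]|nab] : (a = a' /\ b = b') \/ ~ (a = a' /\ b = b') by lia.
      move: same neq; rewrite ea eb => /(_ erefl).
      by clear; case: sh; case: sh' => //=; rewrite ?eqxx //; auto.
    by right; right.
  clear same neq; case: K => [[-> ->]|[[-> ->]|K]] in ex ey *.
  - by move: ex ey; rewrite /= !inE; (do ?[case/orP]) => /eqP ->; (do ?[case/orP]) => /eqP[] *; lia.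
  - by move: ex ey; rewrite /= !inE; (do ?[case/orP]) => /eqP ->; (do ?[case/orP]) => /eqP[] *; lia.
  by case: sh ex; case: sh' ey => /=; rewrite !inE;
    (do ?[case/orP]) => /eqP E1; (do ?[case/orP]) => /eqP; rewrite E1 => -[] *; lia.
Qed.

Lemma zigzag_geometry (q q' a b a' b' t : int) (i j m m' w w' : nat) :
  a = q + m%:Z -> b = q + m%:Z + (t - i%:Z) ->
  a' = q' + m'%:Z -> b' = q' + m'%:Z + (t - j%:Z) ->
  (j = i.+1 -> (w' = w.+1 /\ q' = q) \/ (w = w'.+1 /\ q' = q + 1)) ->
  ((j == i.+1) && zigzag w w' m m') =
    (a' == a + 1) && (b' == b) || (a' == a) && (b' + 1 == b).
Proof.
move=> ea eb ea' eb' h; rewrite /zigzag.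
have [ji|ji] := eqVneq j i.+1; last first.
  apply/esym/negbTE; apply/negP => /orP[] /andP[/eqP h1 /eqP h2]; move/eqP: ji; lia.
rewrite /=; case: (h ji) => -[-> eq]; rewrite ?ltnSn ?[(_.+1 < _)%N]ltnNge ?leqnSn /=.
  have -> : (m <= m' <= m.+1)%N = (m' == m.+1) || (m' == m) by lia.
  by congr (_ || _); apply/eqP/andP => [e|[/eqP h1 /eqP h2]]; 
    [split; apply/eqP; lia | lia | split; apply/eqP; lia | lia].
have -> : (m' <= m <= m'.+1)%N = (m' == m) || (m == m'.+1) by lia.
by congr (_ || _); apply/eqP/andP => [e|[/eqP h1 /eqP h2]]; 
    [split; apply/eqP; lia | lia | split; apply/eqP; lia | lia].
Qed.

(** * Tilings as matchings of the layered graph *)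

Section Count.
Variables (o : octagon) (black : pred cell) (s : boundary) (N : nat).
Hypothesis qo : quasi_octagon o black s.

Let n1 := sumn (upper_dist o).
Let n2 := sumn (middle_dist o).
Let n3 := sumn (lower_dist o).
Let L := (n1 + n2 + n3)%N.
Let top := top_diag o.
Local Notation wid := (wid o s).
Local Notation qx := (qx o s).
Local Notation pt_at := (pt_at o s).

Hypothesis wN : forall i, (i <= L)%N -> (wid i <= N)%N.

(** The absolute values only make the coordinates total; [cells_rowP] shows that they recover every
    cell of the region. *)
Definition row_idx (x : cell) : nat := `|top - diag x.1|%N.
Definition row_pos (x : cell) : nat := `|x.1.1 - qx (row_idx x)|%N.
Definition to_model (x : cell) : mcell N L :=
  (inord (row_idx x), x.2 != Upper, inord (row_pos x)).

Lemma cells_rowP x : x \in cells o s ->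
  [/\ (row_idx x <= L)%N, x.1 = pt_at (row_idx x) (row_pos x)%:Z,
     (row_pos x < wid (row_idx x))%N & shape_ok o (row_idx x) x.2].
Proof.
move=> /(cellsP qo)[i [iL dx qxw sh]].
have e : row_idx x = i by rewrite /row_idx dx -/top; lia.
rewrite /row_pos e; split=> //; last by lia.
move: dx qxw; rewrite /pt_at /diag; case: (x.1) => a b /= dx qxw; congr (_, _); lia.
Qed.

Lemma pt_at_idx i m sh : row_idx (pt_at i m, sh) = i.
Proof. by rewrite /row_idx diag_pt_at -/top; lia. Qed.

Lemma pt_at_pos i (m : nat) sh : row_pos (pt_at i m%:Z, sh) = m.
Proof. by rewrite /row_pos pt_at_idx /=; lia. Qed.

Lemma pt_at_cells i (m : nat) sh : (i <= L)%N -> (m < wid i)%N -> shape_ok o i sh ->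
  (pt_at i m%:Z, sh) \in cells o s.
Proof.
move=> iL mw sok; apply/(cellsP qo); exists i; split=> //=; first exact: diag_pt_at.
by lia.
Qed.

Lemma to_model_inj : {in cells o s &, injective to_model}.
Proof.
move=> x y /cells_rowP[iL xe mw sx] /cells_rowP[jL ye mw' sy] /eqP.
rewrite /to_model !xpair_eqE -!val_eqE /=.
have := leq_trans (ltnW mw) (wN iL); have := leq_trans (ltnW mw') (wN jL) => bx bY.
rewrite !inordK //.
move=> /andP[/andP[/eqP ei /eqP es] /eqP em].
rewrite [x]surjective_pairing [y]surjective_pairing xe ye ei em; congr (_, _).
by move: sx sy es; rewrite ei; case: (x.2); case: (y.2) => //= h1 h2; move: h1 h2; case: drawn_at.
Qed.

Lemma to_model_adj x y : x \in cells o s -> y \in cells o s ->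
  madj wid (drawn_at o) (to_model x) (to_model y) = share_edge x y.
Proof.
move=> xc yc; rewrite share_edgeE; last first.
  move=> exy; have [_ _ _] := cells_rowP xc; have [_ _ _] := cells_rowP yc.
  by rewrite /row_idx exy; case: (x.2); case: (y.2) => //=; case: drawn_at.
suff H u v : u \in cells o s -> v \in cells o s ->
    below wid (drawn_at o) (to_model u) (to_model v) = on_top u v.
  by rewrite /madj !H.
move=> /cells_rowP[iL ue mw su] /cells_rowP[jL ve mw' sv].
rewrite /below /to_model -[inord (row_idx u) == _]val_eqE -[inord (row_pos u) == _]val_eqE /=.
have := leq_trans (ltnW mw) (wN iL); have := leq_trans (ltnW mw') (wN jL) => bx bY.
rewrite !inordK // {bx bY}.
move: su sv ue ve mw mw' iL jL.
case: u => -[a b] sh; case: v => -[a' b'] sh' /=.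
set i := row_idx _; set j := row_idx _; set m := row_pos _; set m' := row_pos _.
move=> su sv [ea eb] [ea' eb'] mw mw' iL jL.
have zz := zigzag_geometry ea eb ea' eb' (w := wid i) (w' := wid j).
have {}zz := zz ltac:(by move=> ji; rewrite ji; apply: (wid_step qo); rewrite -ji).
have same : i = j -> (m == m') = (a' == a) && (b' == b).
  move=> ij; apply/eqP/andP => [mm|[/eqP h1 _]].
    by rewrite ea' eb' ea eb -mm ij !eqxx.
  by move: h1; rewrite ea ea' ij => /addrI [].
have {}zz : ((j == i.+1) && zigzag (wid i) (wid i.+1) m m') =
    (a' == a + 1) && (b' == b) || (a' == a) && (b' + 1 == b).
  by rewrite -zz; case: eqP => // ->.
have ij : (a' == a) && (b' == b) -> i = j by case/andP=> /eqP h1 /eqP h2; lia.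
clearbody i j m m'; case: (eqVneq sh Upper) => [shU|shU] /=.
  rewrite andbF orbF; move: su; rewrite shU /= => /andP[di _].
  rewrite di /=; case: (eqVneq i j) => [e|nij] /=.
    rewrite -same //; move: sv; rewrite -e; case: (sh') => //=; rewrite di ?orbF ?andbF ?orbT //.
  rewrite orbF; apply/esym/negbTE; apply/negP => /andP[_ h].
  by move/eqP: nij; apply; apply: ij.
rewrite !andbF /=.
have -> : [&& j == i.+1, (sh' != Upper) == ~~ drawn_at o j & zigzag (wid i) (wid i.+1) m m']
    = (sh' != Lower) && ((j == i.+1) && zigzag (wid i) (wid i.+1) m m').
  have -> : ((sh' != Upper) == ~~ drawn_at o j) = (sh' != Lower).
    by move: sv; case: (sh') => //=; case: drawn_at.
  by case: (_ == _); rewrite /= ?andbF.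
by rewrite zz.
Qed.

Lemma tilings_model :
  #|tilings (cells o s)|
  = #|matchings (@madj N L wid (drawn_at o)) (mvalid N L wid (drawn_at o))|.
Proof.
pose e (x y : cells o s) := share_edge (val x) (val y).
have -> : #|tilings (cells o s)| = #|matchings e [set: cells o s]|.
  by congr #|pred_of_set _|; apply/setP => T; rewrite !inE.
pose f (x : cells o s) := to_model (val x).
have fi : injective f by move=> x y /(to_model_inj (valP x) (valP y)) /val_inj.
rewrite -(@card_matchings_imset _ _ e (@madj N L wid (drawn_at o)) f) //.
- congr #|pred_of_set (matchings _ _)|; apply/setP => -[[j b] m].
  have jL : (j <= L)%N by rewrite -ltnS.
  apply/imsetP/idP => [[x _ [-> -> ->]]|].
    have [iL _ mw sok] := cells_rowP (valP x).
    have bx := leq_trans (ltnW mw) (wN iL).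
    rewrite inE /= !inordK // mw /=; move: sok; case: ((val x).2) => /=.
    - by move=> di; rewrite orbT andbF /=; apply/negP => /andP[/eqP e' _];
        move: di; rewrite e' (drawn_bottom o).
    - by move=> /andP[-> i0]; rewrite andbF gtn_eqF.
    by move=> /andP[-> iL']; rewrite andbF /= ltn_eqF.
  rewrite inE /= => /and4P[mw db j0 jL'].
  pose sh := if b then (if drawn_at o j then Lower else Square) else Upper.
  have sok : shape_ok o j sh.
    rewrite /sh; case: (b) db j0 jL' => /=; rewrite ?andbT ?andbF ?orbF.
      by case dj : (drawn_at o j) => _ _ jL' /=; rewrite dj //= ltn_neqAle jL' jL.
    by move=> -> /=; rewrite -lt0n.
  exists (FSetSub (pt_at_cells jL mw sok)); first by rewrite in_setT.
  apply/esym.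
  rewrite -[LHS]/(to_model (pt_at j (m : nat)%:Z, sh)) /to_model pt_at_idx pt_at_pos !inord_val.
  by congr (_, _, _); rewrite /sh; case: (b); case: drawn_at.
- by move=> x y; apply: share_edge_sym.
- by move=> x; apply: share_edge_irr.
- exact: madj_sym.
- exact: madj_irr.
by move=> x y _ _; apply: to_model_adj; apply: valP.
Qed.

End Count.

(** * Heights, widths and numbers of cells from the widths of the rows *)

Section Heights.
Variables (o : octagon) (black : pred cell) (s : boundary).
Hypothesis qo : quasi_octagon o black s.

Let n1 := sumn (upper_dist o).
Let n2 := sumn (middle_dist o).
Let n3 := sumn (lower_dist o).
Let L := (n1 + n2 + n3)%N.
Let top := top_diag o.
Local Notation wid := (wid o s).
Local Notation qx := (qx o s).
Local Notation pt_at := (pt_at o s).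

Lemma in_row_of x y : (y \in row_of o black s x) =
  [&& y \in cells o s, (y.2 == Square) == (x.2 == Square),
      diag y.1 == diag x.1 & black y == black x].
Proof. by rewrite /row_of in_fset inE. Qed.

Section Rows.
Variables (X : {fset cell}) (ks : seq nat) (sh : nat -> Defs.shape) (col : nat -> bool).
Hypothesis ks_uniq : uniq ks.
Hypothesis ks_le : forall i, i \in ks -> (i <= L)%N /\ shape_ok o i (sh i).
Hypothesis memX : forall x, (x \in X) =
  [&& x \in cells o s, row_idx o x \in ks & x.2 == sh (row_idx o x)].
Hypothesis colX : forall x, x \in X -> black x = col (row_idx o x).

Lemma card_rows : #|` X| = (\sum_(i <- ks) wid i)%N.
Proof.
pose t := [seq (pt_at i (m : nat)%:Z, sh i) | i <- ks, m <- iota 0 (wid i)].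
have -> : #|` X| = size t.
  apply: perm_size; apply: uniq_perm; first exact: fset_uniq.
    apply: allpairs_uniq_dep => // [i _|]; first exact: iota_uniq.
    move=> [i m] [j k] _ _ /= e.
    have := pt_at_idx o s i m%:Z (sh i); rewrite e pt_at_idx => ij.
    have := pt_at_pos o s i m (sh i); rewrite e pt_at_pos => mk.
    by rewrite ij mk.
  move=> x; rewrite memX; apply/and3P/allpairsPdep => [[xc xk /eqP xs]|[i [m [ik + ->]]]].
    have [iL xe mw sok] := cells_rowP qo xc.
    exists (row_idx o x), (row_pos o s x); split=> //; first by rewrite mem_iota.
    by rewrite -xs -xe -surjective_pairing.
  rewrite mem_iota add0n => /= mw; have [iL sok] := ks_le ik.
  by rewrite pt_at_idx eqxx ik (pt_at_cells qo).
rewrite size_allpairs_dep sumnE big_map.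
by apply: eq_bigr => i _; rewrite size_iota.
Qed.

Lemma nb_rows_size : nb_rows o black s X = size ks.
Proof.
pose r i := row_of o black s (pt_at i 0, sh i).
have cX i : i \in ks -> (pt_at i 0, sh i) \in X.
  move=> ik; have [iL sok] := ks_le ik.
  rewrite memX -[0]/(0%N%:Z) pt_at_idx ik eqxx (pt_at_cells qo) //.
  exact: (wid_gt0 qo).
have rE x : x \in X -> row_of o black s x = r (row_idx o x).
  move=> xX; have /and3P[xc xk /eqP xs] :
      [&& x \in cells o s, row_idx o x \in ks & x.2 == sh (row_idx o x)] by rewrite -memX.
  rewrite /r; apply/fsetP => y; rewrite !in_row_of /=.
  rewrite xs (colX xX) (colX (cX _ xk)) -[0]/(0%N%:Z) pt_at_idx diag_pt_at.
  suff -> : diag x.1 = top_diag o - (row_idx o x)%:Z by [].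
  by have [_ -> _ _] := cells_rowP qo xc; rewrite diag_pt_at.
rewrite -(size_map r); apply: perm_size; apply: uniq_perm; first exact: fset_uniq.
  rewrite map_inj_in_uniq // => i j ik jk e.
  have : (pt_at i 0, sh i) \in r i.
    rewrite /r in_row_of !eqxx !andbT.
    by have := cX i ik; rewrite memX => /and3P[].
  rewrite e in_row_of /= => /andP[_ /and3P[_ /eqP + _]].
  by rewrite !diag_pt_at; lia.
move=> R; apply/imfsetP/mapP => /= [[x xX ->]|[i ik ->]].
  rewrite rE //; exists (row_idx o x) => //.
  by move: xX; rewrite memX => /and3P[].
by exists (pt_at i 0, sh i); rewrite ?cX.
Qed.
End Rows.

Lemma size_filter_sum (P : pred nat) a b :
  size [seq k <- iota a (b - a) | P k] = (\sum_(a <= k < b) P k)%N.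
Proof. by rewrite size_filter -sum1_count big_mkcond; apply: eq_bigr => k _; case: (P k). Qed.

Definition up_rows a b : seq nat :=
  [seq k.+1 | k <- [seq k <- iota a (b - a) | (wid k < wid k.+1)%N]].

Lemma up_rows_uniq a b : uniq (up_rows a b).
Proof. by rewrite map_inj_uniq; [apply/filter_uniq/iota_uniq | apply: succn_inj]. Qed.

Lemma mem_up_rows a b i : (i \in up_rows a b) = [&& (a < i <= b)%N & (wid i.-1 < wid i)%N].
Proof.
apply/mapP/idP => [[k + ->]|/andP[/andP[ai ib] wi]].
  by rewrite mem_filter mem_iota /= => /andP[-> h]; rewrite andbT; lia.
exists i.-1; last by lia.
by rewrite mem_filter mem_iota prednK ?wi //; lia.
Qed.

Lemma size_up_rows a b : size (up_rows a b) = ups wid a b.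
Proof. by rewrite size_map size_filter_sum. Qed.

Lemma sum_up_rows a b : (\sum_(i <- up_rows a b) wid i)%N = up_total wid a b.
Proof. by rewrite big_map big_filter. Qed.

Lemma high_ok i : (0 < i)%N -> shape_ok o i (high o i).
Proof. by move=> i0; rewrite /high; case di: drawn_at; rewrite /= di. Qed.

Lemma low_ok i : (i < L)%N -> shape_ok o i (low o i).
Proof. by move=> i0; rewrite /low; case di: drawn_at; rewrite /= di. Qed.

Lemma n2_gt0 : (0 < n2)%N.
Proof.
rewrite /n2; have := middle_nonempty qo; have := middle_gt0 qo.
by case: (middle_dist o) => //= a l /andP[a0 _] _; rewrite ltn_addr.
Qed.

Lemma L_gt0 : (0 < L)%N.
Proof. by have := n2_gt0; rewrite /L; lia. Qed.

(** Above l the regular triangles are the [Upper] ones, and by [wid_color] their row on diagonal [i]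
    is black exactly when the step from [i.-1] widens the region. *)
Lemma upper_cellsE x : (x \in upper_cells o black s) =
  [&& x \in cells o s, row_idx o x \in up_rows 0 n1 & x.2 == high o (row_idx o x)].
Proof.
rewrite /upper_cells in_fset inE /=; case xc: (x \in cells o s) => //=.
have [iL xe mw sok] := cells_rowP qo xc.
have n20 := n2_gt0.
move: sok; rewrite mem_up_rows.
have dx : diag x.1 = top - (row_idx o x)%:Z by rewrite xe diag_pt_at.
move: dx iL; move: (row_idx o x) => i dx iL sok.
rewrite [LHS]andbA.
have -> : in_upper o x && regular_cell o x =
    (x.2 == high o i) && (0 < i <= n1)%N.
  have := ell_top o; have := ell'_top o; rewrite /in_upper /regular_cell -/top -/n1 -/n2 => -> ->.
  have d1 := drawn_ell o; have d0 := drawn_top o.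
  move: dx sok d1; rewrite /diag /high; case: x {xc xe mw} => -[a b] [] /= dx sok d1.
  - rewrite /diag /= (negPf sok) /= andbT.
    have i0 : i <> 0%N by move=> e; rewrite e d0 in sok.
    have i1 : i <> n1 by move=> e; rewrite e d1 in sok.
    by lia.
  - by case/andP: sok => -> i0; rewrite /diag /=; lia.
  by case/andP: sok => -> i0; rewrite /diag /=; lia.
case: eqP => /= xh; last by rewrite !andbF.
rewrite andbT; case: (boolP (0 < i <= n1)%N) => //= ii.
have e : i.-1.+1 = i by lia.
have iL' : (i.-1 < L)%N by rewrite /L; lia.
have in1 : (i.-1 < n1)%N by lia.
have := wid_color qo iL'; rewrite -/n1 in1 e /= => ->.
rewrite [x]surjective_pairing xh.
by have := @black_high _ _ _ qo i.-1 x.1; rewrite e => ->.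
Qed.

Lemma middle_cellsE x : (x \in middle_cells o black s) =
  [&& x \in cells o s, row_idx o x \in up_rows n1 (n1 + n2) & x.2 == high o (row_idx o x)].
Proof.
rewrite /middle_cells in_fset inE /=; case xc: (x \in cells o s) => //=.
have [iL xe mw sok] := cells_rowP qo xc.
have n20 := n2_gt0.
move: sok; rewrite mem_up_rows.
have dx : diag x.1 = top - (row_idx o x)%:Z by rewrite xe diag_pt_at.
move: dx iL; move: (row_idx o x) => i dx iL sok.
rewrite [LHS]andbA.
have -> : in_middle o x && regular_cell o x =
    (x.2 == high o i) && (n1 < i <= n1 + n2)%N.
  have := ell_top o; have := ell'_top o; rewrite /in_middle /regular_cell -/top -/n1 -/n2 => -> ->.
  have d1 := drawn_ell o; have d2 := drawn_ell' o; rewrite -/n1 -/n2 in d1 d2.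
  move: dx sok d1 d2; rewrite /diag /high; case: x {xc xe mw} => -[a b] [] /= dx sok d1 d2.
  - rewrite /diag /= (negPf sok) /= andbT.
    have i0 : i <> n1 by move=> e; rewrite e d1 in sok.
    have i1 : i <> (n1 + n2)%N by move=> e; rewrite e d2 in sok.
    by lia.
  - by case/andP: sok => -> i0; rewrite /diag /=; lia.
  by case/andP: sok => -> i0; rewrite /diag /=; lia.
case: eqP => /= xh; last by rewrite !andbF.
rewrite andbT; case: (boolP (n1 < i <= n1 + n2)%N) => //= ii.
have e : i.-1.+1 = i by lia.
have iL' : (i.-1 < L)%N by rewrite /L; lia.
have := wid_color qo iL'; rewrite -/n1 -/n2.
have -> : ((i.-1 < n1) || (n1 + n2 <= i.-1))%N = false by lia.
rewrite e => ->.
rewrite [x]surjective_pairing xh.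
by have := @black_high _ _ _ qo i.-1 x.1; rewrite e => ->.
Qed.

Let v k := wid (L - k).
Definition low_rows : seq nat :=
  [seq (L - k.+1)%N | k <- [seq k <- iota 0 n3 | (v k < v k.+1)%N]].

Lemma low_rows_uniq : uniq low_rows.
Proof.
rewrite map_inj_in_uniq; first by apply/filter_uniq/iota_uniq.
by move=> i j; rewrite !mem_filter !mem_iota /L; lia.
Qed.

Lemma mem_low_rows i : (i \in low_rows) = [&& (n1 + n2 <= i < L)%N & (wid i.+1 < wid i)%N].
Proof.
apply/mapP/idP => [[k + ->]|/andP[/andP[ai ib] wi]].
  rewrite mem_filter mem_iota /v => /andP[h kn].
  have kL : (k < L)%N by rewrite /L; lia.
  by rewrite subnSK // h andbT; move: kL kn; rewrite /L; lia.
exists (L - i.+1)%N; last by lia.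
rewrite mem_filter mem_iota /v.
have -> : (L - (L - i.+1))%N = i.+1 by lia.
have -> : (L - (L - i.+1).+1)%N = i by lia.
by rewrite wi /=; move: ai ib; rewrite /L; lia.
Qed.

Lemma size_low_rows : size low_rows = ups v 0 n3.
Proof. by rewrite size_map /ups -size_filter_sum subn0. Qed.

Lemma sum_low_rows : (\sum_(i <- low_rows) wid i)%N = up_total v 0 n3.
Proof. by rewrite big_map big_filter /up_total /index_iota subn0. Qed.

(** Below l' the regular triangles are the [Lower] ones, and the black rows are those reached by a
    widening step when the region is read upwards, as in [v]. *)
Lemma lower_cellsE x : (x \in lower_cells o black s) =
  [&& x \in cells o s, row_idx o x \in low_rows & x.2 == low o (row_idx o x)].
Proof.
rewrite /lower_cells in_fset inE /=; case xc: (x \in cells o s) => //=.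
have [iL xe mw sok] := cells_rowP qo xc.
have n20 := n2_gt0.
move: sok; rewrite mem_low_rows.
have dx : diag x.1 = top - (row_idx o x)%:Z by rewrite xe diag_pt_at.
move: dx iL; move: (row_idx o x) => i dx iL sok.
rewrite [LHS]andbA.
have -> : in_lower o x && regular_cell o x =
    (x.2 == low o i) && (n1 + n2 <= i < L)%N.
  have := ell'_top o; rewrite /in_lower /regular_cell -/top -/n1 -/n2 => ->.
  have d1 := drawn_bottom o; have d2 := drawn_ell' o; rewrite -/n1 -/n2 -/n3 -/L in d1 d2.
  move: dx iL sok d1 d2; rewrite /diag /low; case: x {xc xe mw} => -[a b] [] /= dx iL sok d1 d2.
  - rewrite /diag /= (negPf sok) /= andbT.
    have i0 : i <> L by move=> e; rewrite e d1 in sok.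
    have i1 : i <> (n1 + n2)%N by move=> e; rewrite e d2 in sok.
    by rewrite -/L in iL; lia.
  - by case/andP: sok => -> i0; rewrite /diag /=; lia.
  by case/andP: sok => -> i0; rewrite -/L in i0; rewrite /diag /=; lia.
case: eqP => /= xh; last by rewrite !andbF.
rewrite andbT; case: (boolP (n1 + n2 <= i < L)%N) => //= ii.
have iL' : (i < L)%N by lia.
have := wid_color qo iL'; rewrite -/n1 -/n2.
have -> : ((i < n1) || (n1 + n2 <= i))%N by lia.
rewrite [x]surjective_pairing xh (black_low qo) // => <-.
by case: (wid_step qo iL') => -[-> _]; rewrite ltnSn ltnNge leqnSn.
Qed.

Lemma upper_card : #|` upper_cells o black s| = up_total wid 0 n1.
Proof.
rewrite -sum_up_rows; apply: (card_rows (sh := high o) (up_rows_uniq _ _) _ upper_cellsE).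
by move=> i; rewrite mem_up_rows => h; split; [rewrite /L; lia | apply: high_ok; lia].
Qed.

Lemma middle_card : #|` middle_cells o black s| = up_total wid n1 (n1 + n2).
Proof.
rewrite -sum_up_rows; apply: (card_rows (sh := high o) (up_rows_uniq _ _) _ middle_cellsE).
by move=> i; rewrite mem_up_rows => h; split; [rewrite /L; lia | apply: high_ok; lia].
Qed.

Lemma lower_card : #|` lower_cells o black s| = up_total v 0 n3.
Proof.
rewrite -sum_low_rows; apply: (card_rows (sh := low o) low_rows_uniq _ lower_cellsE).
by move=> i; rewrite mem_low_rows => h; split; [lia | apply: low_ok; lia].
Qed.

Lemma upper_heightE : upper_height o black s = ups wid 0 n1.
Proof.
rewrite -size_up_rows.
apply: (nb_rows_size (sh := high o) (col := fun=> true) (up_rows_uniq _ _) _ upper_cellsE).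
  by move=> i; rewrite mem_up_rows => h; split; [rewrite /L; lia | apply: high_ok; lia].
by move=> x; rewrite /upper_cells in_fset inE => /and4P[].
Qed.

Lemma middle_heightE : middle_height o black s = ups wid n1 (n1 + n2).
Proof.
rewrite -size_up_rows.
apply: (nb_rows_size (sh := high o) (col := fun=> false) (up_rows_uniq _ _) _ middle_cellsE).
  by move=> i; rewrite mem_up_rows => h; split; [rewrite /L; lia | apply: high_ok; lia].
by move=> x; rewrite /middle_cells in_fset inE => /and4P[_ _ _ /negPf].
Qed.

Lemma lower_heightE : lower_height o black s = ups v 0 n3.
Proof.
rewrite -size_low_rows.
apply: (nb_rows_size (sh := low o) (col := fun=> true) low_rows_uniq _ lower_cellsE).
  by move=> i; rewrite mem_low_rows => h; split; [lia | apply: low_ok; lia].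
by move=> x; rewrite /lower_cells in_fset inE => /and4P[].
Qed.

Lemma upper_widthE : upper_width o s = wid n1.
Proof. by rewrite /upper_width -(ne_pt_B qo). Qed.

Lemma lower_widthE : lower_width o s = wid (n1 + n2).
Proof. by rewrite /lower_width -(ne_pt_C qo). Qed.

End Heights.

(** * The formula *)

Local Open Scope fset_scope.
Local Open Scope ring_scope.

Section DeltaV.
Variable N : nat.
Local Notation st := {set 'I_N.+1}.
Local Notation ivl := (@ivl N).
Implicit Types (B D : st) (n m : nat).

(* Positions are counted from 0, the elements of [interval1] from 1. *)
Definition to_fset D : {fset int} := [fset (nat_of_ord x).+1%:Z | x in D].

Lemma to_fsetP D z : reflect (exists2 x : 'I_N.+1, x \in D & z = x.+1%:Z) (z \in to_fset D).
Proof. by apply: (iffP (imfsetP _ _ _ _)) => -[x xD ->]; exists x. Qed.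

Lemma mem_to_fset D (x : 'I_N.+1) : (x.+1%:Z \in to_fset D) = (x \in D).
Proof.
apply/to_fsetP/idP => [[y yD [e]]|xD]; last by exists x.
by have -> : x = y by apply: val_inj.
Qed.

Lemma perm_to_fset D : perm_eq (to_fset D) [seq k.+1%:Z | k <- [seq val x | x <- enum D]].
Proof.
apply: uniq_perm; first exact: fset_uniq.
  by rewrite -map_comp map_inj_uniq ?enum_uniq // => x y [] /val_inj.
move=> z; rewrite -map_comp; apply/to_fsetP/mapP => -[x].
  by move=> xD ->; exists x; rewrite ?mem_enum.
by rewrite mem_enum => xD ->; exists x.
Qed.

Lemma card_to_fset D : #|` to_fset D| = #|D|.
Proof. by rewrite (perm_size (perm_to_fset D)) !size_map -cardE. Qed.

Lemma to_fset_inj : injective to_fset.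
Proof. by move=> D D' e; apply/setP => x; rewrite -!mem_to_fset e. Qed.

Lemma Delta_to_fset D : (Delta (to_fset D))%:~R = vdm D * (superfact #|D|)%:R :> rat.
Proof.
rewrite /vdm binom_det_vandermonde /Delta.
set l := [seq val x | x <- enum D].
have sl : size l = #|D| by rewrite size_map -cardE.
rewrite (perm_big _ (perm_to_fset D)) big_map -/l.
under eq_bigr do rewrite (perm_big _ (perm_to_fset D)) big_map -/l.
rewrite (big_nth 0%N) sl big_mkord rmorph_prod /=; apply: eq_bigr => i _.
rewrite (big_nth 0%N) sl big_mkord rmorph_prod /=.
have lt (j : 'I_#|D|) : (nth 0%N l i < nth 0%N l j)%N = (i < j)%N.
  have [ij|ji|e] := ltngtP i j; first by apply: pt_ltn.
    by apply/negbTE; rewrite -leqNgt; apply/ltnW/pt_ltn.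
  by rewrite e ltnn.
apply: eq_big => j; first by rewrite -lt ltz_nat ltnS.
have S (p q : nat) : p.+1%:Z - q.+1%:Z = p%:Z - q%:Z by lia.
by move=> _; rewrite S rmorphB /= -!pmulrn.
Qed.

Lemma V_ivl m : (m <= N.+1)%N -> vdm (ivl m) = 1.
Proof.
move=> mN; rewrite /vdm card_ivl // /binom_det -det_tr.
have pE i : (i < m)%N -> pt (ivl m) i = i.
  move=> im; rewrite /pt.
  have -> : [seq val x | x <- enum (ivl m)] = iota 0 m.
    apply: (irr_sorted_eq ltn_trans ltnn); [exact: sorted_enum_val|exact: iota_ltn_sorted|].
    move=> k; rewrite mem_iota; apply/mapP/idP => [[x + ->]|km].
      by rewrite mem_enum inE.
    have kN : (k < N.+1)%N by lia.
    by exists (Ordinal kN); rewrite // mem_enum inE.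
  by rewrite nth_iota.
rewrite det_trig.
  by rewrite big1 // => i _; rewrite !mxE pE // binn.
by apply/is_trig_mxP => i j ij; rewrite !mxE pE // bin_small.
Qed.

Lemma interval1E m : (m <= N.+1)%N -> interval1 m = to_fset (ivl m).
Proof.
move=> mN; apply/fsetP => z; apply/imfsetP/to_fsetP => /= [[i]|[x]].
  rewrite mem_iota => im ->; have iN : (i.-1 < N.+1)%N by lia.
  by exists (Ordinal iN); rewrite ?inE /= ?prednK //; lia.
by rewrite inE => xm ->; exists x.+1; rewrite // mem_iota; lia.
Qed.

(** Both products contain the same superfactorial, which cancels because [vdm] of an initial
    interval is 1. *)
Lemma Delta_ratio D : (Delta (to_fset D))%:~R / (Delta (interval1 #|D|))%:~R = vdm D.
Proof.
have DN : (#|D| <= N.+1)%N by rewrite -[X in (_ <= X)%N]card_ord max_card.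
rewrite interval1E // !Delta_to_fset V_ivl // card_ivl // mul1r mulfK //.
rewrite pnatr_eq0 /superfact -lt0n prodn_gt0 // => i; exact: fact_gt0.
Qed.

Lemma to_fsetD n j B : (n + 2 * j <= N.+1)%N -> B \subset ivl n ->
  interval1 (n + 2 * j) `\` translate j%:Z (to_fset B)
  = to_fset (ivl (n + 2 * j) :\: shift j B).
Proof.
move=> nN Bn; rewrite interval1E //; apply/fsetP => z; rewrite in_fsetD.
have nj : (n + j <= N.+1)%N by lia.
apply/andP/to_fsetP => [[zt /to_fsetP[x xn zE]]|[x + ->]].
  exists x => //; rewrite in_setD xn andbT.
  apply: contra zt => /imsetP[y yB xE].
  have := subsetP Bn _ yB; rewrite inE => yn.
  apply/imfsetP; exists (y.+1%:Z) => /=; first by rewrite mem_to_fset.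
  by rewrite zE xE inordK; lia.
rewrite in_setD => /andP[xB xn]; rewrite mem_to_fset xn; split=> //.
apply: contra xB => /imfsetP[z' /= /to_fsetP[y yB ->] e].
have := subsetP Bn _ yB; rewrite inE => yn.
apply/imsetP; exists y => //; apply: val_inj; rewrite /= inordK; lia.
Qed.

Lemma card_frozen n j B : (n + 2 * j <= N.+1)%N -> B \subset ivl n ->
  #|ivl (n + 2 * j) :\: shift j B| = (n + 2 * j - #|B|)%N.
Proof.
move=> nN Bn; have nj : (n + j <= N.+1)%N by lia.
have sB : shift j B \subset ivl (n + 2 * j).
  by apply: subset_trans (shift_sub nj Bn) _; apply/subsetP => x; rewrite !inE; lia.
have := card_compl nN sB.
rewrite -(cnt_max sB (leqnn _)) (cnt_shift _ nj Bn) (cnt_max Bn); last by lia.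
by move: #|_ :\: _| => k <-; rewrite addnK.
Qed.

Lemma sum_splittings n a b (F : {fset int} * {fset int} -> rat) : (n <= N.+1)%N ->
  \sum_(AB <- fpowerset (interval1 n) `*` fpowerset (interval1 n)
         | [&& [disjoint AB.1 & AB.2]%fset, AB.1 `|` AB.2 == interval1 n,
               #|` AB.1| == a & #|` AB.2| == b]) F AB
  = \sum_(B : st | [&& B \subset ivl n, #|B| == b & #|ivl n :\: B| == a])
      F (to_fset (ivl n :\: B), to_fset B).
Proof.
move=> nN; rewrite -big_filter; set P := fun AB => _.
rewrite -[RHS]big_filter.
rewrite -(big_map (fun B : st => (to_fset (ivl n :\: B), to_fset B)) predT F).
apply: perm_big; apply: uniq_perm.
- by apply/filter_uniq/fset_uniq.
- rewrite map_inj_uniq ?filter_uniq ?index_enum_uniq // => B B' [_ /to_fset_inj] //.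
move=> [A B]; rewrite mem_filter in_fsetM !fpowersetE /P /= interval1E //.
apply/idP/mapP => [/andP[/and4P[dAB /eqP uAB cA cB] /andP[An Bn]]|[B' + [-> ->]]].
  pose B' : st := [set x : 'I_N.+1 | x.+1%:Z \in B].
  have BE : B = to_fset B'.
    apply/fsetP => z; apply/idP/to_fsetP => [zB|[x + ->]]; last by rewrite inE.
    by have /to_fsetP[x _ e] := fsubsetP Bn _ zB; exists x => //; rewrite inE -e.
  have AE : A = to_fset (ivl n :\: B').
    apply/fsetP => z; apply/idP/to_fsetP => [zA|[x + ->]].
      have /to_fsetP[x xn e] := fsubsetP An _ zA; exists x => //.
      rewrite in_setD xn andbT inE -e.
      by have /fdisjointP/(_ _ zA) := dAB.
    rewrite in_setD inE => /andP[xB xn].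
    have : x.+1%:Z \in A `|` B by rewrite uAB mem_to_fset.
    by rewrite in_fsetU (negPf xB) orbF.
  exists B'; last by rewrite AE BE.
  rewrite mem_filter mem_index_enum andbT -!card_to_fset -AE -BE cA cB !andbT.
  apply/subsetP => x; rewrite inE => xB.
  by rewrite -mem_to_fset; apply: (fsubsetP Bn).
rewrite mem_filter mem_index_enum andbT => /and3P[Bn cB cA].
rewrite !card_to_fset cA cB !andbT; apply/andP; split; apply/andP; split.
- apply/fdisjointP => z /to_fsetP[x]; rewrite in_setD => /andP[xB _] ->.
  by rewrite mem_to_fset.
- apply/eqP/fsetP => z; rewrite in_fsetU; apply/orP/to_fsetP => [[/to_fsetP[x]|/to_fsetP[x]]|[x xn ->]].
  + by rewrite in_setD => /andP[_ xn] ->; exists x.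
  + by move=> xB ->; exists x => //; apply: (subsetP Bn).
  by rewrite !mem_to_fset in_setD xn andbT; case: (x \in B'); [right|left].
- by apply/fsubsetP => z /to_fsetP[x]; rewrite in_setD => /andP[_ xn] ->; rewrite mem_to_fset.
by apply/fsubsetP => z /to_fsetP[x xB ->]; rewrite mem_to_fset (subsetP Bn).
Qed.
End DeltaV.

Theorem theorem3p4 :
  forall (o : octagon) (black : pred cell) (s : boundary),
  quasi_octagon o black s ->
  forall h1 h2 h3 w1 w2 C1 C2 C3 : nat,
  h1 = upper_height o black s ->
  h2 = middle_height o black s ->
  h3 = lower_height o black s ->
  w1 = upper_width o s ->
  w2 = lower_width o s ->
  (w2 < w1)%N -> (h1 < w1)%N -> (h2 < w2)%N -> (h3 < w2)%N ->
  C1 = #|` upper_cells o black s| ->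
  C2 = #|` middle_cells o black s| ->
  C3 = #|` lower_cells o black s| ->
  ((h1 + h3 <> w1 + h2)%N -> #|tilings (cells o s)| = 0%N)
  /\
  ((h1 + h3 = w1 + h2)%N ->
   (#|tilings (cells o s)|)%:R =
   (2 : rat) ^ ((C1 + C2 + C3)%:Z
                - (h1 * (2 * w1 - h1 + 1) %/ 2)%N%:Z
                - (h2 * (2 * w2 - h2 + 1) %/ 2)%N%:Z
                - (h3 * (2 * w2 - h3 + 1) %/ 2)%N%:Z)
   * \sum_(AB <- fpowerset (interval1 (w2 - h2)) `*` fpowerset (interval1 (w2 - h2))
            | [&& [disjoint AB.1 & AB.2]%fset,
                  AB.1 `|` AB.2 == interval1 (w2 - h2),
                  #|` AB.1| == (w2 - h3)%N
                & #|` AB.2| == (w1 - h1)%N])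
       ((Delta (interval1 (h2 + 2 * w1 - w2)
                `\` translate (h2 + w1 - w2)%N%:Z AB.2))%:~R
        / (Delta (interval1 (h1 + h2 + w1 - w2)))%:~R
        * ((Delta (interval1 (w2 + h2) `\` translate h2%:Z AB.1))%:~R
           / (Delta (interval1 (h2 + h3)))%:~R))).
Proof.
move=> o black s qo h1 h2 h3 w1 w2 C1 C2 C3.
rewrite (upper_heightE qo) (middle_heightE qo) (lower_heightE qo).
rewrite (upper_widthE qo) (lower_widthE qo) (upper_card qo) (middle_card qo) (lower_card qo).
set n1 := sumn (upper_dist o); set n2 := sumn (middle_dist o); set n3 := sumn (lower_dist o).
set w := wid o s; set L := (n1 + n2 + n3)%N; pose v k := w (L - k)%N.
rewrite -/(v) => h1E h2E h3E w1E w2E w21 hw1 hw2 hw3 C1E C2E C3E.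
have nb : nearby w 0 L := wid_nearby qo.
have nb1 : nearby w 0 n1 by move=> k kn; apply: nb; rewrite /L; lia.
have nb2 : nearby w n1 (n1 + n2) by move=> k kn; apply: nb; rewrite /L; lia.
have nb3 : nearby v 0 n3.
  move=> k kn; have kL : (k < L)%N by rewrite /L; lia.
  by rewrite /v -(subnSK kL); case: (nb (L - k.+1)%N); [lia|right|left].
have vE : v n3 = w2 by rewrite w2E /v /L addnK.
have JE := width_ups (leq_addr n2 n1) nb2; rewrite -w1E -w2E -h2E in JE.
set J := downs w n1 (n1 + n2) in JE.
pose N := (\max_(i < L.+1) w i + 2 * (w1 + h2))%N.
have wN i : (i <= L)%N -> (w i <= N)%N.
  move=> iL; apply: (@leq_trans (\max_(i < L.+1) w i)); last exact: leq_addr.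
  exact: (leq_bigmax (Ordinal (iL : (i < L.+1)%N))).
have bw1 : (w1 + 2 * (w1 + h2) <= N)%N.
  rewrite /N leq_add2r w1E; have n1L : (n1 < L.+1)%N by rewrite ltnS /L; lia.
  exact: (leq_bigmax (Ordinal n1L)).
have wc i : (i < L)%N -> (w i < w i.+1)%N =
    if ((i < n1) || (n1 + n2 <= i))%N then white o black s i else ~~ white o black s i.
  exact: wid_color.
have white_up i : (i < n1)%N -> white o black s i = (w i < w i.+1)%N.
  by move=> i1; rewrite wc ?i1 // /L; lia.
have white_mid i : (n1 <= i < n1 + n2)%N -> white o black s i = ~~ (w i < w i.+1)%N.
  move=> i1; rewrite wc; last by rewrite /L; lia.
  have -> : ((i < n1) || (n1 + n2 <= i))%N = false by lia.
  by rewrite negbK.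
have white_low i : (n1 + n2 <= i < L)%N -> white o black s i = (w i < w i.+1)%N.
  move=> i1; rewrite wc; last by lia.
  by have -> : ((i < n1) || (n1 + n2 <= i))%N by lia.
have count := @model_formula N w (drawn_at o) (white o black s) n1 n2 n3
  (L_gt0 qo) (drawn_bottom o) wN nb (white_top qo) (fun i _ => white_next qo i)
  (white_bottom qo) white_up white_mid white_low (w2 - h2)%N.
cbv zeta in count; rewrite -/L -/v -/J in count.
rewrite -h1E -h2E -w1E -h3E -(tilings_model qo wN) in count.
have {}count := count ltac:(lia) ltac:(lia) ltac:(lia) ltac:(lia).
split=> [h|h].
  (* Part (a): the two prescribed values of #|B| are incompatible, so the sum is empty. *)
  apply/eqP; rewrite -(pnatr_eq0 rat) count big1 ?mulr0 // => B /and3P[_ /eqP cB].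
  by rewrite cB => /eqP; lia.
rewrite count; have JE' : J = (h2 + w1 - w2)%N by lia.
have T1 := up_total_du (leq0n n1) nb1; rewrite -h1E -w1E -C1E in T1.
have T2 := up_total_ud (leq_addr n2 n1) nb2; rewrite -h2E -w2E -C2E in T2.
have T3 := up_total_du (leq0n n3) nb3; rewrite -h3E vE -C3E in T3.
congr (_ * _).
  rewrite (half_triangle (ltnW hw1) T1) (half_triangle (ltnW hw2) T2) (half_triangle (ltnW hw3) T3).
  by rewrite exprnP; congr (_ ^ _); lia.
have nN : (w2 - h2 <= N.+1)%N by lia.
rewrite (sum_splittings _ _ _ nN).
apply: eq_big => [B|B /and3P[Bn /eqP cB _]].
  case Bn: (B \subset _) => //=; case: eqP => //= cB.
  have := card_compl nN Bn; rewrite cB; move: #|_| => k c.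
  by apply/eqP/eqP; lia.
have cA : #|ivl N (w2 - h2) :\: B| = (w2 - h3)%N.
  by have := card_compl nN Bn; rewrite cB; lia.
(* The two intervals of the formula are the narrowest row enlarged by [J] and by [h2] positions at
   each end. Their sizes minus those of [B] and [A] are the lengths in the denominators. *)
have e1 : (h2 + 2 * w1 - w2 = w2 - h2 + 2 * J)%N by lia.
have e2 : (w2 + h2 = w2 - h2 + 2 * h2)%N by lia.
have b1 : (w2 - h2 + 2 * J <= N.+1)%N by lia.
have b2 : (w2 - h2 + 2 * h2 <= N.+1)%N by lia.
rewrite /= -JE' e1 e2 (to_fsetD b1 Bn) (to_fsetD b2 (subsetDl _ _)) /frozen_vdm -!Delta_ratio.
rewrite !card_frozen ?subsetDl // cA cB.
by congr (_ / (Delta (interval1 _))%:~R * (_ / (Delta (interval1 _))%:~R)); lia.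
Qed.
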